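(* Let $(\Omega,\mathcal F,\mathbb P)$ be a probability space with a filtration $\mathbb F=(\mathcal F_t)_{t\ge 0}$ satisfying the usual conditions, and let $0<L<U$ be constants. Assume: (i) $\nu$ is a discrete probability measure on $\mathbb R$ with $\nu(\{0\})=0$ and $\int_{\mathbb R}|\xi|\,\nu(d\xi)<\infty$; let $\operatorname{Atom}(\nu)$ be the set of $x\in\mathbb R$ with $\nu(\{x\})>0$. (ii) $\eta$ is an $\mathbb F$-predictable process with $L\le\eta\le U$ $(\mathbb P\otimes dt)$-a.e.; moreover, there exist $\alpha\in(0,1]$ and, for each $T>0$, a constant $C_T>0$ such that $\mathbb E[|\eta_t-\eta_s|]\le C_T|t-s|^\alpha$ for all $s,t\in[0,T]$. (iii) $\lambda:\mathbb R_+\times\operatorname{FS}(\operatorname{Atom}(\nu))\to\mathbb R_+$ is a measurable function such that $L\le\lambda(\cdot,x)\le U$ Lebesgue-a.e. for each $x\in\operatorname{FS}(\operatorname{Atom}(\nu))$. Suppose that $\Omega$ supports a sequence of i.i.d. $\operatorname{Exp}(1)$ random variables $(E_k)_{k\ge1}$ and a sequence of i.i.d. $\nu$-distributed random variables $(J_k)_{k\ge1}$ such that $\mathcal F_\infty$, $(E_k)_{k\ge1}$ and $(J_k)_{k\ge1}$ are independent. Then there exist an enlarged filtration $\mathbb G\supseteq\mathbb F$ on $\Omega$ (satisfying the usual conditions) and a $\mathbb G$-adapted pure jump process $X$ starting from $0$ whose jump measure has $\mathbb G$-compensator $$\frac{\eta_t}{\mathbb E[\eta_t\mid X_{t-}]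}\,\lambda(t,X_{t-})\,\nu(d\xi)\,dt.$$
   Context: $\mathbb R_+=[0,\infty)$, $\mathbb N=\{0,1,2,\dots\}$. A filtration satisfies the usual conditions if it is right-continuous and $\mathcal F_0$ contains all $\mathbb P$-null sets. $\mathcal F_\infty:=\bigvee_{t\ge0}\mathcal F_t$. For $\varnothing\ne A\subseteq\mathbb R$, $\operatorname{FS}(A)$ is the set of all finite (including empty, equal to $0$) sums of elements of $A$, i.e. $\operatorname{FS}(A)=\{\sum_{i=1}^k a_i: a\in A^k,\ k\in\mathbb N\}$. Pure jump processes here are of the type $X_t=\sum_{k=1}^\infty J_k\mathbf 1_{\{\tau_k\le t\}}$, $t\ge0$, with random times $0<\tau_1<\tau_2<\cdots$ $\mathbb P$-a.s. and i.i.d. discrete $J_k$ with $\mathbb P(J_k\ne0)=1$. The jump measure of $X$ is the integer-valued random measure $\mu^X(dt,d\xi)=\sum_{s>0}\mathbf 1_{\{\Delta X_s\ne0\}}\delta_{(s,\Delta X_s)}(dt,d\xi)$ on $\mathbb R_+\times\mathbb R$, and its $\mathbb G$-compensator is its predictable compensator (dual predictable projection) with respect to $\mathbb G$. $\mathbb E[\eta_t\mid X_{t-}]$ is understood as $\gamma(t,X_{t-})$ for a measurable, strictly positive function $\gamma$ such that $\gamma(t,X_{t-})=\mathbb E[\eta_t\mid X_{t-}]$ $\mathbb P$-a.s. for Lebesgue-a.e. $t\ge0$. *)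

(* Defs.v *)
From HB Require Import structures.
From mathcomp Require Import all_boot all_order all_algebra finmap.
From mathcomp Require Import all_classical all_reals all_analysis measurable_realfun.

Set Implicit Arguments.
Unset Strict Implicit.
Unset Printing Implicit Defensive.

Import Order.TTheory GRing.Theory Num.Theory.
Import numFieldNormedType.Exports.

Local Open Scope classical_set_scope.
Local Open Scope ring_scope.

(* Time is R_+ = [0, +oo[. Time-indexed families are total functions on R, and
   every condition below only concerns their values at times t >= 0. *)
Definition Rplus {R : realType} : set R := `[0, +oo[.

Definition discrete_probability {R : realType} (nu : probability R R) : Prop :=
  exists2 S : set R, countable S & nu (~` S) = 0%E.

Definition Atom {R : realType} (nu : probability R R) : set R :=
  [set x | (0 < nu [set x])%E].

Definition FS {R : realType} (A : set R) : set R :=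
  [set x | exists k (a : 'I_k -> R), (forall i, A (a i)) /\ x = \sum_(i < k) a i].

Section independence.
Context d (T : measurableType d) (R : realType) (P : probability T R).

Definition mutually_independent (I : choiceType)
    (S : I -> set (set T)) : Prop :=
  forall (D : {fset I}) (A : I -> set T), (forall i, i \in D -> S i (A i)) ->
    P (\bigcap_(i in [set` D]) A i) = (\prod_(i <- D) P (A i))%E.

Definition sigma_of (X : T -> R) : set (set T) :=
  g_sigma_algebra_preimage (X : T -> measurableTypeR R).

Definition sigma_of_seq (X : nat -> T -> R) : set (set T) :=
  <<s \bigcup_k sigma_of (X k) >>.

Definition iid (X : nat -> {RV P >-> R}) (law : set R -> \bar R) : Prop :=
  mutually_independent (fun k => sigma_of (X k)) /\
  forall k B, measurable B -> distribution P (X k) B = law B.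

(* Z is a version of the conditional expectation of Y given H *)
Definition is_cond_expectation (H : set (set T)) (Y Z : T -> R) : Prop :=
  [/\ P.-integrable setT (EFin \o Y),
      P.-integrable setT (EFin \o Z),
      @measurable_fun _ _ (g_sigma_algebraType H) R setT Z &
      forall A, H A ->
        (\int[P]_(w in A) (Z w)%:E = \int[P]_(w in A) (Y w)%:E)%E].

End independence.

Section filtrations.
Context d (T : measurableType d) (R : realType) (P : probability T R).
Implicit Type F : R -> set (set T).

Definition filtration F : Prop :=
  [/\ forall t, 0 <= t -> sigma_algebra setT (F t),
      forall t, 0 <= t -> F t `<=` measurable &
      forall s t, 0 <= s -> s <= t -> F s `<=` F t].

Definition right_continuous F : Prop :=
  forall t, 0 <= t -> \bigcap_(s in `]t, +oo[) F s `<=` F t.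

(* P-null sets are the measurable sets of probability 0: the underlying
   probability space need not be complete. *)
Definition contains_null_sets F : Prop :=
  forall N, measurable N -> P N = 0%E -> F 0 N.

Definition usual_conditions F : Prop :=
  right_continuous F /\ contains_null_sets F.

Definition F_infty F : set (set T) := <<s \bigcup_(t in Rplus) F t >>.

Definition adapted F (X : R -> T -> R) : Prop :=
  forall t, 0 <= t ->
    @measurable_fun _ _ (g_sigma_algebraType (F t)) R setT (X t).

Definition predictable_rectangle F : set (set (R * T)) :=
  [set B | exists2 A, F 0 A & B = [set 0] `*` A] `|`
  [set B | exists s t A, [/\ 0 <= s, s < t, F s A & B = `]s, t] `*` A]].

(* R * Omega with a sigma-algebra whose trace on R_+ x Omega is the predictable
   sigma-algebra of F *)
Definition predictable_space F := g_sigma_algebraType (predictable_rectangle F).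

Definition predictable_process F d' (T' : measurableType d')
    (Y : R -> T -> T') : Prop :=
  @measurable_fun _ _ (predictable_space F) T' (Rplus `*` setT)
    (fun z => Y z.1 z.2).

(* functions of (t, w, xi) measurable for the product of the predictable
   sigma-algebra and the Borel sigma-algebra *)
Definition predictable_function F (W : R -> T -> R -> \bar R) : Prop :=
  @measurable_fun _ _ (predictable_space F * R)%type _
    ((Rplus `*` setT) `*` setT) (fun z => W z.1.1 z.1.2 z.2).

End filtrations.

Section jump_measure.
Context (R : realType).
Local Open Scope ereal_scope.

(* x_{t-}, with the convention x_{0-} = x_0 *)
Definition left_limit (x : R -> R) (t : R) : R :=
  if (0 < t)%R then lim (x s @[s --> t^'-]) else x 0%R.

Definition jump (x : R -> R) (t : R) : R := (x t - left_limit x t)%R.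

Definition jump_measure (x : R -> R) (B : set (R * R)) : \bar R :=
  \esum_(s in [set s | (0 < s)%R /\ jump x s != 0%R]) \d_(s, jump x s) B.

Variable x : R -> R.

Let jump_measure0 : jump_measure x set0 = 0.
Proof. by rewrite /jump_measure esum1// => s _; exact: measure0. Qed.

Let jump_measure_ge0 B : 0 <= jump_measure x B.
Proof. by apply: esum_ge0 => s _; exact: measure_ge0. Qed.

Let jump_measure_sigma_additive : semi_sigma_additive (jump_measure x).
Proof.
move=> B mB tB mUB.
suff -> : jump_measure x (\bigcup_n B n) = \sum_(n <oo) jump_measure x (B n).
  exact: is_cvg_nneseries.
rewrite nneseries_esumT//.
rewrite /jump_measure (@esum_esum _ _ _ setT (fun=> _))//.
set S := [set s | _].
transitivity (\esum_(s in S) \esum_(n in [set: nat])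
    (\d_(s, jump x s) (B n) : \bar R)).
  apply: eq_esum => s _.
  by rewrite measure_semi_bigcup// nneseries_esumT.
rewrite (@esum_esum _ _ _ S (fun=> _))//.
rewrite (reindex_esum (S `*`` (fun=> setT)) _ (fun z => (z.2, z.1)))//.
split=> //=; first by move=> [i j] [/=].
- by move=> [i1 i2] [j1 j2] /= _ _ [] -> ->.
- by move=> [i1 i2] [/= _ Si2]; exists (i2, i1).
Qed.

HB.instance Definition _ := isMeasure.Build _ _ _ (jump_measure x)
  jump_measure0 jump_measure_ge0 jump_measure_sigma_additive.

End jump_measure.

Section compensators.
Context d (T : measurableType d) (R : realType) (P : probability T R).
Local Open Scope ereal_scope.

Definition random_measure := T -> {measure set (R * R) -> \bar R}.

Definition jump_random_measure (X : R -> T -> R) : random_measure :=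
  fun w => jump_measure (fun t => X t w).

Definition predictable_random_measure (G : R -> set (set T))
    (K : random_measure) : Prop :=
  forall W : R -> T -> R -> \bar R, predictable_function G W ->
    (forall t w xi, 0 <= W t w xi) ->
    predictable_process G
      (fun t w => \int[K w]_(z in `]0%R, t] `*` setT) W z.1 w z.2).

(* K is the dual predictable projection of mu with respect to G *)
Definition is_compensator (G : R -> set (set T)) (mu K : random_measure) : Prop :=
  predictable_random_measure G K /\
  forall W : R -> T -> R -> \bar R, predictable_function G W ->
    (forall t w xi, 0 <= W t w xi) ->
    \int[P]_w \int[mu w]_(z in `]0%R, +oo[ `*` setT) W z.1 w z.2 =
    \int[P]_w \int[K w]_(z in `]0%R, +oo[ `*` setT) W z.1 w z.2.

(* mu has compensator a_t(w) nu(dxi) dt; compensators being unique up to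
   P-null sets, only P-almost every path is prescribed. *)
Definition has_compensator_density (G : R -> set (set T)) (mu : random_measure)
    (a : R -> T -> R) (nu : probability R R) : Prop :=
  exists2 K : random_measure, is_compensator G mu K &
    {ae P, forall w, forall B : set (R * R), measurable B ->
      K w B = \int[lebesgue_measure]_(t in Rplus)
                \int[nu]_xi (a t w * \1_B (t, xi))%:E}.

(* The index k stands for k + 1. Strict monotonicity makes all the times finite,
   and convergence of the series at every t, with i.i.d. nonzero terms, excludes
   accumulation of the times. *)
Definition pure_jump_process (X : R -> T -> R) : Prop :=
  exists (tau J : nat -> {RV P >-> R}) (law : probability R R),
    [/\ {ae P, forall w, (0 < tau 0%N w)%R /\
           forall k, (tau k w < tau k.+1 w)%R},
        discrete_probability law,
        iid J law,
        (forall k, P [set w | J k w != 0%R] = 1) &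
        {ae P, forall w, forall t, (0 <= t)%R ->
           series (fun k => J k w * (tau k w <= t)%R%:R)%R @ \oo --> X t w}].

End compensators.

(* Main.v *)
Require Import Defs.
From HB Require Import structures.
From mathcomp Require Import all_boot all_order all_algebra finmap.
From mathcomp Require Import all_classical all_reals all_analysis measurable_realfun.
From mathcomp Require Import ring lra.

Set Implicit Arguments.
Unset Strict Implicit.
Unset Printing Implicit Defensive.

Import Order.TTheory GRing.Theory Num.Theory.
Import numFieldNormedType.Exports.

Local Open Scope classical_set_scope.
Local Open Scope ring_scope.

(** Given an intensity [q(u, w, x)] that is [F_infty]-measurable in [w] and bounded away
    from [0] and [+oo], let the process wait at the state [x] until the integral of
    [q(u, w, x) du] since the last jump reaches the next [E_k], and then jump by [J_k].
    In the filtration of the events that, before the next jump, depend only on [F_infty]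
    and on the pairs [(E_j, J_j)] already used, the jump measure has compensator
    [q(t, w, X_{t-}) nu(dxi) dt].

    It remains to take [q = eta lambda g] with [g(t, X_{t-}) E[eta_t | X_{t-}] = 1], a
    fixed point problem because [X] depends on [g]. By the forward equation, the law of
    [X_t], tested jointly with [F_infty], depends on [g] in a Lipschitz way for the total
    variation, so the Picard iteration [g |-> P(X_{t-} = x) / E[eta_t; X_{t-} = x]] contracts
    in a norm weighted by [exp (- theta t)]. The weights themselves need not converge at
    the states whose mass vanishes in the limit, which is harmless because only
    countably many states are charged. *)

(** * Measures and independence *)

(** All of [F_infty] is known at time [0], so between two jumps the rate is a known function of
    time, and compensation reduces to one exponential variable independent of it. The obstacle is
    the denominator: [E[eta_t; X_{t-} = x]] is not a function of the law of [X_t] alone, which is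
    why laws are compared jointly with the initial information. The forward equation bounds the
    distance of two such laws by an integral of itself and of the mean difference of the weights;
    conversely, normalizing the weights anew costs at most [K1] times the distance of the laws. In
    [theta = 4 * K + 4 * (U * U * K1)] the first summand absorbs the self-dependence, as in a
    Gronwall argument, and the second makes the composed map contract by [1/2]. Division by
    vanishing masses is avoided by the notion [balanced]: a weight [h] is judged by the pairing of
    [eta * h - 1] with bounded functions of the state. This defect is stable under total variation
    and, as [eta >= L], still controls the mean distance of two weights, so an upper limit of the
    iterates can serve as the fixed point. *)

Section density_measure.
Context d (T : measurableType d) (R : realType).
Variables (mu : {measure set T -> \bar R}) (h : T -> R).
Import HBSimple HBNNSimple.
Local Open Scope ereal_scope.

(** The proofs [mh] and [h0] are carried by the term because the measure structure attached to it
    below is inferred from them. *)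
Definition density_measure (mh : measurable_fun setT h)
  (h0 : forall x, (0 <= h x)%R) (B : set T) : \bar R := \int[mu]_(x in B) (h x)%:E.

Variables (mh : measurable_fun setT h) (h0 : forall x, (0 <= h x)%R).
Local Notation dens := (density_measure mh h0).

Let dens0 : dens set0 = 0.
Proof. by rewrite /density_measure integral_set0. Qed.

Let dens_ge0 B : 0 <= dens B.
Proof. by apply: integral_ge0 => x _; rewrite lee_fin. Qed.

Let dens_sigma_additive : semi_sigma_additive dens.
Proof.
move=> /= F mF tF mUF; rewrite /density_measure; apply: cvg_toP.
  apply: ereal_nondecreasing_is_cvgn => m n mn.
  apply: lee_sum_nneg_natr => // k _ _.
  by apply: integral_ge0 => x _; rewrite lee_fin.
rewrite ge0_integral_bigcup//=.
- by apply/measurable_EFinP; exact: measurable_funTS.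
- by move=> x _; rewrite lee_fin.
Qed.

HB.instance Definition _ := isMeasure.Build _ _ _
  dens dens0 dens_ge0 dens_sigma_additive.

(** On indicators this is the definition of the density measure; linearity gives simple functions,
    and monotone convergence on both sides gives the rest. *)
Lemma ge0_integral_density (f : T -> \bar R) :
  measurable_fun setT f -> (forall x, 0 <= f x) ->
  \int[dens]_x f x = \int[mu]_x (f x * (h x)%:E).
Proof.
move=> mf f0.
pose f_ := nnsfun_approx measurableT mf.
have f_cvg x : (f_ n x)%:E @[n --> \oo] --> f x.
  by apply: cvg_nnsfun_approx => // y _.
have f_nd x : nondecreasing_seq (fun n => (f_ n x)%:E).
  move=> a b ab; rewrite lee_fin.
  by have /lefP := nd_nnsfun_approx measurableT mf ab.
have mfn n : measurable_fun setT (EFin \o f_ n) by exact/measurable_EFinP.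
have mh' : measurable_fun setT (EFin \o h) by exact/measurable_EFinP.
have h0' x : 0 <= (EFin \o h) x by rewrite lee_fin.
transitivity (limn (fun n => \int[dens]_x (f_ n x)%:E)).
  rewrite -monotone_convergence//.
  - by apply: eq_integral => x _; apply/esym/cvg_lim.
  - by move=> n x _; rewrite lee_fin.
transitivity (limn (fun n => \int[mu]_x ((f_ n x)%:E * (h x)%:E))); last first.
  rewrite -monotone_convergence//.
  - apply: eq_integral => x _; apply/cvg_lim => //.
    exact: cvgeZr.
  - by move=> n; exact: (emeasurable_funM (mfn n) mh').
  - by move=> n x _; rewrite mule_ge0// lee_fin.
  - by move=> x _ a b ab; apply: lee_wpmul2r; [rewrite lee_fin|exact: f_nd].
congr (limn _); apply/funext => n.
have mfk k : measurable (f_ n @^-1` [set k]) by [].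
transitivity (\sum_(k \in range (f_ n)) \int[dens]_x (k * \1_(f_ n @^-1` [set k]) x)%:E).
  under eq_integral do rewrite fimfunE -fsumEFin//.
  rewrite ge0_integral_fsum//.
  - by move=> y; exact/measurable_EFinP/measurable_funM.
  - by move=> y x _; rewrite nnfun_muleindic_ge0.
transitivity (\sum_(k \in range (f_ n)) \int[mu]_x ((k * \1_(f_ n @^-1` [set k]) x)%:E * (h x)%:E)); last first.
  rewrite -ge0_integral_fsum//.
  - apply: eq_integral => x _; rewrite [in RHS]fimfunE -fsumEFin// ge0_mule_fsuml//.
    by move=> r; rewrite nnfun_muleindic_ge0.
  - by move=> y; apply: emeasurable_funM => //; exact/measurable_EFinP/measurable_funM.
  - by move=> y x _; rewrite mule_ge0 ?nnfun_muleindic_ge0 ?lee_fin.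
apply: eq_fsbigr => r _; rewrite integralZl_indic_nnsfun// integral_indic//=.
rewrite setIT.
have [r0|r0] := ltP r 0%R.
  rewrite preimage_nnfun0// measure0 mule0 integral0_eq// => x _.
  by rewrite indic0 mulr0 mul0e.
under eq_integral do rewrite EFinM -muleA.
rewrite ge0_integralZl//.
- congr (_ * _); rewrite /density_measure integral_mkcond.
  apply: eq_integral => x _; rewrite patchE indicE.
  by case: ifPn => _; rewrite ?mul1e ?mul0e.
- by apply: emeasurable_funM => //; exact/measurable_EFinP.
- by move=> x _; rewrite mule_ge0 // lee_fin.
Qed.

End density_measure.
Section image_measure.
Context d1 d2 (T1 : measurableType d1) (T2 : measurableType d2) (R : realType).
Variables (m : {measure set T1 -> \bar R}) (f : T1 -> T2).
Local Open Scope ereal_scope.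

Definition image_measure (mf : measurable_fun setT f) : set T2 -> \bar R :=
  pushforward m f.

Variable mf : measurable_fun setT f.

Let image_measure0 : image_measure mf set0 = 0.
Proof. exact: measure0. Qed.

Let image_measure_ge0 B : 0 <= image_measure mf B.
Proof. exact: measure_ge0. Qed.

Let image_measure_sigma_additive : semi_sigma_additive (image_measure mf).
Proof. exact: measure_semi_sigma_additive. Qed.

HB.instance Definition _ := isMeasure.Build _ _ _ (image_measure mf)
  image_measure0 image_measure_ge0 image_measure_sigma_additive.

Lemma image_measureE B : image_measure mf B = m (f @^-1` B).
Proof. by []. Qed.

Lemma ge0_integral_image_measure (g : T2 -> \bar R) :
  measurable_fun setT g -> (forall y, 0 <= g y) ->
  \int[image_measure mf]_y g y = \int[m]_x g (f x).
Proof. by move=> mg g0; rewrite ge0_integral_pushforward// preimage_setT. Qed.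

End image_measure.

(** Composition with this identity turns measurability for a sub-sigma-algebra into measurability
    for the ambient one. *)
Lemma measurable_id_g_sigma_algebra d (T : measurableType d) (A : set (set T)) :
  A `<=` measurable ->
  @measurable_fun _ _ T (g_sigma_algebraType A) setT id.
Proof.
move=> Am _ B mB; rewrite setTI preimage_id.
apply: (@smallest_sub _ (sigma_algebra setT) A measurable) => //.
exact: sigma_algebra_measurable.
Qed.

Lemma measurable_id_sub_sigma_algebra (T : pointedType) (A B : set (set T)) :
  A `<=` <<s B >> ->
  @measurable_fun _ _ (g_sigma_algebraType B) (g_sigma_algebraType A) setT id.
Proof.
move=> AB; apply: (@measurable_id_g_sigma_algebra _ (g_sigma_algebraType B)).
exact: AB.
Qed.

Section independence_section.
Context d (T : measurableType d) (R : realType) (P : probability T R).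
Variables (A : set (set T)) (mA : A `<=` measurable) (sA : sigma_algebra setT A).
Variables (V : T -> R) (mV : measurable_fun setT V) (mu : probability R R).
Hypothesis indep : forall a B, A a -> measurable B ->
  (P (a `&` V @^-1` B) = P a * mu B)%E.
Local Notation AT := (g_sigma_algebraType A).

(** Independence says that the image of [P] under [w |-> (w, V w)], on the product of [A] with the
    Borel sets, agrees with [P \x mu] on rectangles, hence everywhere. What is known in [A] can thus
    be frozen while [V] is integrated out. *)
Lemma measure_graph_indep (D : set (AT * R)) : measurable D ->
  P [set w | D (w, V w)] = (\int[P]_w mu (xsection D w))%E.
Proof.
move=> mD.
have mid := measurable_id_g_sigma_algebra mA.
have mphi : measurable_fun setT (fun w : T => (w, V w) : AT * R).
  exact: measurable_fun_pair.
have mpsi : measurable_fun setT ((fun z => z) : T * R -> AT * R).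
  apply/measurable_fun_pairP; split; last exact: measurable_snd.
  exact: (measurableT_comp mid measurable_fst).
change (image_measure P mphi D = image_measure (P \x mu)%E mpsi D).
apply: (measure_unique [set X `*` Y | X in @measurable _ AT & Y in measurable] (fun=> setT)) => //.
- by rewrite measurable_prod_measurableType.
- move=> _ _ [X1 mX1 [Y1 mY1 <-]] [X2 mX2 [Y2 mY2 <-]].
  by rewrite -setXI; exists (X1 `&` X2); [exact: measurableI|exists (Y1 `&` Y2) => //; exact: measurableI].
- by move=> _; exists setT => //; exists setT => //; rewrite setXTT.
- by rewrite bigcup_const.
- move=> _ [X mX [Y mY <-]].
  rewrite measurable_g_measurableTypeE in mX; last exact: sA.
  change (P (X `&` V @^-1` Y) = (P \x mu)%E (X `*` Y)).
  by rewrite product_measure1E//; [exact: indep|exact: mA].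
- move=> _; change (P setT < +oo)%E; by rewrite probability_setT ltry.
Qed.

End independence_section.

Lemma measurable_integral_lebesgue d (X : measurableType d) (R : realType)
    (f : X * R -> \bar R) : measurable_fun setT f -> (forall z, 0 <= f z)%E ->
  measurable_fun setT (fun x => \int[@lebesgue_measure R]_u f (x, u))%E.
Proof.
move=> mf f0; exact: (@measurable_fun_fubini_tonelli_F _ _ X _ R lebesgue_measure f).
Qed.

Lemma tonelli_lebesgue d (X : measurableType d) (R : realType)
    (m : {sigma_finite_measure set X -> \bar R})
    (f : X * R -> \bar R) : measurable_fun setT f -> (forall z, 0 <= f z)%E ->
  (\int[m]_x \int[@lebesgue_measure R]_u f (x, u) =
   \int[@lebesgue_measure R]_u \int[m]_x f (x, u))%E.
Proof.
move=> mf f0; exact: (@fubini_tonelli _ _ X _ R m lebesgue_measure f).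
Qed.

(** * Times at which an accumulated rate reaches an independent exponential threshold *)

Section cumulated_rate.
Context (R : realType).
Local Notation leb := (@lebesgue_measure R).

Definition cumulated (r : R -> R) (s t : R) : R :=
  fine (\int[leb]_(u in `]s, t]) (r u)%:E)%E.

(** For [e >= 0] and a rate bounded away from [0] and [+oo], exactly one such time exists; the
    default [s] is the value for [e < 0]. *)
Definition hitting (r : R -> R) (s e : R) : R :=
  xget s [set t | s <= t /\ cumulated r s t = e].

Variables (r : R -> R) (c C : R).
Hypotheses (mr : measurable_fun setT r) (c_gt0 : 0 < c).
Hypothesis r_bounds : forall u, c <= r u <= C.

Let r_ge0 u : 0 <= r u.
Proof. by have /andP[+ _] := r_bounds u; apply: le_trans; exact: ltW. Qed.

Lemma integral_rate_bounds (D : set R) : measurable D ->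
  (c%:E * leb D <= \int[leb]_(u in D) (r u)%:E <= C%:E * leb D)%E.
Proof.
move=> mD; rewrite -!integral_cst//.
have mrD : measurable_fun D (EFin \o r) by apply/measurable_EFinP/measurable_funTS.
apply/andP; split; apply: ge0_le_integral => //.
- by move=> x _; rewrite /= lee_fin ltW.
- by move=> x _; have /andP[+ _] := r_bounds x; rewrite /= lee_fin.
- by move=> x _; rewrite lee_fin.
- by move=> x _; have /andP[_ +] := r_bounds x; rewrite /= lee_fin.
Qed.

Lemma cumulated_EFin s t :
  ((cumulated r s t)%:E = \int[leb]_(u in `]s, t]) (r u)%:E)%E.
Proof.
have /andP[_ h] := @integral_rate_bounds `]s, t]%classic (measurable_itv _).
rewrite fineK// ge0_fin_numE; last by apply: integral_ge0 => u _; rewrite lee_fin.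
apply: le_lt_trans h _; rewrite lebesgue_measure_itv/=; case: ifP => _.
  by rewrite -EFinB -EFinM ltry.
by rewrite mule0.
Qed.

Lemma cumulated_eq0 s t : t <= s -> cumulated r s t = 0.
Proof. by move=> ts; rewrite /cumulated set_itv_ge ?integral_set0//= bnd_simp -leNgt. Qed.

Lemma cumulatedD s t u : s <= t -> t <= u ->
  cumulated r s u = cumulated r s t + cumulated r t u.
Proof.
move=> st tu; apply: EFin_inj; rewrite EFinD !cumulated_EFin.
have <- : `]s, t]%classic `|` `]t, u]%classic = `]s, u]%classic.
  apply/seteqP; split=> x /=; rewrite !in_itv/=.
    by case=> /andP[sx xt]; rewrite ?sx ?xt ?(le_trans xt)//= ?andbT (le_lt_trans st).
  by move=> /andP[-> ->]; rewrite andbT; have [xt|] := leP x t; [left|right].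
rewrite ge0_integral_setU//=.
- by apply/measurable_EFinP/measurable_funTS.
- by move=> x _; rewrite lee_fin.
- apply/disj_setPS => x [] /=; rewrite !in_itv/= => /andP[_ xt] /andP[tx _].
  by move: (le_lt_trans xt tx); rewrite ltxx.
Qed.

Lemma cumulated_bounds s t : s <= t ->
  c * (t - s) <= cumulated r s t <= C * (t - s).
Proof.
rewrite le_eqVlt => /orP[/eqP ->|st].
  by rewrite cumulated_eq0// subrr !mulr0 lexx.
have := @integral_rate_bounds `]s, t]%classic (measurable_itv _).
by rewrite -cumulated_EFin lebesgue_measure_itv/= lte_fin st -EFinB -!EFinM !lee_fin.
Qed.

Let C_gt0 : 0 < C.
Proof. by have /andP[a b] := r_bounds 0; exact: lt_le_trans c_gt0 (le_trans a b). Qed.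

Lemma cumulated_ge0 s t : 0 <= cumulated r s t.
Proof.
have [st|/ltW ts] := leP s t; last by rewrite cumulated_eq0.
have /andP[+ _] := cumulated_bounds st; apply: le_trans.
by rewrite mulr_ge0 ?subr_ge0// ltW.
Qed.

Lemma le_cumulated s t u : t <= u -> cumulated r s t <= cumulated r s u.
Proof.
move=> tu; have [st|/ltW ts] := leP s t; last by rewrite (cumulated_eq0 ts) cumulated_ge0.
by rewrite (cumulatedD st tu) lerDl cumulated_ge0.
Qed.

Lemma lt_cumulated s t u : s <= t -> t < u -> cumulated r s t < cumulated r s u.
Proof.
move=> st tu; rewrite (cumulatedD st (ltW tu)) ltrDl.
have /andP[+ _] := cumulated_bounds (ltW tu); apply: lt_le_trans.
by rewrite mulr_gt0// subr_gt0.
Qed.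

Lemma cumulated_surj s e : 0 <= e -> exists2 t, s <= t & cumulated r s t = e.
Proof.
(* A rate at least [c] accumulates at least [e] by time [b]; the intermediate value theorem applies
   because the accumulated rate is [C]-Lipschitz in its endpoint. *)
move=> e0; pose b := s + e / c.
have sb : s <= b by rewrite lerDl divr_ge0// ltW.
have cont : continuous (cumulated r s).
  have lip (x y : R) : x <= y -> `|cumulated r s x - cumulated r s y| <= C * `|x - y|.
    move=> xy; rewrite distrC (distrC x) !ger0_norm ?subr_ge0 ?le_cumulated//.
    have [sx|/ltW xs] := leP s x.
      rewrite (cumulatedD sx xy) addrAC subrr add0r.
      by have /andP[] := cumulated_bounds xy.
    rewrite (cumulated_eq0 xs) subr0.
    have [sy|/ltW ys] := leP s y; last first.
      by rewrite cumulated_eq0// mulr_ge0 ?subr_ge0// ltW.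
    have /andP[_ h] := cumulated_bounds sy; apply: le_trans h _.
    by rewrite ler_pM2l// lerD2l lerN2.
  move=> x; apply/cvgrPdist_le => eps eps0; near=> y.
  have xy : `|x - y| <= eps / C.
    by near: y; apply: cvgr_dist_le; [exact: cvg_id|exact: divr_gt0].
  apply: (@le_trans _ _ (C * `|x - y|)).
    have [/lip//|/ltW/lip] := leP x y.
    by rewrite distrC (distrC y).
  by rewrite mulrC -ler_pdivlMr.
have [|t tb te] := @IVT R (cumulated r s) s b e sb (continuous_subspaceT cont).
  rewrite cumulated_eq0// min_l ?cumulated_ge0// max_r ?cumulated_ge0// e0/=.
  have /andP[+ _] := cumulated_bounds sb; apply: le_trans.
  by rewrite /b addrAC subrr add0r mulrCA divff ?mulr1// gt_eqF.
by exists t => //; move: tb; rewrite in_itv/= => /andP[].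
Unshelve. all: by end_near. Qed.

Lemma hittingP s e : 0 <= e -> s <= hitting r s e /\ cumulated r s (hitting r s e) = e.
Proof.
move=> /(cumulated_surj s)[t st te]; rewrite /hitting.
by case: xgetP => [_ -> //|/(_ t)]; case.
Qed.

(** Trades a time for a level: questions on the hitting time become a comparison of [e] with an
    accumulated rate. Strict positivity of [e] rules out [t < s], where the accumulated rate is
    [0]. *)
Lemma hitting_le s e t : 0 < e -> (hitting r s e <= t) = (e <= cumulated r s t).
Proof.
move=> e0; have [sh he] := hittingP s (ltW e0).
apply/idP/idP => [ht|]; first by rewrite -{1}he; exact: le_cumulated.
rewrite !leNgt; apply: contraNN => th.
have [st|/ltW ts] := leP s t; last by rewrite cumulated_eq0.
by have := lt_cumulated st th; rewrite he.
Qed.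

Lemma hitting_gt s e : 0 < e -> s < hitting r s e.
Proof. by move=> e0; rewrite ltNge hitting_le// cumulated_eq0// -ltNge. Qed.

Lemma hitting_lb s e : 0 <= e -> s + e / C <= hitting r s e.
Proof.
move=> e0; have [sh he] := hittingP s e0; rewrite addrC -lerBrDr ler_pdivrMr// mulrC.
by rewrite -{1}he; have /andP[] := cumulated_bounds sh.
Qed.

(** The change of variable [v = cumulated r s u] carries [r u du] to [dv] and []s, hitting r s e]]
    to []0, e]]. Both intersections are intervals, so only their endpoints have to be matched. *)
Lemma integral_before_hitting s e a b : 0 < e -> a <= b ->
  (\int[leb]_(u in `]s, (hitting r s e)%R] `&` `]a, b]) (r u)%:E =
   leb (`]0%R, e] `&` `]cumulated r s a, cumulated r s b]))%E.
Proof.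
move=> e0 ab; have [sh he] := hittingP s (ltW e0).
set h := hitting r s e in sh he *.
have itvI (x y z w : R) : `]x, y] `&` `]z, w] = `]Num.max x z, Num.min y w]%classic.
  apply/seteqP; split=> u /=; rewrite !in_itv/= gt_max le_min.
    by move=> [/andP[-> ->] /andP[-> ->]].
  by move=> /andP[/andP[-> ->] /andP[-> ->]].
rewrite !itvI (max_r (cumulated_ge0 _ _)).
have hmin : Num.min e (cumulated r s b) = cumulated r s (Num.min h b).
  have [hb|/ltW bh] := leP h b.
    by rewrite he min_l// -{1}he le_cumulated.
  by rewrite min_r// -he le_cumulated.
have hmax : cumulated r s a = cumulated r s (Num.max s a).
  have [sa|/ltW as_] := leP s a => //.
  by rewrite !cumulated_eq0.
rewrite hmin hmax -cumulated_EFin lebesgue_measure_itv/=.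
have sm : s <= Num.max s a by rewrite le_max lexx.
have [mm|mm] := ltP (Num.max s a) (Num.min h b).
  rewrite (cumulatedD sm (ltW mm)) lte_fin ifT; last first.
    by rewrite -cumulatedD ?(ltW mm)//; exact: lt_cumulated.
  by rewrite -EFinB addrAC subrr add0r.
rewrite cumulated_eq0// lte_fin ifF//.
by apply/negbTE; rewrite -leNgt le_cumulated.
Qed.

End cumulated_rate.

(** For parameter [1] the tail and the density of the exponential law coincide. This constant hazard
    is why the rate itself becomes the density of the compensator. *)
Lemma exponential_prob_itvcy (R : realType) (v : R) : 0 <= v ->
  exponential_prob 1 `[v, +oo[ = (exponential_pdf 1 v)%:E.
Proof.
move=> v0; rewrite exponential_pdfE//.
have exp0 : exponential_prob (1 : R) `]-oo, 0[ = 0%E.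
  by rewrite /exponential_prob integral0_eq// => x; rewrite /= in_itv/= => x0; rewrite lt0_exponential_pdf.
have expc (x : R) : 0 <= x -> exponential_prob 1 `[0, x[ = (1 - expR (- x))%:E.
  rewrite le_eqVlt => /orP[/eqP<-|x0].
    by rewrite set_itv_ge ?bnd_simp ?ltxx// /exponential_prob integral_set0 oppr0 expR0 subrr.
  have := @exponential_prob_itv0c R 1 x x0; rewrite mulN1r EFinB => <-.
  rewrite /exponential_prob integral_itv_bndo_bndc//.
  by apply/measurable_EFinP/measurable_funTS; exact: measurable_exponential_pdf.
have : exponential_prob (1 : R) setT = 1%E by exact: probability_setT.
have <- : `]-oo, v[%classic `|` `[v, +oo[%classic = [set: R].
  apply/seteqP; split=> // x _ /=; rewrite !in_itv/= andbT.
  by have [xv|] := ltP x v; [left|right].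
have <- : `]-oo, 0[%classic `|` `[0, v[%classic = `]-oo, v[%classic :> set R.
  apply/seteqP; split=> x /=; rewrite !in_itv/=.
    by case=> [x0|/andP[]//]; exact: lt_le_trans v0.
  by move=> ->; rewrite andbT; have [xv|] := ltP x 0; [left|right].
rewrite measureU//; last 2 first.
- by apply: measurableU.
- apply/seteqP; split=> // x /=; rewrite !in_itv/= andbT => -[[x0|/andP[_ xv]] vx].
    by move: (lt_le_trans x0 v0); rewrite ltNge vx.
  by move: xv; rewrite ltNge vx.
rewrite measureU//; last first.
  apply/seteqP; split=> // x /=; rewrite !in_itv/= => -[x0 /andP[]].
  by rewrite leNgt x0.
rewrite /= exp0 add0e expc// => /eqP.
rewrite mul1r mulN1r; case: (exponential_prob 1 `[v, +oo[) => [y| |]//=.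
by rewrite -EFinD eqe addrAC -subr_eq0 => /eqP h; congr (_%:E); lra.
Qed.

(** * One jump under a rate known in advance *)

Section jump_step.
Context d (T : measurableType d) (R : realType) (P : probability T R).
Variables (A : set (set T)) (mA : A `<=` measurable) (sA : sigma_algebra setT A).
Local Notation AT := (g_sigma_algebraType A).
Local Notation leb := (@lebesgue_measure R).
Variables (r : R -> T -> R) (c C : R).
Hypotheses (mr : @measurable_fun _ _ (R * AT)%type R setT (fun z => r z.1 z.2))
  (c_gt0 : 0 < c) (r_bounds : forall u w, c <= r u w <= C).
Variables (sigma : T -> R) (msigma : @measurable_fun _ _ AT R setT sigma).
Variables (Eps : T -> R).
Hypotheses (mEps : measurable_fun setT Eps) (Eps_gt0 : forall w, 0 < Eps w).
Variables (mu : probability R R).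
Hypotheses (muE : forall B, measurable B -> mu B = exponential_prob 1 B)
  (indep : forall a B, A a -> measurable B -> (P (a `&` Eps @^-1` B) = P a * mu B)%E).

Definition next_time w := hitting (r ^~ w) (sigma w) (Eps w).

Let mrw w : measurable_fun setT (r ^~ w).
Proof. exact: (@measurable_fun_pair1 _ _ _ R AT R _ w mr). Qed.

Lemma measurable_cumulated t :
  @measurable_fun _ _ AT R setT (fun w => cumulated (r ^~ w) (sigma w) t).
Proof.
rewrite (_ : (fun _ => _) = fine \o (fun w => \int[leb]_u ((r u w * (sigma w < u <= t)%R%:R)%:E)))%E; last first.
  apply/funext => w; rewrite /cumulated integral_mkcond/=; congr fine.
  apply: eq_integral => u _; rewrite patchE.
  have -> : (u \in `]sigma w, t]%classic) = (sigma w < u <= t) by rewrite mem_setE in_itv.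
  by case: ifP => _; rewrite ?mulr1 ?mulr0.
apply: measurableT_comp => //.
pose f (z : AT * R) := (r z.2 z.1 * (sigma z.1 < z.2 <= t)%R%:R)%:E.
apply: (@measurable_integral_lebesgue _ AT R f).
- apply/measurable_EFinP; apply: measurable_funM.
    exact: (measurableT_comp mr (@measurable_swap _ _ AT R)).
  apply: measurableT_comp => //.
  apply: measurable_and.
    apply: measurable_fun_ltr => //.
    exact: (measurableT_comp msigma measurable_fst).
  by apply: measurable_fun_ler.
- move=> z; rewrite lee_fin mulr_ge0//.
  by have /andP[+ _] := r_bounds z.2 z.1; apply: le_trans; exact: ltW.
Qed.

Lemma next_time_le w t : (next_time w <= t) = (Eps w <= cumulated (r ^~ w) (sigma w) t).
Proof. by apply: (hitting_le (mrw w) c_gt0 (fun u => r_bounds u w)). Qed.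

Lemma measurable_next_time (B : set (set T)) : A `<=` <<s B >> ->
  @measurable_fun _ _ (g_sigma_algebraType B) R setT Eps ->
  @measurable_fun _ _ (g_sigma_algebraType B) R setT next_time.
Proof.
move=> AB mEpsB; apply: (measurability _ (RGenOInfty.measurableE R)) => _ [_ [x ->] <-].
rewrite setTI.
rewrite (_ : _ @^-1` _ =
    (fun w => cumulated (r ^~ w) (sigma w) x < Eps w) @^-1` [set true]); last first.
  by apply/seteqP; split=> w /=; rewrite in_itv/= andbT !ltNge next_time_le.
rewrite -[X in _ X]setTI.
have mc := measurableT_comp (@measurable_cumulated x) (measurable_id_sub_sigma_algebra AB).
exact: (measurable_fun_ltr mc mEpsB).
Qed.

(** Given [A], the probability of [cs < Eps <= ct] is the integral over []cs, ct]] of the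
    exponential density at [v], which is also the probability of [v <= Eps]. Exchanging the
    integrals leaves the mean length of []0, Eps]] intersected with []cs, ct]], and
    [integral_before_hitting] turns this length into an integral of the rate. *)
Lemma next_time_prob (a : set T) s t :
    A a -> s <= t ->
  (P (a `&` [set w | s < next_time w <= t]%R) =
   \int[P]_(w in a) \int[leb]_(u in `]sigma w, next_time w] `&` `]s, t]) (r u w)%:E)%E.
Proof.
move=> Aa st.
pose cs w := cumulated (r ^~ w) (sigma w) s.
pose ct w := cumulated (r ^~ w) (sigma w) t.
have mcs : @measurable_fun _ _ AT R setT cs by exact: measurable_cumulated.
have mct : @measurable_fun _ _ AT R setT ct by exact: measurable_cumulated.
pose D1 : set (AT * R) := [set z | a z.1 /\ cs z.1 < z.2 <= ct z.1].
have mAT : measurable_fun setT (fun w : AT => w \in a).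
  apply: (measurable_fun_bool true); rewrite setTI.
  rewrite (_ : _ @^-1` _ = a); last first.
    by apply/seteqP; split=> w /= => [/set_mem|/mem_set].
  by rewrite measurable_g_measurableTypeE.
pose b1 (z : AT * R) := (z.1 \in a) && ((cs z.1 < z.2) && (z.2 <= ct z.1)).
have mb1 : measurable_fun setT b1.
  apply: measurable_and; first exact: (measurableT_comp mAT measurable_fst).
  apply: measurable_and.
    by apply: measurable_fun_ltr => //; exact: (measurableT_comp mcs measurable_fst).
  by apply: measurable_fun_ler => //; exact: (measurableT_comp mct measurable_fst).
have D1E : D1 = b1 @^-1` [set true].
  apply/seteqP; split=> z; rewrite /D1 /b1/=; first by case=> /mem_set -> ->.
  by move=> /andP[/set_mem].
have mD1 : measurable D1 by rewrite D1E -[X in measurable X]setTI; exact: mb1.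
have -> : a `&` [set w | s < next_time w <= t] = [set w | D1 (w, Eps w)].
  apply/seteqP; split=> w /=; by rewrite /D1/= !ltNge !next_time_le.
rewrite (measure_graph_indep mA sA mEps indep mD1).
(* [D1] cut down to the levels [v] in []0, Eps]]; the length of its section at [w] is the one that
   [integral_before_hitting] computes. *)
pose D2 : set (T * R) := [set z | [/\ a z.1, cs z.1 < z.2 <= ct z.1 & 0 < z.2 <= Eps z.1]].
have mid := measurable_id_g_sigma_algebra mA.
have mpsi : measurable_fun setT ((fun z => z) : T * R -> AT * R).
  apply/measurable_fun_pairP; split; last exact: measurable_snd.
  exact: (measurableT_comp mid measurable_fst).
have mD1' : @measurable _ (T * R)%type D1.
  by rewrite -[X in measurable X]setTI; exact: (mpsi measurableT _ mD1).
have mD2 : measurable D2.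
  rewrite (_ : D2 = D1 `&` (fun z : T * R => (0 < z.2) && (z.2 <= Eps z.1)) @^-1` [set true]).
    apply: measurableI => //; rewrite -[X in measurable X]setTI.
    have mb : measurable_fun setT (fun z : T * R => (0 < z.2) && (z.2 <= Eps z.1)).
      apply: measurable_and; first exact: measurable_fun_ltr.
      by apply: measurable_fun_ler => //; exact: (measurableT_comp mEps measurable_fst).
    exact: mb.
  by apply/seteqP; split=> z /=; [case|case=> -[]].
transitivity (\int[P]_w \int[leb]_v (\1_D2 (w, v))%:E)%E; last first.
  rewrite [RHS]integral_mkcond; apply: eq_integral => w _.
  rewrite patchE; case: ifPn => wa; last first.
    by rewrite integral0_eq// => v _; rewrite indicE memNset// => -[/mem_set]; rewrite (negbTE wa).
  rewrite (integral_before_hitting (mrw w) c_gt0 (fun u => r_bounds u w))//.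
  set S := _ `&` _.
  have mS : measurable S by exact: measurableI.
  have -> : leb S = (\int[leb]_v (\1_S v)%:E)%E by rewrite integral_indic ?setIT.
  apply: eq_integral => v _; congr (_%:E); rewrite !indicE; congr (nat_of_bool _)%:R.
  apply/idP/idP => /set_mem; rewrite /S/D2/= => h; apply/mem_set => /=; move: h; rewrite !in_itv/=.
    by case=> _ -> ->.
  by case=> -> ->; split => //; exact/set_mem.
rewrite (tonelli_lebesgue P (f := fun z => (\1_D2 z)%:E))//; last first.
  by apply/measurable_EFinP; exact: measurable_indic.
transitivity (\int[leb]_v \int[P]_w (\1_D1 (w, v) * exponential_pdf 1 v)%:E)%E; last first.
  apply: eq_integral => v _.
  have [v0|v0] := leP v 0.
    rewrite integral0_eq; last first.
      move=> w _; rewrite indicE memNset ?mul0r// => -[_ /andP[csv _]].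
      have := cumulated_ge0 (mrw w) c_gt0 (fun u => r_bounds u w) (sigma w) s.
      by rewrite leNgt (lt_le_trans csv v0).
    by rewrite integral0_eq// => w _; rewrite indicE memNset// => -[_ _]; rewrite ltNge v0.
  have mysec := @measurable_ysection _ _ AT R D1 v mD1.
  rewrite measurable_g_measurableTypeE in mysec => //.
  transitivity (P (ysection D1 v) * (exponential_pdf 1 v)%:E)%E.
    rewrite -[in RHS](setIT (ysection _ _)) -integral_indic//; last exact: mA.
    rewrite -ge0_integralZr//.
    - by apply: eq_integral => w _; rewrite -EFinM !indicE mem_ysection.
    - by apply/measurable_EFinP; apply: measurable_indic; exact: mA.
    - by rewrite lee_fin exponential_pdf_ge0.
  (* The density at [v] is read as the law of [Eps] on [[v, +oo[], and independence turns the
     product into the probability of a joint event. *)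
  rewrite -exponential_prob_itvcy ?ltW// -muE// -indep//.
  rewrite -[in LHS](setIT (_ `&` _)) -integral_indic//; last first.
    apply: measurableI; first exact: mA.
    by rewrite -[X in measurable X]setTI; exact: mEps.
  apply: eq_integral => w _; congr (_%:E); rewrite !indicE; congr (nat_of_bool _)%:R.
  apply/idP/idP => /set_mem h; apply/mem_set; move: h.
    by case; rewrite /ysection/= => /set_mem [aw csw]; rewrite in_itv/= andbT => vE; split; rewrite ?v0.
  by case=> aw csw /andP[_ vE]; split; rewrite /ysection/= ?in_itv/= ?andbT//; apply/mem_set.
rewrite -(tonelli_lebesgue P (f := fun z => (\1_D1 z * exponential_pdf 1 z.2)%:E))//; last 2 first.
- apply/measurable_EFinP/measurable_funM; first exact: measurable_indic.
  apply: measurableT_comp => //; exact: measurable_exponential_pdf.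
- by move=> z; rewrite lee_fin mulr_ge0// exponential_pdf_ge0.
apply: eq_integral => w _.
rewrite muE; last exact: measurable_xsection.
rewrite /exponential_prob [LHS]integral_mkcond; apply: eq_integral => v _.
by rewrite patchE mem_xsection indicE; case: ifP => _; rewrite ?mul1r ?mul0r.
Qed.

End jump_step.

(** * The jump process of an intensity *)

Section driver.
Context d (T : measurableType d) (R : realType) (P : probability T R).
Variable nu : probability R R.

(* [gap k] is the exponential variable producing the [k]-th jump time and
   [mark k] the [k]-th jump; [pre k] is the information available before both,
   [mid k] the information available between them. *)
Record driver := Driver {
  pre : nat -> set (set T);
  mid : nat -> set (set T);
  gap : nat -> T -> R;
  mark : nat -> T -> R;
  gap_law : probability R R;
  pre_sigma_algebra : forall k, sigma_algebra setT (pre k);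
  mid_sigma_algebra : forall k, sigma_algebra setT (mid k);
  mid_measurable : forall k, mid k `<=` measurable;
  pre_null : forall N, measurable N -> P N = 0%E -> pre 0 N;
  sub_pre_mid : forall k, pre k `<=` mid k;
  sub_mid_pre : forall k, mid k `<=` pre k.+1;
  gap_measurable : forall k,
    @measurable_fun _ _ (g_sigma_algebraType (mid k)) R setT (gap k);
  mark_measurable : forall k,
    @measurable_fun _ _ (g_sigma_algebraType (pre k.+1)) R setT (mark k);
  gap_gt0 : forall k w, 0 < gap k w;
  gap_sum_unbounded : forall w (M : R), exists n, M < \sum_(k < n) gap k w;
  mark_neq0 : forall k w, mark k w != 0;
  mark_atom : forall k w, Atom nu (mark k w);
  gap_lawE : forall B, measurable B -> gap_law B = exponential_prob 1 B;
  gap_indep : forall k A B, pre k A -> measurable B ->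
    (P (A `&` gap k @^-1` B) = P A * gap_law B)%E;
  mark_indep : forall k A B, mid k A -> measurable B ->
    (P (A `&` mark k @^-1` B) = P A * nu B)%E }.

Variable D : driver.
Notation preT k := (g_sigma_algebraType (pre D k)).
Notation midT k := (g_sigma_algebraType (mid D k)).

Lemma sub_pre j k : (j <= k)%N -> pre D j `<=` pre D k.
Proof.
elim: k => [|k IH]; first by rewrite leqn0 => /eqP ->.
rewrite leq_eqVlt => /predU1P[->//|]; rewrite ltnS => /IH jk A /jk/sub_pre_mid.
exact: sub_mid_pre.
Qed.

Lemma pre_measurable k : pre D k `<=` measurable.
Proof. by move=> A /sub_pre_mid; exact: mid_measurable. Qed.

Lemma sub_gen_pre j k : (j <= k)%N -> pre D j `<=` <<s pre D k >>.
Proof. by move=> jk A /(sub_pre jk); exact: sub_sigma_algebra. Qed.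

Lemma sub_gen_pre_mid k : pre D k `<=` <<s mid D k >>.
Proof. by move=> A /sub_pre_mid; exact: sub_sigma_algebra. Qed.

Lemma sub_gen_mid_pre k : mid D k `<=` <<s pre D k.+1 >>.
Proof. by move=> A /sub_mid_pre; exact: sub_sigma_algebra. Qed.

Lemma pre_funS j k d' (V : measurableType d') (f : T -> V) : (j <= k)%N ->
  @measurable_fun _ _ (preT j) V setT f -> @measurable_fun _ _ (preT k) V setT f.
Proof.
move=> jk mf; exact: (measurableT_comp mf (measurable_id_sub_sigma_algebra (sub_gen_pre jk))).
Qed.

Lemma mid_pre_fun k d' (V : measurableType d') (f : T -> V) :
  @measurable_fun _ _ (midT k) V setT f -> @measurable_fun _ _ (preT k.+1) V setT f.
Proof.
move=> mf; exact: (measurableT_comp mf (measurable_id_sub_sigma_algebra (@sub_gen_mid_pre k))).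
Qed.

Lemma pre_mid_fun k d' (V : measurableType d') (f : T -> V) :
  @measurable_fun _ _ (preT k) V setT f -> @measurable_fun _ _ (midT k) V setT f.
Proof.
move=> mf; exact: (measurableT_comp mf (measurable_id_sub_sigma_algebra (@sub_gen_pre_mid k))).
Qed.

Lemma mid_fun_measurable k d' (V : measurableType d') (f : T -> V) :
  @measurable_fun _ _ (midT k) V setT f -> measurable_fun setT f.
Proof.
move=> mf; exact: (measurableT_comp mf (measurable_id_g_sigma_algebra (@mid_measurable D k))).
Qed.

Lemma pre_fun_measurable k d' (V : measurableType d') (f : T -> V) :
  @measurable_fun _ _ (preT k) V setT f -> measurable_fun setT f.
Proof. by move/pre_mid_fun/mid_fun_measurable. Qed.

Definition position k w := \sum_(j < k) mark D j w.

Lemma measurable_position k : @measurable_fun _ _ (preT k) R setT (position k).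
Proof.
rewrite /position; apply: measurable_sum => j.
by apply: (@pre_funS j.+1); [exact: ltn_ord|exact: mark_measurable].
Qed.

Lemma position0 w : position 0 w = 0. Proof. by rewrite /position big_ord0. Qed.

Lemma positionS k w : position k.+1 w = position k w + mark D k w.
Proof. by rewrite /position big_ord_recr. Qed.

Lemma FS_position k w : FS (Atom nu) (position k w).
Proof.
by exists k, (fun j : 'I_k => mark D j w); split => // i; exact: mark_atom.
Qed.

(** The outcome enters through the initial information only; what happens after time [0] acts on the
    rate through the state argument alone. *)
Record intensity := Intensity {
  rate :> R -> T -> R -> R;
  rate_lb : R;
  rate_ub : R;
  rate_measurable :
    @measurable_fun _ _ (R * preT 0 * R)%type R setT (fun z => rate z.1.1 z.1.2 z.2);
  rate_lb_gt0 : 0 < rate_lb;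
  rate_bounds : forall t w x, rate_lb <= rate t w x <= rate_ub }.

Variable q : intensity.

(** The rate in force between the jumps [k] and [k + 1], continued to all times by freezing the
    state, so that it is known with [pre D k]. *)
Definition stage_rate k u w := q u w (position k w).

Lemma stage_rate_bounds k u w : rate_lb q <= stage_rate k u w <= rate_ub q.
Proof. exact: rate_bounds. Qed.

Lemma measurable_stage_rate k :
  @measurable_fun _ _ (R * preT k)%type R setT (fun z => stage_rate k z.1 z.2).
Proof.
have mid0 := measurable_id_sub_sigma_algebra (sub_gen_pre (leq0n k)).
have m1 : @measurable_fun _ _ (R * preT k)%type (R * preT 0 * R)%type setT
    (fun z => (z.1, z.2, position k z.2)).
  apply: measurable_fun_pair.
    apply: measurable_fun_pair => //.
    exact: (measurableT_comp mid0 measurable_snd).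
  exact: (measurableT_comp (@measurable_position k) (@measurable_snd _ _ R (preT k))).
exact: (measurableT_comp (rate_measurable q) m1).
Qed.

Lemma measurable_stage_rate_path k w : measurable_fun setT (stage_rate k ^~ w).
Proof. exact: (@measurable_fun_pair1 _ _ _ R (preT k) R _ w (@measurable_stage_rate k)). Qed.

Fixpoint jump_time k w :=
  if k is j.+1 then next_time (stage_rate j) (jump_time j) (gap D j) w else 0.

Arguments jump_time : simpl never.

Lemma jump_timeS k : jump_time k.+1 = next_time (stage_rate k) (jump_time k) (gap D k).
Proof. by []. Qed.

(** The time of jump [k + 1] is known already in [mid D k], before its size [mark D k]; this is what
    makes the size independent of the time. *)
Lemma measurable_jump_time k : @measurable_fun _ _ (preT k) R setT (jump_time k)
  /\ @measurable_fun _ _ (midT k) R setT (jump_time k.+1).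
Proof.
suff step j : @measurable_fun _ _ (preT j) R setT (jump_time j) ->
    @measurable_fun _ _ (midT j) R setT (jump_time j.+1).
  elim: k => [|k [IH1 IH2]].
    have m0 : @measurable_fun _ _ (preT 0) R setT (jump_time 0).
      exact: (@measurable_cst _ _ (preT 0) R setT 0).
    by split; [exact: m0|exact: step].
  have m1 := mid_pre_fun IH2.
  by split; [exact: m1|exact: step].
move=> mj; rewrite jump_timeS.
apply: (@measurable_next_time _ _ _ (pre D j) (stage_rate j) (rate_lb q) (rate_ub q)) => //.
- exact: measurable_stage_rate.
- exact: rate_lb_gt0.
- exact: stage_rate_bounds.
- exact: gap_gt0.
- exact: sub_gen_pre_mid.
- exact: gap_measurable.
Qed.

Lemma jump_time_lt k w : jump_time k w < jump_time k.+1 w.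
Proof.
by apply: (hitting_gt (@measurable_stage_rate_path k w) (rate_lb_gt0 q)) => [u|];
  [exact: stage_rate_bounds|exact: gap_gt0].
Qed.

Lemma le_jump_time j k w : (j <= k)%N -> jump_time j w <= jump_time k w.
Proof.
elim: k => [|k IH]; first by rewrite leqn0 => /eqP ->.
rewrite leq_eqVlt => /predU1P[->//|]; rewrite ltnS => /IH h.
exact: le_trans h (ltW (jump_time_lt k w)).
Qed.

Lemma lt_jump_time j k w : (j < k)%N -> jump_time j w < jump_time k w.
Proof. by move=> jk; apply: lt_le_trans (jump_time_lt j w) (le_jump_time w jk). Qed.

Lemma jump_time_ge0 k w : 0 <= jump_time k w.
Proof. by rewrite -[0]/(jump_time 0 w) le_jump_time. Qed.

Lemma jump_time_gt0 k w : 0 < jump_time k.+1 w.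
Proof. exact: le_lt_trans (jump_time_ge0 k w) (jump_time_lt k w). Qed.

Lemma rate_ub_gt0 : 0 < rate_ub q.
Proof.
have /andP[a b] := rate_bounds q 0 point 0.
exact: lt_le_trans (rate_lb_gt0 q) (le_trans a b).
Qed.

(** No explosion: rates are at most [rate_ub q], so each waiting time is at least the gap divided by
    [rate_ub q], and the gaps have unbounded sums. *)
Lemma jump_time_unbounded t w : exists k, t < jump_time k w.
Proof.
have lb k : (\sum_(j < k) gap D j w) / rate_ub q <= jump_time k w.
  elim: k => [|k IH]; first by rewrite big_ord0 mul0r.
  rewrite big_ord_recr/= mulrDl.
  have := @hitting_lb R (stage_rate k ^~ w) _ (rate_ub q) (@measurable_stage_rate_path k w)
    (rate_lb_gt0 q) (fun u => stage_rate_bounds k u w) (jump_time k w) _ (ltW (gap_gt0 D k w)).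
  by apply: le_trans; rewrite lerD2r.
have [n hn] := gap_sum_unbounded D w (t * rate_ub q).
by exists n; apply: lt_le_trans (lb n); rewrite ltr_pdivlMr ?rate_ub_gt0.
Qed.

Let ex_left t w : exists k, t <= jump_time k.+1 w.
Proof.
have [k tk] := jump_time_unbounded t w.
by exists k; exact/ltW/(lt_trans tk)/jump_time_lt.
Qed.

Let ex_right t w : exists k, t < jump_time k.+1 w.
Proof.
have [k tk] := jump_time_unbounded t w.
by exists k; exact/(lt_trans tk)/jump_time_lt.
Qed.

(** [ex_left] and [ex_right] differ in the strictness of one inequality, which decides whether a
    jump at [t] itself is counted; hence the left limit on one side and the right-continuous state
    on the other. *)
Definition jumps_before t w := ex_minn (ex_left t w).
Definition jumps_upto t w := ex_minn (ex_right t w).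
Definition left_state t w := position (jumps_before t w) w.
Definition state t w := position (jumps_upto t w) w.

Lemma jumps_beforeE k t w : jump_time k w < t <= jump_time k.+1 w -> jumps_before t w = k.
Proof.
move=> /andP[kt tk]; rewrite /jumps_before; case: ex_minnP => m tm mmin.
apply/eqP; rewrite eqn_leq mmin//= leqNgt; apply/negP => mk.
by move: (lt_le_trans kt tm); rewrite ltNge le_jump_time.
Qed.

Lemma jumps_uptoE k t w : jump_time k w <= t < jump_time k.+1 w -> jumps_upto t w = k.
Proof.
move=> /andP[kt tk]; rewrite /jumps_upto; case: ex_minnP => m tm mmin.
apply/eqP; rewrite eqn_leq mmin//= leqNgt; apply/negP => mk.
by move: (le_lt_trans kt tm); rewrite ltNge le_jump_time.
Qed.

Lemma jumps_beforeP t w : 0 < t ->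
  jump_time (jumps_before t w) w < t <= jump_time (jumps_before t w).+1 w.
Proof.
move=> t0; rewrite /jumps_before; case: ex_minnP => -[|m] tm mmin; rewrite tm andbT//.
by rewrite ltNge; apply/negP => /mmin; rewrite ltnn.
Qed.

Lemma jumps_uptoP t w : 0 <= t ->
  jump_time (jumps_upto t w) w <= t < jump_time (jumps_upto t w).+1 w.
Proof.
move=> t0; rewrite /jumps_upto; case: ex_minnP => -[|m] tm mmin; rewrite tm andbT//.
by rewrite leNgt; apply/negP => /mmin; rewrite ltnn.
Qed.

Lemma jumps_before0 t w : t <= 0 -> jumps_before t w = 0%N.
Proof.
move=> t0; rewrite /jumps_before; case: ex_minnP => m tm mmin; apply/eqP.
by rewrite -leqn0 mmin//; apply: le_trans t0 (jump_time_ge0 _ _).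
Qed.

Lemma jumps_upto0 t w : t <= 0 -> jumps_upto t w = 0%N.
Proof.
move=> t0; rewrite /jumps_upto; case: ex_minnP => m tm mmin; apply/eqP.
by rewrite -leqn0 mmin//; apply: le_lt_trans t0 (jump_time_gt0 _ _).
Qed.

Lemma left_stateE k t w : jump_time k w < t <= jump_time k.+1 w -> left_state t w = position k w.
Proof. by move=> /jumps_beforeE; rewrite /left_state => ->. Qed.

Lemma left_state0 t w : t <= 0 -> left_state t w = 0.
Proof. by move=> t0; rewrite /left_state jumps_before0// position0. Qed.

Lemma state0 t w : t <= 0 -> state t w = 0.
Proof. by move=> t0; rewrite /state jumps_upto0// position0. Qed.

Lemma left_limit_state t w : left_limit (state ^~ w) t = left_state t w.
Proof.
rewrite /left_limit; case: ltP => [t0|t0]; last by rewrite state0// left_state0.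
have /andP[kt tk] := jumps_beforeP w t0.
apply/cvg_lim => //; apply: cvg_near_cst; near=> s.
rewrite /state (@jumps_uptoE (jumps_before t w))//.
apply/andP; split; near: s; last first.
  exists 1 => //= s _ st; exact: lt_le_trans st tk.
exists (t - jump_time (jumps_before t w) w); first by rewrite /= subr_gt0.
move=> s /= /[swap] st; rewrite gtr0_norm ?subr_gt0//.
by rewrite ltrD2l ltrN2 => /ltW.
Unshelve. all: by end_near. Qed.

Lemma jump_state_jump_time k w : jump (state ^~ w) (jump_time k.+1 w) = mark D k w.
Proof.
rewrite /jump left_limit_state (@left_stateE k) ?jump_time_lt ?lexx//.
by rewrite /state (@jumps_uptoE k.+1) ?jump_time_lt ?lexx// positionS addrAC subrr add0r.
Qed.

Lemma jump_state_neq0 t w : 0 < t -> jump (state ^~ w) t != 0 ->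
  exists k, t = jump_time k.+1 w.
Proof.
move=> t0; rewrite /jump left_limit_state.
have /andP[kt] := jumps_beforeP w t0; set k := jumps_before t w in kt *.
rewrite le_eqVlt => /predU1P[->|tk]; first by exists k.
rewrite (@left_stateE k) ?kt ?(ltW tk)// /state (@jumps_uptoE k) ?(ltW kt)//.
by rewrite subrr eqxx.
Qed.

End driver.

Arguments jump_time {_ _ _ _ _ _} _ _ _ : simpl never.

(** * The filtration of the jump process *)

Section predictable_space.
Context d (T : measurableType d) (R : realType) (F : R -> set (set T)).
Local Notation predT := (predictable_space F).

Lemma measurable_predictable_after s A : 0 <= s -> F s A ->
  measurable ([set z | s < z.1 /\ A z.2] : set predT).
Proof.
move=> s0 FA.
rewrite (_ : [set _ | _] = \bigcup_n (`]s, s + n.+1%:R]%classic `*` A)); last first.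
  apply/seteqP; split=> -[u w] /=; last first.
    by move=> [n _ [/=]]; rewrite in_itv/= => /andP[].
  move=> [su Aw]; exists (Num.truncn (u - s)) => //; split=> //=.
  by rewrite in_itv/= su/= -lerBlDl ltW// truncnS_gt.
apply: bigcupT_measurable => n; apply: sub_sigma_algebra; right.
by exists s, (s + n.+1%:R), A; rewrite ltrDl ltr0n.
Qed.

Lemma measurable_predictable_Rplus A : F 0 A -> measurable ((Rplus `*` A) : set predT).
Proof.
move=> FA; rewrite (_ : _ `*` _ = ([set 0] `*` A) `|` [set z | 0 < z.1 /\ A z.2]); last first.
  apply/seteqP; split=> -[u w] /=; rewrite /Rplus/= in_itv/= andbT.
    by move=> [u0 Aw]; move: u0; rewrite le_eqVlt => /predU1P[<-|]; [left|right].
  by case=> -[] => [->|/ltW].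
apply: measurableU; last exact: measurable_predictable_after.
by apply: sub_sigma_algebra; left; exists A.
Qed.

Lemma measurable_id_predictable_space : (forall t, 0 <= t -> F t `<=` measurable) ->
  @measurable_fun _ _ (R * T)%type predT setT id.
Proof.
move=> Fm; apply: (@measurability _ _ (R * T)%type (predictable_space F) _ _ (predictable_rectangle F)) => //.
move=> _ [_ [[A FA ->]|[s [t [A [s0 st FA ->]]]]] <-]; rewrite setTI preimage_id.
  by apply: measurableX => //; exact: Fm FA.
by apply: measurableX => //; exact: Fm FA.
Qed.

End predictable_space.

Lemma measurable_fun_pair_dom d d1 d2 (X : measurableType d)
    (Y1 : measurableType d1) (Y2 : measurableType d2) (B : set X)
    (f : X -> Y1) (g : X -> Y2) : measurable B ->
  measurable_fun B f -> measurable_fun B g -> measurable_fun B (fun x => (f x, g x)).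
Proof.
move=> mB /(measurable_restrictT _ mB) mf /(measurable_restrictT _ mB) mg.
apply: (@eq_measurable_fun _ _ _ _ _ (fun x => ((f \_ B) x, (g \_ B) x))).
  by move=> x xB; rewrite !patchE xB.
exact/measurable_funTS/measurable_fun_pair.
Qed.

Section jump_filtration.
Context d (T : measurableType d) (R : realType) (P : probability T R).
Variables (nu : probability R R) (D : driver P nu) (q : intensity D).
Local Notation preT k := (g_sigma_algebraType (pre D k)).
Local Notation tau k := (jump_time q k).

(* Up to the event that the next jump has occurred, an event of the filtration at
   time [t] is an event of [pre D k]. *)
Definition jump_filtration t : set (set T) := [set A | measurable A /\
  forall k, exists2 B, pre D k B &
    A `&` [set w | t < tau k.+1 w] = B `&` [set w | t < tau k.+1 w]].
Local Notation G := jump_filtration.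

Lemma pre_measurableE k (A : set T) : pre D k A <-> @measurable _ (preT k) A.
Proof. by rewrite measurable_g_measurableTypeE//; exact: pre_sigma_algebra. Qed.

Lemma pre_jump_time_le k t : pre D k [set w | tau k w <= t].
Proof.
apply/pre_measurableE; have [m _] := measurable_jump_time q k.
have := m measurableT `]-oo, t]%classic (measurable_itv _).
by rewrite setTI; congr measurable; apply/seteqP; split=> w /=; rewrite in_itv.
Qed.

Lemma jump_filtration_sigma_algebra t : sigma_algebra setT (G t).
Proof.
split.
- split; first exact: measurable0.
  by move=> k; exists set0; [apply/pre_measurableE; exact: measurable0|rewrite !set0I].
- move=> A [mA GA]; rewrite setTD; split; first exact: measurableC.
  move=> k; have [B pB AB] := GA k; exists (~` B).
    by apply/pre_measurableE/measurableC/pre_measurableE.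
  apply/seteqP; split=> w [nAw tw]; split=> // Xw; apply: nAw.
    by have [] : (A `&` [set w | t < tau k.+1 w]) w by rewrite AB.
  by have [] : (B `&` [set w | t < tau k.+1 w]) w by rewrite -AB.
- move=> A GA; split; first by apply: bigcupT_measurable => n; have [] := GA n.
  move=> k.
  have /choice[B BP] n : exists B, pre D k B /\
      A n `&` [set w | t < tau k.+1 w] = B `&` [set w | t < tau k.+1 w].
    by have [_ /(_ k)[B ? ?]] := GA n; exists B.
  exists (\bigcup_n B n).
    by apply/pre_measurableE; apply: bigcupT_measurable => n; apply/pre_measurableE; have [] := BP n.
  by rewrite !setI_bigcupl; apply: eq_bigcupr => n _; have [] := BP n.
Qed.

Lemma jump_filtration_measurable t : G t `<=` measurable.
Proof. by move=> A []. Qed.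

Lemma sub_jump_filtration s t : s <= t -> G s `<=` G t.
Proof.
move=> st A [mA GA]; split=> // k; have [B pB AB] := GA k; exists B => //.
apply/seteqP; split=> w [Xw tw]; split=> //.
  by have [] : (B `&` [set w | s < tau k.+1 w]) w by rewrite -AB; split=> //; exact: le_lt_trans tw.
by have [] : (A `&` [set w | s < tau k.+1 w]) w by rewrite AB; split=> //; exact: le_lt_trans tw.
Qed.

Lemma filtration_jump_filtration : filtration G.
Proof.
split.
- by move=> t _; exact: jump_filtration_sigma_algebra.
- by move=> t _; exact: jump_filtration_measurable.
- by move=> s t _; exact: sub_jump_filtration.
Qed.

Lemma right_continuous_jump_filtration : Defs.right_continuous G.
Proof.
move=> t t0 A GA.
have GAs s : t < s -> G s A by move=> ts; apply: GA; rewrite /= in_itv/= ts.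
split; first by have [|] := GAs (t + 1); rewrite ?ltrDl.
move=> k; pose e n : R := t + n.+1%:R^-1.
have /choice[B BP] n : exists B, pre D k B /\
    A `&` [set w | e n < tau k.+1 w] = B `&` [set w | e n < tau k.+1 w].
  have [|_ /(_ k)[B ? ?]] := GAs (e n); first by rewrite ltrDl invr_gt0 ltr0n.
  by exists B.
(* The lower limit of the [B n]. Where [t < tau k.+1], all but finitely many [n] satisfy
   [e n < tau k.+1], and for these [B n] agrees with [A]. *)
exists (\bigcup_m \bigcap_(n in [set n | (m <= n)%N]) B n).
  apply/pre_measurableE; apply: bigcupT_measurable => m.
  by apply: bigcap_measurable => [|n _]; [by exists m => /=|apply/pre_measurableE; have [] := BP n].
have ev w : t < tau k.+1 w -> exists m, forall n, (m <= n)%N -> e n < tau k.+1 w.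
  move=> /ltr_add_invr[m tm]; exists m => n mn; apply: le_lt_trans tm.
  by rewrite lerD2l lef_pV2 ?posrE ?ltr0n// ler_nat ltnS.
apply/seteqP; split=> w [Xw tw]; split=> //; have [m mP] := ev w tw.
  exists m => // n /= mn.
  by have [] : (B n `&` [set w | e n < tau k.+1 w]) w by have [_ <-] := BP n; split=> //; exact: mP.
have [m' _ m'P] := Xw; pose n := maxn m m'.
have [] // : (A `&` [set w | e n < tau k.+1 w]) w.
have [_ ->] := BP n; split; first by apply: m'P; rewrite /= leq_maxr.
by apply: mP; rewrite leq_maxl.
Qed.

Lemma pre0_jump_filtration t : pre D 0 `<=` G t.
Proof.
move=> A pA; split; first exact: (@pre_measurable _ _ _ _ _ D 0).
by move=> k; exists A => //; exact: sub_pre pA.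
Qed.

Lemma usual_conditions_jump_filtration : usual_conditions P G.
Proof.
split; first exact: right_continuous_jump_filtration.
by move=> N mN /(pre_null D mN)/pre0_jump_filtration.
Qed.

(** Once jump [k] has occurred, everything in [pre D k] is known. For [j < k] the event is disjoint
    from [[t < tau j.+1]], so the empty set represents it there. *)
Lemma jump_filtration_after k t A : pre D k A -> G t (A `&` [set w | tau k w <= t]).
Proof.
move=> pA; have pAk : pre D k (A `&` [set w | tau k w <= t]).
  apply/pre_measurableE/measurableI; apply/pre_measurableE => //.
  exact: pre_jump_time_le.
split; first exact: (@pre_measurable _ _ _ _ _ D k).
move=> j; have [kj|jk] := leqP k j; first by exists (A `&` [set w | tau k w <= t]) => //; exact: sub_pre pAk.
exists set0; first by apply/pre_measurableE; exact: measurable0.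
rewrite set0I; apply/seteqP; split=> // w [[_ /= kt]].
by rewrite ltNge (le_trans _ kt)// le_jump_time.
Qed.

Lemma adapted_state : adapted G (state q).
Proof.
move=> t t0 _ V mV; rewrite setTI.
rewrite (_ : _ @^-1` _ = \bigcup_k ((position D k @^-1` V `&` [set w | tau k w <= t]) `&`
    ~` (setT `&` [set w | tau k.+1 w <= t]))); last first.
  apply/seteqP; split=> w /=.
    have kP := jumps_uptoP q w t0; move=> Vw; exists (jumps_upto q t w) => //.
    by have /andP[? ?] := kP; split=> //= -[_]; apply/negP; rewrite -ltNge.
  move=> [k _ [[Vw kt]]] /= kt'.
  rewrite /state (@jumps_uptoE _ _ _ _ _ _ q k)// kt/= ltNge.
  by apply/negP => ?; apply: kt'.
apply: bigcupT_measurable => k; apply: measurableI; last first.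
  apply: measurableC; apply: sub_sigma_algebra; apply: jump_filtration_after.
  by apply/pre_measurableE; exact: measurableT.
apply: sub_sigma_algebra; apply: jump_filtration_after; apply/pre_measurableE.
by rewrite -[X in measurable X]setTI; exact: measurable_position.
Qed.

Local Notation predT := (predictable_space G).

(** A rational [r] with [tau k <= r < u] writes the set as a countable union of predictable sets
    that start at a deterministic time. *)
Lemma measurable_predictable_jump k A : pre D k A -> (0 < k)%N ->
  measurable ([set z | tau k z.2 < z.1 /\ A z.2] : set predT).
Proof.
move=> pA k0.
rewrite (_ : [set _ | _] = \bigcup_(r : rat) [set z | ratr r < z.1 /\
    (0 <= ratr r :> R /\ (A `&` [set w | tau k w <= ratr r]) z.2)]); last first.
  apply/seteqP; split=> -[u w] /=; last first.
    by move=> [r _ /= [ru [r0 [Aw kr]]]]; split=> //; exact: le_lt_trans ru.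
  move=> [ku Aw]; have [r] := rat_in_itvoo ku; rewrite in_itv/= => /andP[kr ru].
  exists r => //; split=> //; split; last by split=> //; exact: ltW.
  by apply: le_trans (ltW kr); exact: jump_time_ge0.
apply: bigcupT_measurable_rat => r.
have [r0|r0] := leP 0 (ratr r : R).
  rewrite (_ : [set _ | _] = [set z | ratr r < z.1 /\ (A `&` [set w | tau k w <= ratr r]) z.2]).
    by apply: measurable_predictable_after => //; exact: jump_filtration_after.
  by apply/seteqP; split=> z [? []].
rewrite (_ : [set _ | _] = set0) ?measurable0//.
by apply/seteqP; split=> // z /= [_ [//]]; rewrite leNgt r0.
Qed.

Lemma measurable_left_state : measurable_fun setT (fun z : predT => left_state q z.1 z.2).
Proof.
move=> _ V mV; rewrite setTI.
pose late k (A : set T) : set predT := [set z | tau k z.2 < z.1 /\ A z.2].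
(* On each stochastic interval between successive jumps the left state is a fixed [position k]. The
   first piece also contains the times [u <= 0], where the left state is [0]. *)
rewrite (_ : _ @^-1` _ = (~` late 1 setT `&` [set _ | V 0]) `|`
    \bigcup_k (late k.+1 (position D k.+1 @^-1` V) `&` ~` late k.+2 setT)); last first.
  apply/seteqP; split=> -[u w] /=.
    have [u0|u0] := leP u 0.
      rewrite left_state0// => V0; left; split=> // -[].
      by rewrite ltNge (le_trans u0)// jump_time_ge0.
    have := jumps_beforeP q w u0; rewrite /left_state.
    case: (jumps_before q u w) => [|k] /andP[ku uk] Vu.
      by left; split; [case; rewrite ltNge uk|rewrite position0 in Vu].
    by right; exists k => //; split; [split|case; rewrite ltNge uk].
  case=> [[late1 V0]|[k _ [[/= ku Vw] late2]]].
    have u1 : u <= tau 1 w by rewrite leNgt; apply/negP => ?; apply: late1.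
    have [u0|u0] := leP u 0; first by rewrite left_state0.
    by rewrite (@left_stateE _ _ _ _ _ _ q 0) ?position0// u0.
  have uk : u <= tau k.+2 w by rewrite leNgt; apply/negP => ?; apply: late2.
  by rewrite (@left_stateE _ _ _ _ _ _ q k.+1)// ku.
have preT_ k : pre D k [set: T] by apply/pre_measurableE; exact: measurableT.
apply: measurableU.
  apply: measurableI; first exact: measurableC (measurable_predictable_jump (preT_ 1%N) _).
  have [V0|V0] := pselect (V 0).
    have -> : [set _ | V 0] = setT :> set predT by apply/seteqP; split.
    exact: measurableT.
  have -> : [set _ | V 0] = set0 :> set predT by apply/seteqP; split.
  exact: measurable0.
apply: bigcupT_measurable => k; apply: measurableI.
  apply: measurable_predictable_jump => //; apply/pre_measurableE.
  by rewrite -[X in measurable X]setTI; exact: measurable_position.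
exact: measurableC (measurable_predictable_jump (preT_ k.+2) _).
Qed.

Lemma measurable_Rplus_predictable : measurable (Rplus `*` setT : set predT).
Proof.
apply: measurable_predictable_Rplus; apply: pre0_jump_filtration.
by apply/pre_measurableE; exact: measurableT.
Qed.

(** The predictable rectangles do not separate negative times, hence the restriction to nonnegative
    ones. *)
Lemma measurable_predictable_time :
  @measurable_fun _ _ predT R (Rplus `*` setT) fst.
Proof.
apply: (measurability _ (RGenOInfty.measurableE R)) => _ [_ [x ->] <-].
have [x0|x0] := ltP x 0.
  rewrite (_ : _ `&` _ = Rplus `*` setT); first exact: measurable_Rplus_predictable.
  apply/seteqP; split=> -[u w] /=; rewrite /Rplus/= !in_itv/= !andbT; first by case.
  by move=> [u0 _]; split=> //; exact: lt_le_trans u0.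
rewrite (_ : _ `&` _ = [set z | x < z.1 /\ setT z.2]).
  by apply: measurable_predictable_after => //; apply: pre0_jump_filtration; apply/pre_measurableE; exact: measurableT.
apply/seteqP; split=> -[u w] /=; rewrite /Rplus/= !in_itv/= !andbT; first by case=> _ ->.
by move=> [xu _]; split=> //; split => //; exact: le_trans (ltW xu).
Qed.

Lemma measurable_predictable_outcome :
  @measurable_fun _ _ predT (preT 0) (Rplus `*` setT) snd.
Proof.
move=> _ A mA.
rewrite (_ : _ `&` _ = Rplus `*` A).
  by apply: measurable_predictable_Rplus; apply: pre0_jump_filtration; exact/pre_measurableE.
by apply/seteqP; split=> -[u w] /= [] => [[? ?] ?|? ?].
Qed.

Lemma measurable_predictable_rate : @measurable_fun _ _ predT R (Rplus `*` setT)
  (fun z : predT => q z.1 z.2 (left_state q z.1 z.2)).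
Proof.
have m : @measurable_fun _ _ predT (R * preT 0 * R)%type (Rplus `*` setT)
    (fun z : predT => (z.1, z.2, left_state q z.1 z.2)).
  apply: (@measurable_fun_pair_dom _ _ _ predT (R * preT 0)%type R).
  - exact: measurable_Rplus_predictable.
  - apply: (@measurable_fun_pair_dom _ _ _ predT R (preT 0)).
    + exact: measurable_Rplus_predictable.
    + exact: measurable_predictable_time.
    + exact: measurable_predictable_outcome.
  - by apply: measurable_funTS; exact: measurable_left_state.
exact: (measurableT_comp (rate_measurable q) m).
Qed.

End jump_filtration.

(** * Compensation of the jumps *)

Section lebesgue_on_reals.
Context (R : realType).
Local Open Scope ereal_scope.

(* Lebesgue measure lives on [measurableTypeR R], whose measurable structure is
   convertible to the canonical one of [R] but carries another display. *)
Definition lebR : set R -> \bar R := @lebesgue_measure R.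

Let lebR0 : lebR set0 = 0.
Proof. exact: (measure0 (@lebesgue_measure R)). Qed.

Let lebR_ge0 B : 0 <= lebR B.
Proof. exact: (measure_ge0 (@lebesgue_measure R)). Qed.

Let lebR_sigma_additive : semi_sigma_additive lebR.
Proof. exact: (@measure_semi_sigma_additive _ _ _ (@lebesgue_measure R)). Qed.

HB.instance Definition _ := isMeasure.Build _ R R lebR
  lebR0 lebR_ge0 lebR_sigma_additive.

Let lebR_sigma_finite : sigma_finite setT lebR.
Proof. exact: (sigma_finiteT (@lebesgue_measure R)). Qed.

HB.instance Definition _ := Measure_isSigmaFinite.Build _ _ _ lebR lebR_sigma_finite.

Lemma ge0_integral_lebR (f : R -> \bar R) : measurable_fun setT f ->
  (forall x, 0 <= f x) -> \int[lebR]_x f x = \int[@lebesgue_measure R]_x f x.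
Proof.
move=> mf f0.
have mid : @measurable_fun _ _ R (measurableTypeR R) setT id by [].
rewrite -(ge0_integral_image_measure lebR mid)//.
Qed.

End lebesgue_on_reals.

Section time_mark_measure.
Context (R : realType) (nu : probability R R).
Local Open Scope ereal_scope.

(* A name of its own for [lebR \x nu]: canonical structure inference does not find
   the sigma-finiteness of [\x]. *)
Definition time_mark : set (R * R) -> \bar R := lebR (R:=R) \x nu.

Let time_mark0 : time_mark set0 = 0.
Proof. exact: (measure0 (lebR (R:=R) \x nu)). Qed.

Let time_mark_ge0 B : 0 <= time_mark B.
Proof. exact: (measure_ge0 (lebR (R:=R) \x nu)). Qed.

Let time_mark_sigma_additive : semi_sigma_additive time_mark.
Proof. exact: (@measure_semi_sigma_additive _ _ _ (lebR (R:=R) \x nu)). Qed.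

HB.instance Definition _ := isMeasure.Build _ (R * R)%type R time_mark
  time_mark0 time_mark_ge0 time_mark_sigma_additive.

Let time_mark_sigma_finite : sigma_finite setT time_mark.
Proof.
have [F [TF _ Foo]] := (sigma_finiteP setT (lebR (R:=R))).1 (sigma_finiteT _).
exists (fun n => F n `*` setT).
  apply/seteqP; split=> // -[u x] _; have [n _ Fu] : (\bigcup_i F i) u by rewrite -TF.
  by exists n.
move=> k; have [mF Fk] := Foo k; split; first exact: measurableX.
by rewrite /time_mark product_measure1E//= probability_setT mule1.
Qed.

HB.instance Definition _ := Measure_isSigmaFinite.Build _ _ _ time_mark
  time_mark_sigma_finite.

Lemma ge0_integral_time_mark (f : R * R -> \bar R) : measurable_fun setT f ->
  (forall z, 0 <= f z) ->
  \int[time_mark]_z f z = \int[@lebesgue_measure R]_u \int[nu]_x f (u, x).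
Proof.
move=> mf f0.
transitivity (\int[lebR (R:=R)]_u \int[nu]_x f (u, x)).
  exact: (@fubini_tonelli1 _ _ R R R (lebR (R:=R)) nu f).
rewrite ge0_integral_lebR//.
- exact: (@measurable_fun_fubini_tonelli_F _ _ R R R nu f).
- by move=> u; exact: integral_ge0.
Qed.

End time_mark_measure.

(** Uniqueness is used twice: for fixed [B] both sides are measures in [A] that agree on [C], which
    yields all measurable rectangles; these in turn determine the measure on the product. *)
Lemma g_sigma_prod_measure_unique d' d (R : realType) (X : measurableType d')
    (Y : measurableType d) (C : set (set X)) (g : (set X)^nat)
    (m1 m2 : {measure set (X * Y) -> \bar R}) :
  @measurable _ X = <<s C >> -> setI_closed C -> (forall i, C (g i)) -> \bigcup_i g i = setT ->
  (m1 setT < +oo)%E ->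
  (forall A B, C A -> measurable B -> m1 (A `*` B) = m2 (A `*` B)) ->
  forall S, measurable S -> m1 S = m2 S.
Proof.
move=> XC IC Cg gT fin m12.
have fstep (B : set Y) : measurable B -> forall A, @measurable _ X A ->
    m1 (A `*` B) = m2 (A `*` B).
  move=> mB A mA.
  have mTB : measurable (setT `*` B : set (X * Y)) by exact: measurableX.
  have E (m : {measure set (X * Y) -> \bar R}) (A' : set X) :
      image_measure (mrestr m mTB) (@measurable_fst _ _ X Y) A' = m (A' `*` B).
    rewrite image_measureE /mrestr; congr (m _).
    by apply/seteqP; split=> -[x y] /=; [case=> ? []|case].
  rewrite -!E.
  apply: (@g_sigma_algebra_measure_unique _ R X C _ g) => //.
  - by rewrite XC; exact: sub_sigma_algebra.
  - by move=> A' CA'; change (image_measure (mrestr m1 mTB) (@measurable_fst _ _ X Y) A' = image_measure (mrestr m2 mTB) (@measurable_fst _ _ X Y) A'); rewrite !E; exact: m12.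
  - move=> k; change (image_measure (mrestr m1 mTB) (@measurable_fst _ _ X Y) (g k) < +oo)%E; rewrite E.
    apply: le_lt_trans fin; apply: le_measure => //; rewrite inE//.
    by apply: measurableX => //; rewrite XC; apply: sub_sigma_algebra.
  - by rewrite -XC.
apply: (measure_unique [set A `*` B | A in @measurable _ X & B in measurable] (fun=> setT)) => //.
- by rewrite measurable_prod_measurableType.
- move=> _ _ [X1 mX1 [Y1 mY1 <-]] [X2 mX2 [Y2 mY2 <-]].
  by rewrite -setXI; exists (X1 `&` X2); [exact: measurableI|exists (Y1 `&` Y2) => //; exact: measurableI].
- by move=> _; exists setT => //; exists setT => //; rewrite setXTT.
- by rewrite bigcup_const.
- by move=> _ [A mA [B mB <-]]; exact: fstep.
Qed.

(** * Generators of the predictable sigma-algebra *)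

Section predictable_generators.
Context d (T : measurableType d) (R : realType).
Variables (F : R -> set (set T)) (FF : filtration F).
Local Notation predT := (predictable_space F).

(** The predictable space also contains the negative times; taking them as one more generator lets
    countably many generators cover the space, as uniqueness of measures requires. *)
Definition predictable_generator : set (set (R * T)) :=
  predictable_rectangle F `|` [set [set z | z.1 < 0]].

Let FT s : 0 <= s -> F s setT.
Proof.
by case: FF => FA _ _ s0; have := @measurableT _ (g_sigma_algebraType (F s)); rewrite measurable_g_measurableTypeE//; exact: FA.
Qed.

Let F0 s : 0 <= s -> F s set0.
Proof. by case: FF => FA _ _ /FA[]. Qed.

Let FI s A B : 0 <= s -> F s A -> F s B -> F s (A `&` B).
Proof.
case: FF => FA _ _ s0; have := @measurableI _ (g_sigma_algebraType (F s)) A B.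
by rewrite measurable_g_measurableTypeE//; exact: FA.
Qed.

Definition predictable_cover (n : nat) : set (R * T) :=
  match n with
  | 0 => [set z | z.1 < 0]
  | 1 => [set 0] `*` setT
  | m.+2 => `]0, m.+1%:R] `*` setT
  end.

Lemma predictable_coverP i : predictable_generator (predictable_cover i).
Proof.
case: i => [|[|m]]; first by right.
  by left; left; exists setT => //; exact: FT.
by left; right; exists 0, m.+1%:R, setT; split => //; exact: FT.
Qed.

Lemma predictable_coverT : \bigcup_i predictable_cover i = setT.
Proof.
apply/seteqP; split=> // -[u w] _; have [u0|u0|u0] := ltgtP u 0.
- by exists 0%N.
- exists (Num.truncn u).+2 => //=; split=> //=; rewrite in_itv/= u0/= ltW//.
  exact: truncnS_gt.
- by exists 1%N.
Qed.

Lemma predictable_generatorE : @measurable _ predT = <<s predictable_generator >>.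
Proof.
apply/seteqP; split.
  by apply: sub_sigma_algebra2 => A ?; left.
apply: smallest_sub; first exact: smallest_sigma_algebra.
move=> A [|->]; first exact: sub_sigma_algebra.
rewrite (_ : [set _ | _] = ~` (([set 0] `*` setT) `|` \bigcup_m (`]0, m.+1%:R] `*` setT))); last first.
  apply/seteqP; split=> -[u w] /=.
    by move=> u0 [[/= u00]|[m _ [/=]]]; [rewrite u00 ltxx in u0|rewrite in_itv/= ltNge ltW].
  move=> nu; rewrite ltNge; apply/negP; rewrite le_eqVlt => /predU1P[u0|u0]; apply: nu.
    by left.
  right; exists (Num.truncn u) => //=; split => //=; rewrite in_itv/= u0/= ltW//.
  exact: truncnS_gt.
apply: (@measurableC _ predT); apply: (@measurableU _ predT).
  by apply: sub_sigma_algebra; left; exists setT => //; exact: FT.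
apply: (@bigcupT_measurable _ predT) => m.
by apply: sub_sigma_algebra; right; exists 0, m.+1%:R, setT; split => //; exact: FT.
Qed.

Lemma predictable_generatorI : setI_closed predictable_generator.
Proof.
have Z : predictable_generator set0.
  by left; left; exists set0; [exact: F0|rewrite setX0].
have ZI (A : set (R * T)) : predictable_rectangle F A -> [set z | z.1 < 0] `&` A = set0.
  move=> [[B _ ->]|[s [t [B [s0 st _ ->]]]]]; apply/seteqP; split=> // -[u w] /=.
    by case=> u0 [u00 _]; rewrite u00 ltxx in u0.
  by case=> u0 [/=]; rewrite in_itv/= => /andP[su _]; move: (le_lt_trans s0 su); rewrite ltNge ltW.
have ZI2 (A B : set T) (s t : R) : 0 <= s -> ([set 0] `*` A) `&` (`]s, t] `*` B) = set0.
  move=> s0; apply/seteqP; split=> // -[u w] /= [[/= -> _] [/=]].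
  by rewrite in_itv/= ltNge s0.
move=> A B [RA|->] [RB|->].
- case: RA => [[A' FA' ->]|[s [t [A' [s0 st FA' ->]]]]]; case: RB => [[B' FB' ->]|[s' [t' [B' [s'0 st' FB' ->]]]]].
  + left; left; exists (A' `&` B'); first exact: FI.
    by rewrite -setXI setIid.
  + by rewrite ZI2.
  + by rewrite setIC ZI2.
  + have -> : (`]s, t] `*` A') `&` (`]s', t'] `*` B') = `]Num.max s s', Num.min t t'] `*` (A' `&` B').
      rewrite -setXI; congr (_ `*` _); apply/seteqP; split=> u /=; rewrite !in_itv/= gt_max le_min.
        by move=> [/andP[-> ->] /andP[-> ->]].
      by move=> /andP[/andP[-> ->] /andP[-> ->]].
    have [h|h] := ltP (Num.max s s') (Num.min t t'); last first.
      rewrite (_ : _ `*` _ = set0)//; apply/seteqP; split=> // -[u w] [/=].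
      by rewrite in_itv/= => /andP[u1 u2]; move: (lt_le_trans u1 u2); rewrite ltNge h.
    have m0 : 0 <= Num.max s s' by rewrite le_max s0.
    left; right; exists (Num.max s s'), (Num.min t t'), (A' `&` B'); split=> //.
    have [_ _ mono] := FF.
    apply: FI => //.
      by apply: (mono s) FA' => //; rewrite le_max lexx.
    by apply: (mono s') FB' => //; rewrite le_max lexx orbT.
- by rewrite setIC ZI.
- by rewrite ZI.
- by right; rewrite setIid.
Qed.

End predictable_generators.

Lemma measurable_indic_comp d1 d2 (X : measurableType d1) (Y : measurableType d2)
    (R : realType) (B : set Y) (E : set X) (g : X -> Y) : measurable B ->
  measurable_fun E g -> measurable_fun E (fun x => \1_B (g x) : R).
Proof.
move=> mB mg; have m := @measurable_indic _ Y R setT B mB.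
exact: (measurableT_comp m mg).
Qed.

(** * Compensation of each jump, then of their sum *)

Section compensation.
Context d (T : measurableType d) (R : realType) (P : probability T R).
Variables (nu : probability R R) (D : driver P nu) (q : intensity D).
Local Notation preT k := (g_sigma_algebraType (pre D k)).
Local Notation tau k := (jump_time q k).
Local Notation G := (jump_filtration q).
Local Notation predT := (predictable_space G).
Local Notation leb := (@lebesgue_measure R).
Local Notation triple := (P \x time_mark nu)%E.

Lemma measurable_id_predictable : @measurable_fun _ _ (R * T)%type predT setT id.
Proof. by apply: measurable_id_predictable_space => t _; exact: jump_filtration_measurable. Qed.

Lemma measurable_jump_timeT k : measurable_fun setT (tau k).
Proof. by have [m _] := measurable_jump_time q k; exact: pre_fun_measurable m. Qed.

Lemma measurable_markT k : measurable_fun setT (mark D k).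
Proof. exact: pre_fun_measurable (@mark_measurable _ _ _ _ _ D k). Qed.

Definition jump_point k w : R * T * R := (tau k.+1 w, w, mark D k w).

Lemma measurable_jump_point k : @measurable_fun _ _ T (predT * R)%type setT (jump_point k).
Proof.
apply: (@measurable_fun_pair _ _ _ T predT R) => //; last exact: measurable_markT.
apply: (measurableT_comp measurable_id_predictable).
by apply: measurable_fun_pair => //; exact: measurable_jump_timeT.
Qed.

Definition reassociate (z : T * (R * R)) : R * T * R := (z.2.1, z.1, z.2.2).

Lemma measurable_reassociate :
  @measurable_fun _ _ (T * (R * R))%type (predT * R)%type setT reassociate.
Proof.
have m2 := @measurable_snd _ _ T (R * R)%type.
apply: (@measurable_fun_pair _ _ _ (T * (R * R))%type predT R).
  apply: (measurableT_comp measurable_id_predictable).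
  apply: measurable_fun_pair => //.
  exact: (measurableT_comp (@measurable_fst _ _ R R) m2).
exact: (measurableT_comp (@measurable_snd _ _ R R) m2).
Qed.

(** The density of the compensator of jump [k + 1] alone. *)
Definition stage_density k (z : T * (R * R)) : R :=
  stage_rate q k z.2.1 z.1 * (tau k z.1 < z.2.1 <= tau k.+1 z.1)%R%:R.

Lemma stage_density_ge0 k z : 0 <= stage_density k z.
Proof.
rewrite mulr_ge0//; have /andP[+ _] := stage_rate_bounds q k z.2.1 z.1.
by apply: le_trans; exact/ltW/rate_lb_gt0.
Qed.

Lemma measurable_stage_density k : measurable_fun setT (stage_density k).
Proof.
have mid := measurable_id_g_sigma_algebra (@pre_measurable _ _ _ _ _ D k).
have m2 := @measurable_snd _ _ T (R * R)%type.
have m21 := measurableT_comp (@measurable_fst _ _ R R) m2.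
have m1 := @measurable_fst _ _ T (R * R)%type.
apply: measurable_funM.
  have m : @measurable_fun _ _ (T * (R * R))%type (R * preT k)%type setT (fun z => (z.2.1, z.1)).
    apply: measurable_fun_pair => //; exact: (measurableT_comp mid m1).
  exact: (measurableT_comp (@measurable_stage_rate _ _ _ _ _ _ q k) m).
apply: measurableT_comp => //; apply: measurable_and.
  apply: measurable_fun_ltr => //; exact: (measurableT_comp (@measurable_jump_timeT k) m1).
by apply: measurable_fun_ler => //; exact: (measurableT_comp (@measurable_jump_timeT k.+1) m1).
Qed.

Lemma stage_time_prob k A s t : pre D k A -> s <= t ->
  (P (A `&` [set w | s < tau k.+1 w <= t]%R) =
   \int[P]_(w in A) \int[leb]_(u in `]tau k w, tau k.+1 w] `&` `]s, t])
     (stage_rate q k u w)%:E)%E.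
Proof.
have [m _] := measurable_jump_time q k.
apply: (@next_time_prob _ _ _ P _ (@pre_measurable _ _ _ _ _ D k) (@pre_sigma_algebra _ _ _ _ _ D k)
  (stage_rate q k) (rate_lb q) (rate_ub q) (@measurable_stage_rate _ _ _ _ _ _ q k) (rate_lb_gt0 q)
  (@stage_rate_bounds _ _ _ _ _ _ q k) _ m _ (mid_fun_measurable (@gap_measurable _ _ _ _ _ D k))
  (@gap_gt0 _ _ _ _ _ D k) (gap_law D)).
- exact: gap_lawE.
- exact: gap_indep.
Qed.

(** Meant for an event [A] of the filtration at time [s] and its representative [A'] in [pre D k].
    The two agree when [s < tau k.+1], and otherwise the stage density vanishes on []s, t]]. The law
    of the mark factors out by Tonelli. *)
Lemma stage_density_rect k (A A' : set T) (B : set R) (s t : R) :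
  measurable A -> measurable A' -> measurable B ->
  (forall w, s < tau k.+1 w -> (w \in A) = (w \in A')) ->
  ((\int[P]_(w in A') \int[leb]_(u in `]tau k w, tau k.+1 w] `&` `]s, t])
      (stage_rate q k u w)%:E) * nu B)%E =
  (\int[triple]_(z in reassociate @^-1` (`]s, t] `*` A `*` B))
      (stage_density k z)%:E)%E.
Proof.
move=> mA mA' mB AA'.
pose h (z : T * R) := stage_density k (z.1, (z.2, 0)) * \1_(`]s, t]%classic) z.2.
have h0 z : (0 <= (h z)%:E)%E by rewrite lee_fin mulr_ge0// stage_density_ge0.
have mh : measurable_fun setT (EFin \o h).
  apply/measurable_EFinP; apply: measurable_funM.
    apply: (measurableT_comp (@measurable_stage_density k)).
    by apply: measurable_fun_pair => //; apply: measurable_fun_pair.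
  exact: measurable_indic_comp.
pose I w := (\int[leb]_u (h (w, u))%:E)%E.
have I0 w : (0 <= I w)%E by exact: integral_ge0.
have mI : measurable_fun setT I by exact: (measurable_integral_lebesgue mh).
transitivity (\int[P]_w (I w * nu B * (\1_A w)%:E))%E.
  transitivity (\int[P]_w ((I w * (\1_A w)%:E) * nu B))%E; last first.
    by apply: eq_integral => w _; rewrite muleAC.
  rewrite [RHS]ge0_integralZr//; last 2 first.
  - by apply: emeasurable_funM => //; apply/measurable_EFinP; exact: measurable_indic.
  - by move=> w _; rewrite mule_ge0// lee_fin.
  congr (_ * _)%E; rewrite [LHS]integral_mkcond; apply: eq_integral => w _.
  rewrite patchE indicE; have [ws|sw] := leP (tau k.+1 w) s.
    have -> : I w = 0%E.
      apply: integral0_eq => u _; rewrite /h /stage_density/= indicE mem_setE in_itv/=.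
      have [uw|uw] := leP u (tau k.+1 w); last by rewrite andbF mulr0 mul0r.
      by rewrite (ltNge s) (le_trans uw ws) /= mulr0.
    rewrite mul0e; case: ifP => // _; rewrite (_ : _ `&` _ = set0) ?integral_set0//.
    apply/seteqP; split=> // u [/=]; rewrite !in_itv/= => /andP[_ uw] /andP[su _].
    by move: (lt_le_trans su (le_trans uw ws)); rewrite ltxx.
  rewrite AA'//; case: ifP => _; rewrite ?mule0 ?mule1//.
  rewrite integral_mkcond; apply: eq_integral => u _.
  rewrite patchE /h /stage_density/= indicE.
  have -> : (u \in `]tau k w, tau k.+1 w] `&` `]s, t]) = (tau k w < u <= tau k.+1 w) && (u \in `]s, t]%classic).
    by rewrite in_setI; congr andb; rewrite mem_setE in_itv.
  by case: (_ < _ <= _) => /=; case: (_ \in _); rewrite ?mulr1 ?mulr0.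
pose f (z : T * (R * R)) := (stage_density k z * (\1_(`]s, t]%classic) z.2.1 * \1_A z.1 * \1_B z.2.2))%:E.
have f0 z : (0 <= f z)%E by rewrite lee_fin mulr_ge0 ?stage_density_ge0 ?mulr_ge0.
have mf : measurable_fun setT f.
  apply/measurable_EFinP; apply: measurable_funM; first exact: measurable_stage_density.
  have m2 := @measurable_snd _ _ T (R * R)%type.
  apply: measurable_funM; last first.
    apply: measurable_indic_comp => //.
    exact: (measurableT_comp (@measurable_snd _ _ R R) m2).
  apply: measurable_funM; last first.
    exact: measurable_indic_comp.
  apply: measurable_indic_comp => //.
  exact: (measurableT_comp (@measurable_fst _ _ R R) m2).
transitivity (\int[triple]_z f z)%E; last first.
  rewrite [RHS]integral_mkcond; apply: eq_integral => -[w [u x]] _.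
  rewrite patchE /f/= !indicE.
  have -> : ((w, (u, x)) \in reassociate @^-1` (`]s, t] `*` A `*` B)) =
      [&& u \in `]s, t]%classic, w \in A & x \in B].
    apply/idP/and3P => [/set_mem[[? ?] ?]|[/set_mem ? /set_mem ? /set_mem ?]].
      by split; exact/mem_set.
    exact/mem_set.
  by case: (u \in _); case: (w \in _); case: (x \in _); rewrite /= ?mulr1 ?mulr0 ?mul0r ?mulr0.
rewrite fubini_tonelli1//; apply: eq_integral => w _.
rewrite /fubini_F ge0_integral_time_mark//; last first.
  exact: (measurableT_comp mf (measurable_pair1 w)).
have mhw : measurable_fun setT (fun x : R => (h (w, x))%:E).
  exact: (measurableT_comp mh (measurable_pair1 w)).
rewrite -muleA -ge0_integralZr//; last first.
  by rewrite mule_ge0// lee_fin.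
apply: eq_integral => u _.
transitivity (\int[nu]_x ((h (w, u) * \1_A w)%:E * (\1_B x)%:E))%E; last first.
  by apply: eq_integral => x _; rewrite -EFinM /f /h /stage_density/= !mulrA.
rewrite ge0_integralZl//.
- by rewrite integral_indic// setIT EFinM muleA muleAC.
- by apply/measurable_EFinP; exact: measurable_indic.
- by rewrite lee_fin mulr_ge0// -lee_fin.
Qed.

(** Before the next jump, an event of the filtration at time [s] can be replaced by one of
    [pre D k]. Its intersection with [[s < tau k.+1 <= t]] lies in [mid D k], so the mark
    contributes the factor [nu B] and [stage_time_prob] gives the rest. Generators at times [u <= 0]
    carry neither jumps nor density. *)
Lemma stage_compensation_rect k A B : predictable_generator G A -> measurable B ->
  P (jump_point k @^-1` (A `*` B)) =
  (\int[triple]_(z in reassociate @^-1` (A `*` B)) (stage_density k z)%:E)%E.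
Proof.
have null0 A' : (forall u w, A' (u, w) -> u <= 0) ->
    P (jump_point k @^-1` (A' `*` B)) =
    (\int[triple]_(z in reassociate @^-1` (A' `*` B)) (stage_density k z)%:E)%E.
  move=> A'0; rewrite (_ : _ @^-1` _ = set0); last first.
    apply/seteqP; split=> // w /= [/A'0]; by rewrite leNgt jump_time_gt0.
  rewrite measure0 integral0_eq// => -[w [u xi]] [/A'0/= u0 _].
  by rewrite /stage_density/= ltNge (le_trans u0 (jump_time_ge0 _ _ _))/= mulr0.
case=> [[[A' GA ->]|[s [t [A' [s0 st GA ->]]]]]|->] mB; last first.
- by apply: null0 => u w /= /ltW.
- have [mA /(_ k)[Ak pA AAk]] := GA.
  have mAk := @pre_measurable _ _ _ _ _ D k _ pA.
  have AkE w : s < tau k.+1 w -> (w \in A') = (w \in Ak).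
    move=> sw; apply/idP/idP => /set_mem Xw; apply/mem_set.
      by have [] : (Ak `&` [set w | s < tau k.+1 w]) w by rewrite -AAk.
    by have [] : (A' `&` [set w | s < tau k.+1 w]) w by rewrite AAk.
  have msttau : mid D k [set w | s < tau k.+1 w <= t].
    have [_ m] := measurable_jump_time q k.
    have := m measurableT `]s, t]%classic (measurable_itv _).
    rewrite setTI measurable_g_measurableTypeE; last exact: mid_sigma_algebra.
    by congr (mid D k _); apply/seteqP; split=> w /=; rewrite in_itv.
  have midI : mid D k (Ak `&` [set w | s < tau k.+1 w <= t]).
    have := @measurableI _ (g_sigma_algebraType (mid D k)) Ak [set w | s < tau k.+1 w <= t].
    rewrite measurable_g_measurableTypeE; last exact: mid_sigma_algebra.
    by apply => //; exact: sub_pre_mid.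
  transitivity (P ((Ak `&` [set w | s < tau k.+1 w <= t]) `&` mark D k @^-1` B)).
    congr (P _); apply/seteqP; split=> w /=; rewrite in_itv/=.
      by move=> [[/andP[sw wt] /mem_set]]; rewrite AkE// => /set_mem; rewrite sw wt.
    by move=> [[/mem_set Aw /andP[sw wt]] Bw]; rewrite sw wt; split=> //; split=> //; apply/set_mem; rewrite AkE.
  rewrite mark_indep// stage_time_prob// ?ltW//.
  exact: stage_density_rect.
- by apply: null0 => u w /= [->].
Qed.

(** Both sides are integrals of [W] against measures on the predictable product space, and these
    measures agree on the generators. *)
Lemma stage_compensation k (W : predT * R -> \bar R) :
  measurable_fun setT W -> (forall z, 0 <= W z)%E ->
  (\int[P]_w W (jump_point k w) =
   \int[triple]_z (W (reassociate z) * (stage_density k z)%:E))%E.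
Proof.
move=> mW W0.
have mH := @measurable_stage_density k.
pose m2 := @density_measure _ (T * (R * R))%type R triple (stage_density k) mH (@stage_density_ge0 k).
rewrite -(ge0_integral_image_measure P (@measurable_jump_point k) mW W0).
transitivity (\int[image_measure m2 measurable_reassociate]_z W z)%E; last first.
  rewrite ge0_integral_image_measure// ge0_integral_density//.
  exact: (measurableT_comp mW measurable_reassociate).
apply: eq_measure_integral => S mS _.
apply: (g_sigma_prod_measure_unique (predictable_generatorE (filtration_jump_filtration q))
  (predictable_generatorI (filtration_jump_filtration q))
  (predictable_coverP (filtration_jump_filtration q)) (predictable_coverT _ _)) => //.
  by change (P setT < +oo)%E; rewrite probability_setT ltry.
by move=> A B GA mB; exact: stage_compensation_rect.
Qed.

Definition compensator_density (z : T * (R * R)) : R :=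
  q z.2.1 z.1 (left_state q z.2.1 z.1) * (0 < z.2.1)%R%:R.

Lemma compensation (W : predT * R -> \bar R) :
  measurable_fun setT W -> (forall z, 0 <= W z)%E ->
  (\sum_(k <oo) \int[P]_w W (jump_point k w) =
   \int[triple]_z (W (reassociate z) * (compensator_density z)%:E))%E.
Proof.
move=> mW W0; under eq_eseriesr do rewrite stage_compensation//.
rewrite -integral_nneseries//; last 2 first.
- move=> k; apply: emeasurable_funM.
    exact: (measurableT_comp mW measurable_reassociate).
  by apply/measurable_EFinP; exact: measurable_stage_density.
- by move=> k z _; rewrite mule_ge0// lee_fin stage_density_ge0.
apply: eq_integral => -[w [u xi]] _.
have [u0|u0] := leP u 0.
  rewrite /compensator_density/= ltNge u0 mulr0 mule0 eseries0// => k _ _.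
  by rewrite /stage_density/= [X in X && _]ltNge (le_trans u0 (jump_time_ge0 _ _ _))/= mulr0 mule0.
have kP := jumps_beforeP q w u0; set k := jumps_before q u w in kP.
rewrite (nneseries_split 0 k.+1)//; last by move=> j _; rewrite mule_ge0// lee_fin stage_density_ge0.
rewrite add0n big_mkord big_ord_recr/= [X in (_ + X)%E]eseries0 ?adde0; last first.
  move=> j; rewrite /= => kj _; rewrite /stage_density/= [X in X && _]ltNge.
  by have /andP[_ h] := kP; rewrite (le_trans h (le_jump_time q w kj))/= mulr0 mule0.
rewrite big1 ?add0e; last first.
  move=> j _; rewrite /stage_density/= [X in _ && X]leNgt.
  by have /andP[h _] := kP; rewrite (le_lt_trans (le_jump_time q w (ltn_ord j)) h) andbF mulr0 mule0.
by rewrite /stage_density/compensator_density/= kP u0 (left_stateE kP).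
Qed.

End compensation.

(** * Forward equation *)

Section bounded_integrals.
Context d (T : measurableType d) (R : realType) (P : probability T R).

Lemma integral_probability_cst (r : R) : (\int[P]_w r%:E = r%:E)%E.
Proof.
by rewrite integral_cst// -[RHS]mule1; congr (_ * _)%E; exact: probability_setT.
Qed.

Lemma bounded_integrable (f : T -> R) (M : R) :
  measurable_fun setT f -> (forall w, `|f w| <= M) -> P.-integrable setT (EFin \o f).
Proof.
move=> mf fM; apply: measurable_bounded_integrable => //.
  exact: (le_lt_trans (probability_le1 P measurableT) (ltry 1)).
exists M; split; first exact: num_real.
by move=> x Mx w _; exact: le_trans (fM w) (ltW Mx).
Qed.

Lemma bounded_RintegralE (f : T -> R) (M : R) :
  measurable_fun setT f -> (forall w, `|f w| <= M) ->
  ((\int[P]_w f w)%:E = \int[P]_w (f w)%:E)%E.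
Proof.
move=> mf fM; rewrite /Rintegral fineK//.
exact: (integrable_fin_num measurableT (bounded_integrable mf fM)).
Qed.

End bounded_integrals.

Section forward_equation.
Context d (T : measurableType d) (R : realType) (P : probability T R).
Variables (nu : probability R R) (D : driver P nu) (q : intensity D).
Local Notation preT k := (g_sigma_algebraType (pre D k)).
Local Notation tau k := (jump_time q k).
Local Notation G := (jump_filtration q).
Local Notation predT := (predictable_space G).
Local Notation leb := (@lebesgue_measure R).
Local Notation triple := (P \x time_mark nu)%E.

Lemma measurable_left_state_joint :
  measurable_fun setT (fun z : R * T => left_state q z.1 z.2).
Proof.
exact: (measurableT_comp (@measurable_left_state _ _ _ _ _ _ q) (@measurable_id_predictable _ _ _ _ _ _ q)).
Qed.

Lemma measurable_left_state_at t : measurable_fun setT (left_state q t).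
Proof. exact: (measurableT_comp measurable_left_state_joint (measurable_pair1 t)). Qed.

(** Tests depend jointly on the initial information and the state; in the application this lets them
    involve [eta]. *)
Definition test_function (f : T -> R -> R) :=
  @measurable_fun _ _ (preT 0 * R)%type R setT (fun z => f z.1 z.2).

Lemma measurable_test_function f d' (V : measurableType d') (X : V -> T) (Y : V -> R) :
  test_function f -> measurable_fun setT X -> measurable_fun setT Y ->
  measurable_fun setT (fun v => f (X v) (Y v)).
Proof.
move=> mf mX mY.
have mid := measurable_id_g_sigma_algebra (@pre_measurable _ _ _ _ _ D 0).
have m : @measurable_fun _ _ V (preT 0 * R)%type setT (fun v => (X v, Y v)).
  by apply: measurable_fun_pair => //; exact: (measurableT_comp mid mX).
exact: (measurableT_comp mf m).
Qed.

Lemma predictable_test_function f (t : R) (g : R -> R -> R) :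
  test_function f -> measurable_fun setT (fun z : R * R => g z.1 z.2) ->
  @measurable_fun _ _ (predT * R)%type R setT
    (fun z => f z.1.2 (g (left_state q z.1.1 z.1.2) z.2) * (0 < z.1.1 < t)%R%:R).
Proof.
move=> mf mg.
pose B : set (predT * R) := (Rplus `*` setT) `*` setT.
have mB : measurable B by apply: measurableX => //; exact: measurable_Rplus_predictable.
have m1 : @measurable_fun _ _ (predT * R)%type predT B fst.
  by apply: measurable_funTS; exact: measurable_fst.
have lift1 d' (V : measurableType d') (h : predT -> V) :
    @measurable_fun _ _ predT V (Rplus `*` setT) h ->
    @measurable_fun _ _ (predT * R)%type V B (fun z => h z.1).
  move=> mh; apply: (@measurable_comp _ _ _ (predT * R)%type predT V (Rplus `*` setT) h B fst) => //.
    exact: measurable_Rplus_predictable.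
  by move=> _ [z [? _] <-].
have mt : @measurable_fun _ _ (predT * R)%type R B (fun z => z.1.1).
  exact: (lift1 _ R fst (@measurable_predictable_time _ _ _ _ _ _ q)).
have mo : @measurable_fun _ _ (predT * R)%type (preT 0) B (fun z => z.1.2).
  exact: (lift1 _ (preT 0) snd (@measurable_predictable_outcome _ _ _ _ _ _ q)).
have ms : @measurable_fun _ _ (predT * R)%type R setT (fun z => left_state q z.1.1 z.1.2).
  exact: (measurableT_comp (@measurable_left_state _ _ _ _ _ _ q) (@measurable_fst _ _ predT R)).
have mgs : @measurable_fun _ _ (predT * R)%type R setT (fun z => g (left_state q z.1.1 z.1.2) z.2).
  apply: (measurableT_comp mg (f := fun z : R * R => g z.1 z.2)
    (g := fun z : predT * R => (left_state q z.1.1 z.1.2, z.2))).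
  by apply: measurable_fun_pair => //; exact: measurable_snd.
pose h (z : predT * R) := f z.1.2 (g (left_state q z.1.1 z.1.2) z.2) * (0 < z.1.1 < t)%R%:R.
have mh : measurable_fun B h.
  apply: measurable_funM.
    have m : @measurable_fun _ _ (predT * R)%type (preT 0 * R)%type B
        (fun z => (z.1.2, g (left_state q z.1.1 z.1.2) z.2)).
      apply: (@measurable_fun_pair_dom _ _ _ (predT * R)%type (preT 0) R) => //.
      exact: measurable_funTS.
    exact: (measurableT_comp mf m).
  apply: measurableT_comp => //; apply: measurable_and; exact: measurable_fun_ltr.
have := (measurable_restrictT h mB).1 mh; congr (measurable_fun setT).
apply/funext => z; rewrite patchE; case: ifPn => // zB.
rewrite (_ : (0 < z.1.1) = false) ?mulr0//; apply/negbTE; apply: contra zB => z0.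
by rewrite inE; do 2!split => //=; rewrite /Rplus/= in_itv/= andbT ltW.
Qed.

Lemma integral_triple (F : T * (R * R) -> \bar R) :
  measurable_fun setT F -> (forall z, 0 <= F z)%E ->
  (\int[triple]_z F z = \int[leb]_u \int[P]_w \int[nu]_x F (w, (u, x)))%E.
Proof.
move=> mF F0; rewrite fubini_tonelli1//.
transitivity (\int[P]_w \int[leb]_u \int[nu]_x F (w, (u, x)))%E.
  apply: eq_integral => w _; rewrite /fubini_F ge0_integral_time_mark//.
  exact: (measurableT_comp mF (measurable_pair1 w)).
pose F' (z : T * R * R) := F (z.1.1, (z.1.2, z.2)).
have mF' : measurable_fun setT F'.
  apply: (measurableT_comp mF (g := fun z : T * R * R => (z.1.1, (z.1.2, z.2)))).
  have m1 := @measurable_fst _ _ (T * R)%type R.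
  apply: measurable_fun_pair.
    exact: (measurableT_comp (@measurable_fst _ _ T R) m1).
  apply: measurable_fun_pair; last exact: measurable_snd.
  exact: (measurableT_comp (@measurable_snd _ _ T R) m1).
apply: (tonelli_lebesgue P (f := fun z : T * R => (\int[nu]_x F' (z, x))%E)).
- exact: (@measurable_fun_fubini_tonelli_F _ _ (T * R)%type R R nu F' mF' (fun z => F0 _)).
- by move=> z; apply: integral_ge0 => x _; exact: F0.
Qed.

Lemma measurable_compensator_density : measurable_fun setT (@compensator_density _ _ _ _ _ _ q).
Proof.
have m2 := @measurable_snd _ _ T (R * R)%type.
have m1 := @measurable_fst _ _ T (R * R)%type.
have m21 := measurableT_comp (@measurable_fst _ _ R R) m2.
have mid := measurable_id_g_sigma_algebra (@pre_measurable _ _ _ _ _ D 0).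
apply: measurable_funM; last first.
  by apply: measurableT_comp => //; exact: measurable_fun_ltr.
have m : @measurable_fun _ _ (T * (R * R))%type (R * preT 0 * R)%type setT
    (fun z => (z.2.1, z.1, left_state q z.2.1 z.1)).
  apply: measurable_fun_pair.
    by apply: measurable_fun_pair => //; exact: (measurableT_comp mid m1).
  apply: (measurableT_comp measurable_left_state_joint (g := fun z : T * (R * R) => (z.2.1, z.1))).
  exact: measurable_fun_pair.
exact: (measurableT_comp (rate_measurable q) m).
Qed.

Lemma compensator_density_ge0 z : 0 <= compensator_density q z.
Proof.
rewrite mulr_ge0//; have /andP[+ _] := rate_bounds q z.2.1 z.1 (left_state q z.2.1 z.1).
by apply: le_trans; exact/ltW/rate_lb_gt0.
Qed.

(** Applied with [g x y = x] for the state before a jump and with [g x y = x + y] for the state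
    after it. *)
Lemma test_compensation f (t : R) (g : R -> R -> R) : test_function f ->
  measurable_fun setT (fun z : R * R => g z.1 z.2) -> (forall w x, 0 <= f w x) ->
  (\sum_(k <oo) \int[P]_w (f w (g (position D k w) (mark D k w)) * (tau k.+1 w < t)%R%:R)%:E =
   \int[leb]_(u in `]0%R, t[) \int[P]_w
     ((q u w (left_state q u w))%:E * \int[nu]_x (f w (g (left_state q u w) x))%:E))%E.
Proof.
move=> mf mg f0.
pose W (z : predT * R) := (f z.1.2 (g (left_state q z.1.1 z.1.2) z.2) * (0 < z.1.1 < t)%R%:R)%:E.
have mW : @measurable_fun _ _ (predT * R)%type _ setT W.
  by apply/(@measurable_EFinP _ (predT * R)%type); exact: (@predictable_test_function f t g mf mg).
have W0 z : (0 <= W z)%E by rewrite lee_fin mulr_ge0.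
transitivity (\sum_(k <oo) \int[P]_w W (jump_point q k w))%E.
  apply: eq_eseriesr => k _; apply: eq_integral => w _.
  by rewrite /W/= jump_time_gt0/= (@left_stateE _ _ _ _ _ _ q k)// jump_time_lt lexx.
rewrite compensation// integral_triple; last 2 first.
- apply: emeasurable_funM.
    exact: (measurableT_comp mW (@measurable_reassociate _ _ _ _ _ _ q)).
  by apply/measurable_EFinP; exact: measurable_compensator_density.
- by move=> z; rewrite mule_ge0// lee_fin compensator_density_ge0.
rewrite [RHS]integral_mkcond; apply: eq_integral => u _.
rewrite patchE mem_setE in_itv/=; case: ifPn => ut; last first.
  rewrite integral0_eq// => w _; rewrite integral0_eq// => x _.
  by rewrite /W/= (negbTE ut) mulr0 mul0e.
apply: eq_integral => w _; rewrite -ge0_integralZl//.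
- apply: eq_integral => x _; rewrite /W /compensator_density/= ut.
  by have /andP[-> _] := ut; rewrite !mulr1 muleC.
- apply/measurable_EFinP; apply: (measurable_test_function mf) => //.
  exact: (measurableT_comp mg (measurable_pair1 _)).
- by move=> x _; rewrite lee_fin.
- have /andP[+ _] := rate_bounds q u w (left_state q u w).
  by rewrite lee_fin; apply: le_trans; exact/ltW/rate_lb_gt0.
Qed.

(** The increments of [f] over the jumps before [t] telescope. The values before the jumps are moved
    to the left, so that both sides are sums of nonnegative terms. *)
Lemma telescoping (f : T -> R -> R) t w : (forall x, 0 <= f w x) ->
  ((f w (left_state q t w))%:E +
    \sum_(k <oo) (f w (position D k w) * (tau k.+1 w < t)%R%:R)%:E =
   (f w 0)%:E +
    \sum_(k <oo) (f w (position D k w + mark D k w) * (tau k.+1 w < t)%R%:R)%:E)%E.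
Proof.
move=> f0; set n := jumps_before q t w.
have nE k : (tau k.+1 w < t)%R = (k < n)%N.
  have [t0|t0] := leP t 0.
    by rewrite /n jumps_before0// ltn0 ltNge (le_trans t0 (jump_time_ge0 _ _ _)).
  have /andP[nt tn] := jumps_beforeP q w t0; apply/idP/idP => [kt|kn].
    by rewrite ltnNge; apply/negP => nk; move: (lt_le_trans kt tn); rewrite ltNge le_jump_time.
  exact: le_lt_trans (le_jump_time q w kn) nt.
have split_sum (g : nat -> R) : (forall k, 0 <= g k) ->
    (\sum_(k <oo) (g k * (tau k.+1 w < t)%R%:R)%:E = \sum_(k < n) (g k)%:E)%E.
  move=> g0; rewrite (nneseries_split 0 n)//; last by move=> k _; rewrite lee_fin mulr_ge0.
  rewrite add0n big_mkord [X in (_ + X)%E]eseries0 ?adde0; last first.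
    by move=> k; rewrite /= => nk _; rewrite nE ltnNge nk mulr0.
  by apply: eq_bigr => k _; rewrite nE ltn_ord mulr1.
rewrite !split_sum//; transitivity (\sum_(k < n.+1) (f w (position D k w))%:E)%E.
  by rewrite big_ord_recr/= addeC.
rewrite big_ord_recl/= position0; congr (_ + _)%E.
by apply: eq_bigr => k _; rewrite -positionS.
Qed.

Definition mark_average (f : T -> R -> R) w y := \int[nu]_x f w (y + x).

Definition mean (X : T -> R) (f : T -> R -> R) := \int[P]_w f w (X w).

Section bounded_test_function.
Variables (f : T -> R -> R) (M : R).
Hypotheses (mf : test_function f) (f_bounds : forall w x, 0 <= f w x <= M).

Let f0 w x : 0 <= f w x. Proof. by case/andP: (f_bounds w x). Qed.

Let fM w x : `|f w x| <= M. Proof. by rewrite ger0_norm//; case/andP: (f_bounds w x). Qed.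

Let mf2 w : measurable_fun setT (f w).
Proof. by apply: (@measurable_test_function f _ R (fun=> w) (fun x => x) mf). Qed.

Lemma mark_averageE w y : ((mark_average f w y)%:E = \int[nu]_x (f w (y + x))%:E)%E.
Proof.
rewrite /mark_average (@bounded_RintegralE _ _ _ _ _ M)//.
by apply: (measurableT_comp (mf2 w)); exact: measurable_funD.
Qed.

Lemma mark_average_bounds w y : 0 <= mark_average f w y <= M.
Proof.
rewrite -!lee_fin mark_averageE; apply/andP; split.
  by apply: integral_ge0 => x _; rewrite lee_fin.
apply: (@le_trans _ _ (\int[nu]_x M%:E)%E).
  apply: ge0_le_integral => //.
  - by move=> x _; rewrite lee_fin.
  - apply/measurable_EFinP; apply: (measurableT_comp (mf2 w)); exact: measurable_funD.
  - by move=> x _; rewrite lee_fin; case/andP: (f_bounds w (y + x)).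
by rewrite integral_probability_cst.
Qed.

Lemma test_mark_average : test_function (mark_average f).
Proof.
pose h (z : preT 0 * R * R) := (f z.1.1 (z.1.2 + z.2))%:E.
have mh : measurable_fun setT h.
  apply/(@measurable_EFinP _ (preT 0 * R * R)%type).
  have m1 := @measurable_fst _ _ (preT 0 * R)%type R.
  have m : @measurable_fun _ _ (preT 0 * R * R)%type (preT 0 * R)%type setT (fun z => (z.1.1, z.1.2 + z.2)).
    apply: measurable_fun_pair.
      exact: (measurableT_comp (@measurable_fst _ _ (preT 0) R) m1).
    apply: measurable_funD; last exact: measurable_snd.
    exact: (measurableT_comp (@measurable_snd _ _ (preT 0) R) m1).
  exact: (measurableT_comp mf m).
have h0 z : (0 <= h z)%E by rewrite lee_fin.
have m := @measurable_fun_fubini_tonelli_F _ _ (preT 0 * R)%type R R nu h mh h0.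
exact: (measurableT_comp (@fine_measurable R setT measurableT) m).
Qed.

Lemma meanE (X : T -> R) : measurable_fun setT X ->
  ((mean X f)%:E = \int[P]_w (f w (X w))%:E)%E.
Proof.
move=> mX; apply: (@bounded_RintegralE _ _ _ _ _ M) => //.
by apply: (measurable_test_function mf); [exact: measurable_id|].
Qed.

End bounded_test_function.

Definition rate_times (f : T -> R -> R) u w x := q u w x * f w x.

Lemma test_rate_times f u : test_function f -> test_function (rate_times f u).
Proof.
move=> mf; apply: measurable_funM => //.
have m : @measurable_fun _ _ (preT 0 * R)%type (R * preT 0 * R)%type setT (fun z => (u, z.1, z.2)).
  apply: measurable_fun_pair; last exact: measurable_snd.
  by apply: measurable_fun_pair => //; exact: measurable_fst.
exact: (measurableT_comp (rate_measurable q) m).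
Qed.

Lemma rate_times_bounds f M u w x : (forall w x, 0 <= f w x <= M) ->
  0 <= rate_times f u w x <= rate_ub q * M.
Proof.
move=> /(_ w x)/andP[f0 fM]; have /andP[l b] := rate_bounds q u w x.
have q0 := le_trans (ltW (rate_lb_gt0 q)) l.
by rewrite mulr_ge0//= ler_pM.
Qed.

(** The mean of [telescoping], with both series evaluated by [test_compensation]; integrating out
    the size of the jump produces [mark_average f]. *)
Lemma forward_equation f M t : test_function f -> (forall w x, 0 <= f w x <= M) ->
  ((mean (left_state q t) f)%:E +
     \int[leb]_(u in `]0%R, t[) (mean (left_state q u) (rate_times f u))%:E =
   (mean (cst 0) f)%:E +
     \int[leb]_(u in `]0%R, t[) (mean (left_state q u) (rate_times (mark_average f) u))%:E)%E.
Proof.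
move=> mf fM.
have f0 w x : 0 <= f w x by case/andP: (fM w x).
have mX u := measurable_left_state_at u.
have mgen g k : measurable_fun setT (fun z : R * R => g z.1 z.2) ->
    measurable_fun setT (fun w => (f w (g (position D k w) (mark D k w)) * (tau k.+1 w < t)%R%:R)%:E).
  move=> mg; apply/measurable_EFinP; apply: measurable_funM.
    apply: (measurable_test_function mf) => //.
    apply: (measurableT_comp mg (g := fun w => (position D k w, mark D k w))).
    apply: measurable_fun_pair; last exact: measurable_markT.
    exact: pre_fun_measurable (@measurable_position _ _ _ _ _ D k).
  apply: measurableT_comp => //; apply: measurable_fun_ltr => //.
  exact: measurable_jump_timeT.
have ge0 g k w : (0 <= (f w (g (position D k w) (mark D k w)) * (tau k.+1 w < t)%R%:R)%:E)%E.
  by rewrite lee_fin mulr_ge0.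
have m1 : measurable_fun setT (fun z : R * R => z.1) by exact: measurable_fst.
have m2 : measurable_fun setT (fun z : R * R => z.1 + z.2) by exact: measurable_funD.
transitivity (\int[P]_w ((f w (left_state q t w))%:E +
    \sum_(k <oo) (f w (position D k w) * (tau k.+1 w < t)%R%:R)%:E))%E.
  rewrite ge0_integralD//; last 4 first.
  - by move=> w _; rewrite lee_fin.
  - by apply/measurable_EFinP; apply: (measurable_test_function mf).
  - by move=> w _; apply: nneseries_ge0 => k _ _; exact: (ge0 (fun x _ => x)).
  - by apply: ge0_emeasurable_sum => [k w _ _|k _]; [exact: (ge0 (fun x _ => x))|exact: (mgen (fun x _ => x))].
  rewrite -(meanE mf fM)//; congr (_ + _)%E.
  rewrite integral_nneseries//; last 2 first.
  - by move=> k; exact: (mgen (fun x _ => x)).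
  - by move=> k w _; exact: (ge0 (fun x _ => x)).
  rewrite (test_compensation (g := fun x _ => x) t mf m1 f0); apply: eq_integral => u _.
  rewrite (meanE (test_rate_times u mf) (fun w x => rate_times_bounds u w x fM))//.
  by apply: eq_integral => w _; rewrite integral_probability_cst -EFinM.
under eq_integral do rewrite telescoping//.
rewrite ge0_integralD//; last 4 first.
- by move=> w _; rewrite lee_fin.
- by apply/measurable_EFinP; apply: (measurable_test_function mf).
- by move=> w _; apply: nneseries_ge0 => k _ _; exact: (ge0 (fun x y => x + y)).
- by apply: ge0_emeasurable_sum => [k w _ _|k _]; [exact: (ge0 (fun x y => x + y))|exact: (mgen (fun x y => x + y))].
rewrite (meanE mf fM)//; congr (_ + _)%E.
rewrite integral_nneseries//; last first.
  by move=> k; exact: (mgen (fun x y => x + y)).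
rewrite (test_compensation (g := fun x y => x + y) t mf m2 f0); apply: eq_integral => u _.
rewrite (meanE (test_rate_times u (test_mark_average mf fM))
  (fun w x => rate_times_bounds u w x (mark_average_bounds mf fM)))//.
by apply: eq_integral => w _; rewrite /rate_times EFinM (mark_averageE mf fM).
Qed.

End forward_equation.

(** * Total variation *)

Section total_variation.
Context d (T : measurableType d) (R : realType) (P : probability T R).
Variables (nu : probability R R) (D : driver P nu).
Local Notation preT k := (g_sigma_algebraType (pre D k)).
Local Notation test := (test_function D).

Definition bounded_test (f : T -> R -> R) (B : R) := test f /\ forall w x, `|f w x| <= B.

Lemma test_state (h : R -> R) : measurable_fun setT h -> test (fun _ x => h x).
Proof. by move=> mh; exact: (measurableT_comp mh (@measurable_snd _ _ (preT 0) R)). Qed.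

Lemma test_outcome (h : T -> R) : @measurable_fun _ _ (preT 0) R setT h ->
  test (fun w _ => h w).
Proof. by move=> mh; exact: (measurableT_comp mh (@measurable_fst _ _ (preT 0) R)). Qed.

Lemma testM f g : test f -> test g -> test (fun w x => f w x * g w x).
Proof. by move=> mf mg; exact: measurable_funM. Qed.

Lemma testD f g : test f -> test g -> test (fun w x => f w x + g w x).
Proof. by move=> mf mg; exact: measurable_funD. Qed.

Lemma testB f g : test f -> test g -> test (fun w x => f w x - g w x).
Proof. by move=> mf mg; exact: measurable_funB. Qed.

Lemma test_cst r : test (fun _ _ => r).
Proof. exact: measurable_cst. Qed.

Lemma bounded_test_cst r : bounded_test (fun _ _ => r) `|r|.
Proof. by split => //; exact: test_cst. Qed.

Lemma bounded_testM f g A B : bounded_test f A -> bounded_test g B ->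
  bounded_test (fun w x => f w x * g w x) (A * B).
Proof.
move=> [mf fA] [mg gB]; split; first exact: testM.
by move=> w x; rewrite normrM ler_pM.
Qed.

Lemma bounded_testB f g A B : bounded_test f A -> bounded_test g B ->
  bounded_test (fun w x => f w x - g w x) (A + B).
Proof.
move=> [mf fA] [mg gB]; split; first exact: testB.
by move=> w x; rewrite (le_trans (ler_normB _ _))// lerD.
Qed.

Section mean_linear.
Variables (X : T -> R) (mX : measurable_fun setT X).

Let mcomp f : test f -> measurable_fun setT (fun w => f w (X w)).
Proof. by move=> mf; apply: (measurable_test_function mf); first exact: measurable_id. Qed.

Let int f B : bounded_test f B -> P.-integrable setT (EFin \o (fun w => f w (X w))).
Proof.
by move=> [mf fB]; apply: (@bounded_integrable _ _ _ _ _ B); [exact: mcomp|].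
Qed.

Lemma meanB f g A B : bounded_test f A -> bounded_test g B ->
  mean P X (fun w x => f w x - g w x) = mean P X f - mean P X g.
Proof. by move=> /int fi /int gi; rewrite /mean RintegralB. Qed.

Lemma meanD f g A B : bounded_test f A -> bounded_test g B ->
  mean P X (fun w x => f w x + g w x) = mean P X f + mean P X g.
Proof. by move=> /int fi /int gi; rewrite /mean RintegralD. Qed.

Lemma meanZ r f A : bounded_test f A -> mean P X (fun w x => r * f w x) = r * mean P X f.
Proof. by move=> /int fi; rewrite /mean RintegralZl. Qed.

Lemma mean_cst r : mean P X (fun _ _ => r) = r.
Proof.
apply: EFin_inj; rewrite /mean (@bounded_RintegralE _ _ _ _ _ `|r|)//.
exact: integral_probability_cst.
Qed.

Lemma le_mean f g A B : bounded_test f A -> bounded_test g B ->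
  (forall w, f w (X w) <= g w (X w)) -> mean P X f <= mean P X g.
Proof. by move=> /int fi /int gi fg; apply: le_Rintegral. Qed.

Lemma mean_bound f A : bounded_test f A -> `|mean P X f| <= A.
Proof.
move=> fA; have A0 : 0 <= A by apply: le_trans (fA.2 point 0); exact: normr_ge0.
rewrite ler_norml; apply/andP; split.
  rewrite -[X in X <= _](mean_cst (- A)).
  apply: (le_mean (bounded_test_cst _) fA) => w.
  by have := fA.2 w (X w); rewrite ler_norml => /andP[].
rewrite -[X in _ <= X](mean_cst A); apply: (le_mean fA (bounded_test_cst _)) => w.
by have := fA.2 w (X w); rewrite ler_norml => /andP[].
Qed.

End mean_linear.

(* The laws of [(w, X1 w)] and [(w, X2 w)], tested against functions of [w] that are
   measurable for the initial information, are at total variation distance at most [b]. *)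
Definition tv_le (X1 X2 : T -> R) b := forall f, test f ->
  (forall w x, 0 <= f w x <= 1) -> mean P X1 f <= mean P X2 f + b.

Section tv.
Variables (X1 X2 : T -> R).
Hypotheses (mX1 : measurable_fun setT X1) (mX2 : measurable_fun setT X2).

Let unit_bounded f : test f -> (forall w x, 0 <= f w x <= 1) -> bounded_test f 1.
Proof.
move=> mf f01; split => // w x; have /andP[f0 f1] := f01 w x.
by rewrite ger0_norm.
Qed.

Lemma tv_le1 : tv_le X1 X2 1.
Proof.
move=> f mf f01; have fb := unit_bounded mf f01.
have h1 := mean_bound mX1 fb; have f0 : 0 <= mean P X2 f.
  rewrite -(mean_cst X2 0); apply: (le_mean mX2 (bounded_test_cst 0) fb) => w.
  by case/andP: (f01 w (X2 w)).
by move: h1; rewrite ler_norml => /andP[_ h1]; lra.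
Qed.

(** Test against [1 - f]. *)
Lemma tv_le_sym b : tv_le X1 X2 b -> tv_le X2 X1 b.
Proof.
move=> tv f mf f01; have fb := unit_bounded mf f01.
have := tv (fun w x => 1 - f w x); rewrite !(meanB _ (bounded_test_cst 1) fb)// !mean_cst//.
have /[swap] /[apply] : test (fun w x => 1 - f w x) by apply: testB => //; exact: test_cst.
have /[swap] /[apply] : forall w x, 0 <= 1 - f w x <= 1.
  by move=> w x; have /andP[? ?] := f01 w x; rewrite subr_ge0 lerBlDr lerDl; apply/andP.
lra.
Qed.

(** The map [f |-> f / (2 * B) + 1/2] sends functions bounded by [B] into the unit interval, whence
    the factor [2 * B]; the same bound for [- f] gives the absolute value. *)
Lemma tv_le_bounded f B b : bounded_test f B -> tv_le X1 X2 b ->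
  `|mean P X1 f - mean P X2 f| <= 2 * B * b.
Proof.
suff half g : bounded_test g B -> tv_le X1 X2 b -> mean P X1 g - mean P X2 g <= 2 * B * b.
  move=> fb tv; rewrite ler_norml; apply/andP; split; last exact: half.
  have gb : bounded_test (fun w x => -1 * f w x) B.
    by have := bounded_testM (bounded_test_cst (-1)) fb; rewrite normrN1 mul1r.
  by have := half _ gb tv; rewrite !(meanZ _ _ fb)//; lra.
move=> gb tv; have B0 : 0 <= B by apply: le_trans (gb.2 point 0); exact: normr_ge0.
move: B0; rewrite le_eqVlt => /predU1P[B0|B0].
  have z X : measurable_fun setT X -> mean P X g = 0.
    by move=> mX; apply/eqP; rewrite -normr_le0 B0; exact: mean_bound.
  by rewrite !z// -B0 mulr0 mul0r subr0.
have B2 : 0 < (2 * B)^-1 by rewrite invr_gt0 mulr_gt0.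
have gb' : bounded_test (fun w x => (2 * B)^-1 * g w x) (`|(2 * B)^-1| * B).
  exact: bounded_testM (bounded_test_cst _) gb.
have := tv (fun w x => (2 * B)^-1 * g w x + 2^-1).
rewrite !(meanD _ gb' (bounded_test_cst _))// !mean_cst// !(meanZ _ _ gb)//.
have /[swap] /[apply] : test (fun w x => (2 * B)^-1 * g w x + 2^-1).
  by apply: testD; [exact: gb'.1|exact: test_cst].
have /[swap] /[apply] : forall w x, 0 <= (2 * B)^-1 * g w x + 2^-1 <= 1.
  move=> w x; have := gb.2 w x; rewrite ler_norml => /andP[h1 h2].
  have e : (2 * B)^-1 * B = 2^-1 by rewrite invfM -mulrA mulVf ?mulr1// gt_eqF.
  have h1' := ler_wpM2l (ltW B2) h1; have h2' := ler_wpM2l (ltW B2) h2.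
  by rewrite mulrN in h1'; apply/andP; split; lra.
rewrite -lerBlDl => h; rewrite -(@ler_pM2l _ (2 * B)^-1)//.
have -> : (2 * B)^-1 * (2 * B * b) = b by rewrite mulrA mulVf ?mul1r// mulf_neq0// gt_eqF.
by rewrite mulrBr; lra.
Qed.

Lemma tv_le_weaken b b' : b <= b' -> tv_le X1 X2 b -> tv_le X1 X2 b'.
Proof. by move=> bb' tv f mf f01; apply: le_trans (tv f mf f01) _; rewrite lerD2l. Qed.

End tv.

Lemma tv_le_trans X1 X2 X3 b c : tv_le X1 X2 b -> tv_le X2 X3 c -> tv_le X1 X3 (b + c).
Proof.
move=> tv tv' f mf f01; have := tv f mf f01; have := tv' f mf f01; lra.
Qed.

Lemma tv_le_refl X : tv_le X X 0.
Proof. by move=> f _ _; rewrite addr0. Qed.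

End total_variation.

(** * Weighted intensities and their fixed point *)

Lemma integral_expR_le (R : realType) (theta t : R) : 0 < theta -> 0 <= t ->
  (\int[@lebesgue_measure R]_(u in `]0%R, t[) (expR (theta * u))%:E <=
   (expR (theta * t) / theta)%:E)%E.
Proof.
move=> theta0; rewrite le_eqVlt => /predU1P[<-|t0].
  rewrite set_itv_ge ?bnd_simp ?ltxx// integral_set0 lee_fin divr_ge0 ?expR_ge0//.
  exact: ltW.
pose F (x : R) := expR (theta * x) / theta.
have cf : continuous (fun u : R => expR (theta * u)).
  move=> x; apply: continuous_comp; last exact: continuous_expR.
  by apply: continuousM => //; exact: cst_continuous.
have dF (x : R) : is_derive x 1 F (expR (theta * x)).
  rewrite /F; apply: is_derive_eq; rewrite !scaler1 ?scaler0 ?addr0 /GRing.scale/=.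
  by rewrite add0r mulrCA mulVf ?mulr1// gt_eqF.
have cF : continuous F.
  by move=> x; apply: cvgM; [exact: cf|exact: cvg_cst].
have -> : (\int[@lebesgue_measure R]_(u in `]0%R, t[) (expR (theta * u))%:E =
    \int[@lebesgue_measure R]_(u in `[0%R, t]) (expR (theta * u))%:E)%E.
  apply/esym/integral_itv_bndoo.
  by apply/measurable_EFinP/measurable_funTS; exact: continuous_measurable_fun.
rewrite (@continuous_FTC2 _ _ F)//.
- rewrite -EFinB lee_fin /F mulr0 expR0 lerBlDr lerDl divr_ge0// ltW//.
- exact: continuous_subspaceT.
- split.
  + by move=> x _; apply: ex_derive.
  + by apply/cvg_at_right_filter; exact: cF.
  + by apply/cvg_at_left_filter; exact: cF.
- by move=> x _; rewrite derive1E derive_val.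
Qed.

(** Meant for the subtraction of two forward equations with the same initial term [c]; finiteness
    makes it legitimate in the extended reals. *)
Lemma balance_le (R : realDomainType) (a1 a2 c k : R) (x1 y1 x2 y2 : \bar R) :
  x1 \is a fin_num -> y1 \is a fin_num -> x2 \is a fin_num -> y2 \is a fin_num ->
  (a1%:E + x1 = c%:E + y1 -> a2%:E + x2 = c%:E + y2 ->
   y1 + x2 <= x1 + y2 + k%:E -> (a1 <= a2 + k)%R)%E.
Proof.
move=> /fineK <- /fineK <- /fineK <- /fineK <-.
rewrite -!EFinD !lee_fin => - [+] [+]; lra.
Qed.

Section local_intensity.
Context d (T : measurableType d) (R : realType) (P : probability T R).
Variables (nu : probability R R) (D : driver P nu).
Local Notation preT k := (g_sigma_algebraType (pre D k)).
Local Notation test := (test_function D).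
Local Notation leb := (@lebesgue_measure R).
Variables (L U : R) (eta : R -> T -> R) (lam : R -> R -> R).
Hypotheses (L_gt0 : 0 < L) (LU : L <= U).
Hypothesis meta : @measurable_fun _ _ (R * preT 0)%type R setT (fun z => eta z.1 z.2).
Hypothesis eta_bounds : forall u w, L <= eta u w <= U.
Hypothesis mlam : measurable_fun setT (fun z : R * R => lam z.1 z.2).
Hypothesis lam_bounds : forall u x, L <= lam u x <= U.

(** A weight stands for the reciprocal of a conditional expectation of [eta], whose values lie
    between [L] and [U]. *)
Record weight := Weight {
  wt :> R -> R -> R;
  wt_measurable : measurable_fun setT (fun z : R * R => wt z.1 z.2);
  wt_bounds : forall u x, U^-1 <= wt u x <= L^-1 }.

Let U_gt0 : 0 < U. Proof. exact: lt_le_trans LU. Qed.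

Lemma wt_gt0 (g : weight) u x : 0 < g u x.
Proof. by case/andP: (wt_bounds g u x) => + _; apply: lt_le_trans; rewrite invr_gt0. Qed.

Definition weighted_rate (g : weight) u w x := eta u w * lam u x * g u x.

Let rate_bounds (g : weight) u w x :
  L * L / U <= weighted_rate g u w x <= U * U / L.
Proof.
have /andP[e1 e2] := eta_bounds u w; have /andP[l1 l2] := lam_bounds u x.
have /andP[g1 g2] := wt_bounds g u x; have L0 := ltW L_gt0.
have Ui0 : 0 <= U^-1 by rewrite invr_ge0 ltW.
apply/andP; split; apply: ler_pM => //.
- exact: mulr_ge0.
- exact: ler_pM.
- by rewrite mulr_ge0// ?(le_trans L0).
- exact/ltW/wt_gt0.
- by apply: ler_pM => //; exact: le_trans L0 _.
Qed.

Lemma measurable_weighted_rate (g : weight) :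
  @measurable_fun _ _ (R * preT 0 * R)%type R setT (fun z => weighted_rate g z.1.1 z.1.2 z.2).
Proof.
have m1 := @measurable_fst _ _ (R * preT 0)%type R.
have m2 := @measurable_snd _ _ (R * preT 0)%type R.
have m11 := measurableT_comp (@measurable_fst _ _ R (preT 0)) m1.
have mux : @measurable_fun _ _ (R * preT 0 * R)%type (R * R)%type setT (fun z => (z.1.1, z.2)).
  exact: measurable_fun_pair.
apply: measurable_funM; last exact: (measurableT_comp (wt_measurable g) mux).
apply: measurable_funM; last exact: (measurableT_comp mlam mux).
exact: (measurableT_comp meta m1).
Qed.

Definition weighted_intensity (g : weight) : intensity D :=
  Intensity (@measurable_weighted_rate g)
    (divr_gt0 (mulr_gt0 L_gt0 L_gt0) U_gt0) (rate_bounds g).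

Local Notation X g := (left_state (weighted_intensity g)).
Local Notation tv_le := (tv_le D).

Let mX g t : measurable_fun setT (X g t).
Proof. exact: measurable_left_state_at. Qed.

Let K := U * U / L.

Let K_gt0 : 0 < K. Proof. by rewrite divr_gt0// mulr_gt0. Qed.

(** * Stability of the law with respect to the weight *)

Lemma weight_difference_bounded (g1 g2 : weight) u :
  bounded_test D (fun _ x => `|g1 u x - g2 u x|) (L^-1).
Proof.
have mg (g : weight) : measurable_fun setT (g u).
  exact: (measurableT_comp (wt_measurable g) (measurable_pair1 u)).
split.
  by apply: (@test_state _ _ _ _ _ D (fun x => `|g1 u x - g2 u x|)); apply: measurableT_comp => //; exact: measurable_funB.
move=> w x; rewrite normr_id ler_norml.
have /andP[a1 b1] := wt_bounds g1 u x; have /andP[a2 b2] := wt_bounds g2 u x.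
have : 0 < U^-1 by rewrite invr_gt0.
by move=> U0; apply/andP; split; lra.
Qed.

(** In use, [h] is the average of [f] over one jump. Passing from [X1] to [X2] with the weight [g1]
    costs [2 * K * b], as the rate is at most [K]; passing from [g1] to [g2] under [X2] costs
    [U * U * e], as [eta] and [lam] are at most [U]. *)
Lemma rate_comparison (g1 g2 : weight) (X1 X2 : T -> R) f h u b e :
  measurable_fun setT X1 -> measurable_fun setT X2 ->
  bounded_test D f 1 -> bounded_test D h 1 -> (forall w x, `|h w x - f w x| <= 1) ->
  tv_le X1 X2 b -> mean P X2 (fun _ x => `|g1 u x - g2 u x|) <= e ->
  mean P X1 (fun w x => weighted_rate g1 u w x * h w x) +
  mean P X2 (fun w x => weighted_rate g2 u w x * f w x) <=
  mean P X1 (fun w x => weighted_rate g1 u w x * f w x) +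
  mean P X2 (fun w x => weighted_rate g2 u w x * h w x) + (2 * K * b + U * U * e).
Proof.
move=> mX1 mX2 fb hb hf tv ge.
have qb g : bounded_test D (weighted_rate g u) K.
  split.
    have := test_rate_times (weighted_intensity g) u (@test_cst _ _ _ _ _ D 1).
    by congr (test_function D); apply/funext => w; apply/funext => x; rewrite /rate_times mulr1.
  move=> w x; have /andP[l r] := rate_bounds g u w x.
  by rewrite ger0_norm// (le_trans _ l)// divr_ge0 ?mulr_ge0// ltW.
have dfb : bounded_test D (fun w x => h w x - f w x) 1.
  by split => //; apply: testB; [exact: hb.1|exact: fb.1].
have m1 g Y : measurable_fun setT Y ->
    mean P Y (fun w x => weighted_rate g u w x * h w x) -
    mean P Y (fun w x => weighted_rate g u w x * f w x) =
    mean P Y (fun w x => weighted_rate g u w x * (h w x - f w x)).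
  move=> mY; rewrite -(meanB mY (bounded_testM (qb g) hb) (bounded_testM (qb g) fb)).
  by congr (mean P Y _); apply/funext => w; apply/funext => x; rewrite mulrBr.
have e1 := tv_le_bounded mX1 mX2 (bounded_testM (qb g1) dfb) tv.
have e2 : mean P X2 (fun w x => weighted_rate g1 u w x * (h w x - f w x)) -
   mean P X2 (fun w x => weighted_rate g2 u w x * (h w x - f w x)) <= U * U * e.
  rewrite -(meanB mX2 (bounded_testM (qb g1) dfb) (bounded_testM (qb g2) dfb)).
  apply: (@le_trans _ _ (U * U * mean P X2 (fun _ x => `|g1 u x - g2 u x|))).
    rewrite -(meanZ mX2 _ (weight_difference_bounded g1 g2 u)).
    apply: (le_mean mX2 (bounded_testB (bounded_testM (qb g1) dfb) (bounded_testM (qb g2) dfb))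
      (bounded_testM (bounded_test_cst D (U * U)) (weight_difference_bounded g1 g2 u))) => w.
    apply: le_trans (ler_norm _) _.
    rewrite -mulrBl normrM /weighted_rate -mulrBr !normrM.
    have /andP[ea eb] := eta_bounds u w; have /andP[la lb] := lam_bounds u (X2 w).
    have L0 := ltW L_gt0.
    rewrite (ger0_norm (le_trans L0 ea)) (ger0_norm (le_trans L0 la)).
    rewrite -[leRHS]mulr1; apply: ler_pM => //.
      by rewrite !mulr_ge0// (le_trans L0).
    apply: ler_wpM2r => //; apply: ler_pM => //; exact: le_trans L0 _.
  by rewrite ler_pM2l// mulr_gt0.
have := m1 g1 X1 mX1; have := m1 g2 X2 mX2.
move: e1; rewrite ler_norml mulr1 => /andP[_ e1]; lra.
Qed.

Lemma measurable_mean_rate (g : weight) f : test f -> (forall w x, 0 <= f w x <= 1) ->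
  measurable_fun setT (fun u => (mean P (X g u) (fun w x => weighted_rate g u w x * f w x))%:E).
Proof.
move=> mf f01.
pose h (z : R * T) := (weighted_rate g z.1 z.2 (X g z.1 z.2) * f z.2 (X g z.1 z.2))%:E.
have mXj := measurable_left_state_joint (weighted_intensity g).
have mh : measurable_fun setT h.
  apply/measurable_EFinP; apply: measurable_funM.
    have mid := measurable_id_g_sigma_algebra (@pre_measurable _ _ _ _ _ D 0).
    have m : @measurable_fun _ _ (R * T)%type (R * preT 0 * R)%type setT
        (fun z => (z.1, z.2, X g z.1 z.2)).
      apply: measurable_fun_pair => //.
      apply: measurable_fun_pair; first exact: measurable_fst.
      exact: (measurableT_comp mid (@measurable_snd _ _ R T)).
    exact: (measurableT_comp (@measurable_weighted_rate g) m).
  by apply: (measurable_test_function mf) => //; exact: measurable_snd.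
have h0 z : (0 <= h z)%E.
  rewrite lee_fin mulr_ge0//; last by case/andP: (f01 z.2 (X g z.1 z.2)).
  have /andP[+ _] := rate_bounds g z.1 z.2 (X g z.1 z.2).
  by apply: le_trans; rewrite divr_ge0 ?mulr_ge0// ltW.
have := @measurable_fun_fubini_tonelli_F _ _ R T R P h mh h0.
congr (measurable_fun setT); apply/funext => u; rewrite /fubini_F.
rewrite -(meanE (test_rate_times (weighted_intensity g) u mf)
  (fun w x => rate_times_bounds (weighted_intensity g) u w x f01))//.
exact: mX g u.
Qed.

Lemma mean_rate_bounds (g : weight) f u : test f -> (forall w x, 0 <= f w x <= 1) ->
  0 <= mean P (X g u) (fun w x => weighted_rate g u w x * f w x) <= K.
Proof.
move=> mf f01; have mq := test_rate_times (weighted_intensity g) u mf.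
have qb := rate_times_bounds (weighted_intensity g) u _ _ f01.
have b : bounded_test D (fun w x => weighted_rate g u w x * f w x) K.
  split => // w x; have /andP[q0 qK] := qb w x; rewrite mulr1 in qK.
  by rewrite ger0_norm.
apply/andP; split.
  rewrite -(mean_cst P (X g u) 0).
  by apply: (le_mean (mX g u) (bounded_test_cst D 0) b) => w; case/andP: (qb w (X g u w)).
by have := mean_bound (mX g u) b; rewrite ler_norml => /andP[].
Qed.

(** The forward equations of the two processes are subtracted and [rate_comparison] is integrated
    over []0, t[]; the integral of [expR (theta * u)] gains the factor [1 / theta]. *)
Lemma stability_step (g1 g2 : weight) theta M delta t : 0 < theta -> 0 <= M -> 0 <= delta ->
  (forall u, 0 <= u -> tv_le (X g1 u) (X g2 u) (M * expR (theta * u))) ->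
  (forall u, 0 <= u -> mean P (X g2 u) (fun _ x => `|g1 u x - g2 u x|) <=
    delta * expR (theta * u)) ->
  0 <= t ->
  tv_le (X g1 t) (X g2 t) ((2 * K * M + U * U * delta) / theta * expR (theta * t)).
Proof.
move=> theta0 M0 delta0 tv gd t0 f mf f01.
pose h := mark_average nu f.
have mh : test h by exact: test_mark_average mf f01.
have h01 w x : 0 <= h w x <= 1 by exact: mark_average_bounds mf f01 w x.
have fb : bounded_test D f 1.
  by split=> // w x; have /andP[? ?] := f01 w x; rewrite ger0_norm.
have hb : bounded_test D h 1.
  by split=> // w x; have /andP[? ?] := h01 w x; rewrite ger0_norm.
have hf w x : `|h w x - f w x| <= 1.
  have /andP[? ?] := f01 w x; have /andP[? ?] := h01 w x.
  by rewrite ler_norml; apply/andP; split; lra.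
pose I g k := (\int[leb]_(u in `]0%R, t[) (mean P (X g u) (fun w x => weighted_rate g u w x * k w x))%:E)%E.
have E1 := forward_equation (weighted_intensity g1) t mf f01.
have E2 := forward_equation (weighted_intensity g2) t mf f01.
rewrite -/(I g1 f) -/(I g1 h) in E1; rewrite -/(I g2 f) -/(I g2 h) in E2.
pose kappa := 2 * K * M + U * U * delta.
have K0 := ltW K_gt0; have U0 := ltW U_gt0.
have kappa0 : 0 <= kappa.
  by apply: addr_ge0; apply: mulr_ge0 => //; exact: mulr_ge0.
have I0 g k : test k -> (forall w x, 0 <= k w x <= 1) -> (0 <= I g k)%E.
  by move=> mk k01; apply: integral_ge0 => u _; rewrite lee_fin; case/andP: (mean_rate_bounds g u mk k01).
have mI g k : test k -> (forall w x, 0 <= k w x <= 1) ->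
    measurable_fun `]0, t[%classic (fun u => (mean P (X g u) (fun w x => weighted_rate g u w x * k w x))%:E).
  by move=> mk k01; apply: measurable_funTS; exact: measurable_mean_rate.
have Ifin g k : test k -> (forall w x, 0 <= k w x <= 1) -> I g k \is a fin_num.
  move=> mk k01; rewrite ge0_fin_numE; last exact: I0.
  apply: (@le_lt_trans _ _ (\int[leb]_(u in `]0%R, t[) K%:E)%E).
    apply: ge0_le_integral => //.
    - by move=> u _; rewrite lee_fin; case/andP: (mean_rate_bounds g u mk k01).
    - exact: mI.
    - by move=> u _; rewrite lee_fin; case/andP: (mean_rate_bounds g u mk k01).
  rewrite integral_cst//= lebesgue_measure_itv/=; case: ifP => _.
    by rewrite -EFinB -EFinM ltry.
  by rewrite mule0.
have mexp : measurable_fun `]0, t[%classic (fun u => (kappa * expR (theta * u))%:E).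
  apply/measurable_EFinP; apply: measurable_funTS; apply: measurable_funM => //.
  apply: measurableT_comp => //; exact: measurable_funM.
have key : (I g1 h + I g2 f <= I g1 f + I g2 h + (kappa / theta * expR (theta * t))%:E)%E.
  apply: (@le_trans _ _ (I g1 f + I g2 h + \int[leb]_(u in `]0%R, t[) (kappa * expR (theta * u))%:E)%E); last first.
    rewrite leeD2l//; under eq_integral do rewrite EFinM.
    rewrite ge0_integralZl//; last first.
      apply/measurable_EFinP; apply: measurable_funTS.
      by apply: measurableT_comp => //; exact: measurable_funM.
    apply: (@le_trans _ _ (kappa%:E * (expR (theta * t) / theta)%:E)%E).
      by apply: lee_wpmul2l; [rewrite lee_fin|exact: integral_expR_le].
    by rewrite -EFinM lee_fin -mulrA [_^-1 * _]mulrC.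
  have le0 g k u : test k -> (forall w x, 0 <= k w x <= 1) ->
      (0 <= (mean P (X g u) (fun w x => weighted_rate g u w x * k w x))%:E)%E.
    by move=> mk k01; rewrite lee_fin; case/andP: (mean_rate_bounds g u mk k01).
  have e0 u : (0 <= (kappa * expR (theta * u))%:E)%E by rewrite lee_fin mulr_ge0 ?expR_ge0.
  have DI g k g' k' : test k -> (forall w x, 0 <= k w x <= 1) ->
      test k' -> (forall w x, 0 <= k' w x <= 1) ->
      (I g k + I g' k' = \int[leb]_(u in `]0%R, t[)
        ((mean P (X g u) (fun w x => weighted_rate g u w x * k w x))%:E +
         (mean P (X g' u) (fun w x => weighted_rate g' u w x * k' w x))%:E))%E.
    move=> mk k01 mk' k'01; rewrite ge0_integralD//.
    - by move=> u _; exact: le0.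
    - exact: mI.
    - by move=> u _; exact: le0.
    - exact: mI.
  rewrite !DI// -ge0_integralD//; last 2 first.
  - by move=> u _; apply: adde_ge0; exact: le0.
  - by apply: emeasurable_funD; exact: mI.
  apply: ge0_le_integral => //.
  - by move=> u _; apply: adde_ge0; exact: le0.
  - by apply: emeasurable_funD; exact: mI.
  - by apply: emeasurable_funD => //; apply: emeasurable_funD; exact: mI.
  - move=> u; rewrite /= in_itv/= => /andP[u0 _]; rewrite -!EFinD lee_fin.
    have := rate_comparison (mX g1 u) (mX g2 u) fb hb hf (tv u (ltW u0)) (gd u (ltW u0)).
    have -> // : kappa * expR (theta * u) =
        2 * K * (M * expR (theta * u)) + U * U * (delta * expR (theta * u)).
      by rewrite /kappa; ring.
exact: (balance_le (Ifin g1 f mf f01) (Ifin g1 h mh h01) (Ifin g2 f mf f01)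
  (Ifin g2 h mh h01) E1 E2 key).
Qed.

Lemma le_geometric_half (a b c : R) : (forall n, a <= b + c * 2^-1 ^+ n) -> a <= b.
Proof.
move=> h; have c0 : (fun n => b + c * 2^-1 ^+ n) @ \oo --> b + 0.
  apply: cvgD; first exact: cvg_cst.
  by apply: cvg_geometric; rewrite ger0_norm// invf_lt1// ltr1n.
by rewrite addr0 in c0; apply: (cvgr_to_ge c0); near=> n; exact: h.
Unshelve. all: by end_near.
Qed.

(** Only the increases are controlled. Adding [2 * c * 2^-n], the sum of all increases still allowed
    after rank [n], makes the sequence nonincreasing. *)
Lemma cvgn_geometric_increments (u : nat -> R) (c B : R) : 0 <= c ->
  (forall n, u n.+1 <= u n + c * 2^-1 ^+ n) -> (forall n, - B <= u n) -> cvgn u.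
Proof.
move=> c0 uS uB; pose v n := u n + 2 * c * 2^-1 ^+ n.
have cv : cvgn v.
  apply: nonincreasing_is_cvgn.
    by apply/nonincreasing_seqP => n; rewrite /v exprS; have := uS n; lra.
  exists (- B) => _ [n _ <-]; rewrite /v (le_trans (uB n))// lerDl.
  by rewrite !mulr_ge0// exprn_ge0.
have -> : u = v \- (fun n => 2 * c * 2^-1 ^+ n) by apply/funext => n; rewrite /v /= addrK.
apply: is_cvgB => //; apply: (@cvgP _ _ 0).
by apply: cvg_geometric; rewrite ger0_norm// invf_lt1// ltr1n.
Qed.

(** A Gronwall estimate: [stability_step] is iterated from the trivial bound until the trace of this
    starting bound disappears. *)
Lemma stability (g1 g2 : weight) theta delta t : 4 * K <= theta -> 0 <= delta ->
  (forall u, 0 <= u -> mean P (X g2 u) (fun _ x => `|g1 u x - g2 u x|) <=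
    delta * expR (theta * u)) ->
  tv_le (X g1 t) (X g2 t) (2 * (U * U * delta) / theta * expR (theta * t)).
Proof.
move=> K4 delta0 gd; have theta0 : 0 < theta by apply: lt_le_trans K4; rewrite mulr_gt0.
have U0 := ltW U_gt0; have K0 := ltW K_gt0.
pose c := 2 * (U * U * delta) / theta; rewrite -/c.
have c0 : 0 <= c by rewrite divr_ge0 ?mulr_ge0// ltW.
have [t0|/ltW t0] := leP t 0.
  have z g : X g t = cst 0 by apply/funext => w; exact: left_state0.
  have ct0 : 0 <= c * expR (theta * t) by rewrite mulr_ge0// expR_ge0.
  by apply: (tv_le_weaken ct0); rewrite !z; exact: tv_le_refl.
(* Since [2 * K / theta <= 1/2] and [U * U * delta / theta = c / 2], one step maps the factor
   [2^-n + c] to at most [2^-(n+1) + c]. *)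
have it n s : 0 <= s -> tv_le (X g1 s) (X g2 s) ((2^-1 ^+ n + c) * expR (theta * s)).
  elim: n s => [|n IH] s s0.
    have le1 : 1 <= (2^-1 ^+ 0 + c) * expR (theta * s).
      rewrite expr0 -[leLHS]mulr1 ler_pM ?lerDl//.
      by rewrite -expR0 ler_expR mulr_ge0// ltW.
    by apply: (tv_le_weaken le1); exact: tv_le1.
  have M0 : 0 <= 2^-1 ^+ n + c by rewrite addr_ge0// exprn_ge0.
  apply: tv_le_weaken (stability_step theta0 M0 delta0 IH gd s0).
  rewrite ler_wpM2r ?expR_ge0// ler_pdivrMr//.
  have ec : U * U * delta = c * theta / 2.
    by rewrite /c divfK ?gt_eqF//; lra.
  rewrite ec exprS.
  have := ler_wpM2r M0 K4; lra.
move=> f mf f01; apply: (@le_geometric_half _ _ (expR (theta * t))) => n.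
apply: le_trans (it n t t0 f mf f01) _; lra.
Qed.

(* The weight [h] normalizes the conditional expectation of [eta s] given [X], up to [e]. *)
Definition balanced (Y : T -> R) s (h : R -> R) e := forall phi : R -> R,
  measurable_fun setT phi -> (forall x, `|phi x| <= 1) ->
  `|mean P Y (fun w x => eta s w * h x * phi x) - mean P Y (fun _ x => phi x)| <= e.

Definition admissible (h : R -> R) := measurable_fun setT h /\ forall x, 0 <= h x <= L^-1.

Lemma wt_admissible (g : weight) s : admissible (g s).
Proof.
split; first exact: (measurableT_comp (wt_measurable g) (measurable_pair1 s)).
by move=> x; rewrite (ltW (wt_gt0 _ _ _))//; case/andP: (wt_bounds g s x).
Qed.

Lemma bounded_test_eta s : bounded_test D (fun w _ => eta s w) U.
Proof.
split; last first.
  move=> w _; have /andP[l u] := eta_bounds s w.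
  by rewrite ger0_norm// (le_trans _ l)// ltW.
by apply: test_outcome; exact: (measurableT_comp meta (@measurable_pair1 _ _ R (preT 0) s)).
Qed.

Lemma bounded_test_phi (phi : R -> R) (B : R) : measurable_fun setT phi ->
  (forall x, `|phi x| <= B) -> bounded_test D (fun _ x => phi x) B.
Proof. by move=> mphi phiB; split => //; exact: test_state. Qed.

Lemma bounded_test_admissible h : admissible h -> bounded_test D (fun _ x => h x) L^-1.
Proof.
by move=> [mh hb]; apply: bounded_test_phi => // x; have /andP[? ?] := hb x; rewrite ger0_norm.
Qed.

Lemma bounded_test_balance s h (phi : R -> R) : admissible h -> measurable_fun setT phi ->
  (forall x, `|phi x| <= 1) -> bounded_test D (fun w x => eta s w * h x * phi x) (U / L).
Proof.
move=> ah mphi phi1; rewrite -[_ / _]mulr1.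
by apply: bounded_testM; [apply: bounded_testM;
  [exact: bounded_test_eta|exact: bounded_test_admissible]|exact: bounded_test_phi].
Qed.

(** Each mean moves by at most twice the bound of its test times [b]; the two bounds are [U / L] and
    [1]. *)
Lemma balanced_tv Y1 Y2 s h e b : measurable_fun setT Y1 -> measurable_fun setT Y2 ->
  admissible h -> tv_le Y1 Y2 b -> balanced Y2 s h e ->
  balanced Y1 s h (e + 2 * (U / L + 1) * b).
Proof.
move=> m1 m2 ah tv bal phi mphi phi1.
have h1 := tv_le_bounded m1 m2 (bounded_test_balance s ah mphi phi1) tv.
have h2 := tv_le_bounded m1 m2 (bounded_test_phi mphi phi1) tv.
have h3 := bal phi mphi phi1.
move: h1 h2 h3; rewrite !ler_norml => /andP[? ?] /andP[? ?] /andP[? ?].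
by apply/andP; split; lra.
Qed.

(* Test against the sign of [h1 - h2]. *)
Lemma balanced_close Y s h1 h2 e1 e2 : measurable_fun setT Y ->
  admissible h1 -> admissible h2 -> balanced Y s h1 e1 -> balanced Y s h2 e2 ->
  mean P Y (fun _ x => `|h1 x - h2 x|) <= (e1 + e2) / L.
Proof.
move=> mY a1 a2 b1 b2.
pose phi x : R := (-1) ^+ (h1 x < h2 x)%R.
have phi1 x : `|phi x| <= 1 by rewrite /phi normrX normrN1 expr1n.
have mphi : measurable_fun setT phi.
  have -> : phi = (fun x => if h1 x < h2 x then -1 else 1).
    by apply/funext => x; rewrite /phi; case: ifP.
  by apply: measurable_fun_ifT => //; apply: measurable_fun_ltr; [case: a1|case: a2].
have t1 := bounded_test_balance s a1 mphi phi1.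
have t2 := bounded_test_balance s a2 mphi phi1.
have n1 : bounded_test D (fun _ x => `|h1 x - h2 x|) (L^-1 + L^-1).
  have [m b] := bounded_testB (bounded_test_admissible a1) (bounded_test_admissible a2).
  split; last by move=> w x; rewrite normr_id; exact: b w x.
  by apply: test_state; apply: measurableT_comp => //; apply: measurable_funB; [case: a1|case: a2].
rewrite ler_pdivlMr// mulrC -(meanZ mY _ n1).
apply: (@le_trans _ _ (mean P Y (fun w x => eta s w * h1 x * phi x) -
    mean P Y (fun w x => eta s w * h2 x * phi x))).
  rewrite -(meanB mY t1 t2).
  apply: (le_mean mY (bounded_testM (bounded_test_cst D L) n1) (bounded_testB t1 t2)) => w.
  have -> : eta s w * h1 (Y w) * phi (Y w) - eta s w * h2 (Y w) * phi (Y w) =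
      eta s w * `|h1 (Y w) - h2 (Y w)|.
    rewrite /phi; case: ltP => h; rewrite ?expr1 ?expr0.
      by rewrite ltr0_norm ?subr_lt0//; ring.
    by rewrite ger0_norm ?subr_ge0//; ring.
  by rewrite ler_wpM2r//; case/andP: (eta_bounds s w).
have := b1 phi mphi phi1; have := b2 phi mphi phi1.
rewrite !ler_norml => /andP[? ?] /andP[? ?]; lra.
Qed.

Lemma measurable_state_indic (x : R) : measurable_fun setT (fun y : R => (y == x)%:R : R).
Proof.
have -> : (fun y : R => (y == x)%:R : R) = \1_[set x].
  by apply/funext => y; rewrite indicE; congr (nat_of_bool _)%:R; apply/eqP/idP; rewrite inE.
exact: measurable_indic.
Qed.

Lemma bounded_test_state_indic (x : R) : bounded_test D (fun _ y => (y == x)%:R) 1.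
Proof.
apply: bounded_test_phi; first exact: measurable_state_indic.
by move=> y; case: (y == x); rewrite ?normr1 ?normr0.
Qed.

(* Only countably many states are charged, so the vanishing on each of them passes to the
   whole mean, up to a tail controlled uniformly by total variation. *)
Lemma mean_concentrated (Y : nat -> T -> R) (S : set R) n0 (f : T -> R -> R) (B b : R) :
  (forall n, measurable_fun setT (Y n)) -> countable S -> (forall w, S (Y n0 w)) ->
  bounded_test D f B ->
  (forall m, (n0 <= m)%N -> tv_le (Y n0) (Y m) b) ->
  (forall x, mean P (Y m) (fun w y => f w y * (y == x)%:R) @[m --> \oo] --> 0) ->
  `|mean P (Y n0) f| <= 2 * B * b.
Proof.
move=> mY cS SY fb tv f0.
have B0 : 0 <= B by apply: le_trans (fb.2 point 0); exact: normr_ge0.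
have [e eS] : exists e : nat -> R, forall x, S x -> exists n, e n = x.
  have /pcard_geP/unsquash e : (S #<= [set: nat])%card by [].
  by exists e => x /(@surj _ _ _ _ e)[n _ <-]; exists n.
(* [chi k] is the indicator of the first [k] terms of the enumeration [e]. The factor
   [1 - chi k (e k)] in [chiS] keeps a repeated term from being counted twice. *)
pose chi := fix chi k (y : R) : R := if k is j.+1 then if y == e j then 1 else chi j y else 0.
have chi01 k y : 0 <= chi k y <= 1.
  by elim: k => [|k IH] /=; rewrite ?lexx ?ler01//; case: eqP => //; rewrite ?lexx ?ler01.
have chiS k y : chi k.+1 y = chi k y + (1 - chi k (e k)) * (y == e k)%:R.
  by rewrite /=; case: eqP => [->|_]; rewrite ?mulr0 ?addr0// mulr1 subrKC.
have mchi k : measurable_fun setT (chi k).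
  elim: k => [|k IH]; first exact: measurable_cst.
  have -> : chi k.+1 = (fun y => chi k y + (1 - chi k (e k)) * (y == e k)%:R).
    by apply/funext => y; exact: chiS.
  apply: measurable_funD => //; apply: measurable_funM => //; exact: measurable_state_indic.
have fchi k : bounded_test D (fun w y => f w y * chi k y) B.
  rewrite -[B]mulr1; apply: bounded_testM => //.
  by apply: bounded_test_phi => // y; have /andP[? ?] := chi01 k y; rewrite ger0_norm.
have fx x : bounded_test D (fun w y => f w y * (y == x)%:R) B.
  by rewrite -[B]mulr1; apply: bounded_testM => //; exact: bounded_test_state_indic.
have lim0 k : mean P (Y m) (fun w y => f w y * chi k y) @[m --> \oo] --> 0.
  elim: k => [|k IH].
    have -> : (fun m => mean P (Y m) (fun w y => f w y * chi 0 y)) = cst 0.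
      apply/funext => m; rewrite -[RHS](mean_cst P (Y m)); congr (mean P _ _).
      by apply/funext => w; apply/funext => y; rewrite mulr0.
    exact: cvg_cst.
  pose r := 1 - chi k (e k).
  have -> : (fun m => mean P (Y m) (fun w y => f w y * chi k.+1 y)) =
      (fun m => mean P (Y m) (fun w y => f w y * chi k y) +
        r * mean P (Y m) (fun w y => f w y * (y == e k)%:R)).
    apply/funext => m; rewrite -(meanZ (mY m) _ (fx _)).
    rewrite -(meanD (mY m) (fchi k) (bounded_testM (bounded_test_cst D r) (fx (e k)))).
    by congr (mean P _ _); apply/funext => w; apply/funext => y; rewrite chiS -/r; ring.
  have := cvgD IH (cvgM (cvg_cst r) (f0 (e k))).
  by rewrite mulr0 addr0; apply.
(* The means at [n0] and at [m] differ by at most [2 * B * b], uniformly in [k], and the one at [m]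
   tends to [0] as [m] grows. *)
have bk k : `|mean P (Y n0) (fun w y => f w y * chi k y)| <= 2 * B * b.
  have c1 : (fun m => 2 * B * b + `|mean P (Y m) (fun w y => f w y * chi k y)|) @ \oo -->
      2 * B * b + `|0 : R|.
    by apply: cvgD; [exact: cvg_cst|apply: cvg_norm; exact: lim0].
  rewrite normr0 addr0 in c1; apply: (cvgr_to_ge c1); near=> m.
  have n0m : (n0 <= m)%N by near: m; exact: nbhs_infty_ge.
  have := tv_le_bounded (mY n0) (mY m) (fchi k) (tv m n0m).
  set a := mean _ _ _; set a' := mean _ _ _ => h.
  by rewrite -[a](subrK a') (le_trans (ler_normD _ _))// lerD2r.
have mf0 k : measurable_fun setT (fun w => f w (Y n0 w) * chi k (Y n0 w)).
  by apply: (measurable_test_function (fchi k).1) => //; exact: measurable_id.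
(* [Y n0] takes its values in the enumerated set, so [chi k] tends to [1] along it and dominated
   convergence removes the truncation. *)
have cF : mean P (Y n0) (fun w y => f w y * chi k y) @[k --> \oo] --> mean P (Y n0) f.
  suff : (mean P (Y n0) (fun w y => f w y * chi k y))%:E @[k --> \oo] --> (mean P (Y n0) f)%:E.
    by move/fine_cvg.
  have mYf : measurable_fun setT (fun w => f w (Y n0 w)).
    by apply: (measurable_test_function fb.1) => //; exact: measurable_id.
  rewrite /mean (@bounded_RintegralE _ _ _ _ _ B)//; last by move=> w; exact: fb.2.
  have -> : (fun k => (\int[P]_w (f w (Y n0 w) * chi k (Y n0 w)))%:E) =
      (fun k => (\int[P]_w (f w (Y n0 w) * chi k (Y n0 w))%:E)%E).
    apply/funext => k; rewrite (@bounded_RintegralE _ _ _ _ _ B)//.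
    by move=> w; exact: (fchi k).2.
  apply: (@dominated_cvg _ _ _ _ _ _ _ _ (fun=> B%:E)) => //.
  - by move=> k; apply/measurable_EFinP; exact: mf0.
  - move=> w _; apply: cvg_EFin; first by near=> k.
    have [j ej] := eS _ (SY w).
    apply: cvg_near_cst; near=> k; rewrite /=.
    suff -> : chi k (Y n0 w) = 1 by rewrite mulr1.
    have : (j < k)%N by near: k; exact: nbhs_infty_gt.
    elim: {+}k => // k' IH; rewrite ltnS leq_eqVlt /= => /predU1P[<-|/IH ->].
      by rewrite ej eqxx.
    by case: ifP.
  - exact: finite_measure_integrable_cst.
  - by move=> k w _; rewrite abse_EFin lee_fin; exact: (fchi k).2.
by apply: (cvgr_to_le (cvg_norm cF)); near=> k; exact: bk.
Unshelve. all: by end_near.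
Qed.

(** * Normalization of the weight state by state *)

Definition state_mass (g : weight) s x := mean P (X g s) (fun _ y => (y == x)%:R).

Definition state_eta (g : weight) s x := mean P (X g s) (fun w y => eta s w * (y == x)%:R).

Lemma bounded_test_eta_indic s x : bounded_test D (fun w y => eta s w * (y == x)%:R) U.
Proof.
rewrite -[U]mulr1; apply: bounded_testM; [exact: bounded_test_eta|].
exact: bounded_test_state_indic.
Qed.

Lemma state_mass_ge0 g s x : 0 <= state_mass g s x.
Proof. by apply: Rintegral_ge0 => w _; case: (_ == _). Qed.

Lemma state_eta_bounds g s x :
  L * state_mass g s x <= state_eta g s x <= U * state_mass g s x.
Proof.
have b c : bounded_test D (fun _ y => c * (y == x)%:R) (`|c| * 1).
  by apply: bounded_testM; [exact: bounded_test_cst|exact: bounded_test_state_indic].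
rewrite /state_mass -!(meanZ (mX g s) _ (bounded_test_state_indic x)).
apply/andP; split.
  apply: (le_mean (mX g s) (b L) (bounded_test_eta_indic s x)) => w.
  by rewrite ler_wpM2r//; case/andP: (eta_bounds s w).
apply: (le_mean (mX g s) (bounded_test_eta_indic s x) (b U)) => w.
by rewrite ler_wpM2r//; case/andP: (eta_bounds s w).
Qed.

Let joint_indic g (h : R -> T -> R) : measurable_fun setT (fun z : R * T => h z.1 z.2) ->
  (forall s w, 0 <= h s w <= U) ->
  measurable_fun setT
    (fun z : R * R => \int[P]_w (h z.1 w * (X g z.1 w == z.2)%:R)).
Proof.
move=> mh hU.
pose f (z : (R * R) * T) := (h z.1.1 z.2 * (X g z.1.1 z.2 == z.1.2)%:R)%:E.
have msw : measurable_fun setT (fun z : (R * R) * T => (z.1.1, z.2)).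
  apply: measurable_fun_pair; last exact: measurable_snd.
  by apply: (measurableT_comp measurable_fst); exact: measurable_fst.
have mf : measurable_fun setT f.
  apply/measurable_EFinP; apply: measurable_funM; first exact: (measurableT_comp mh msw).
  apply: (measurableT_comp (f := fun b : bool => b%:R : R)) => //.
  apply: measurable_fun_eqr.
    exact: (measurableT_comp (measurable_left_state_joint (weighted_intensity g)) msw).
  by apply: (measurableT_comp measurable_snd); exact: measurable_fst.
have f0 z : (0 <= f z)%E.
  by rewrite lee_fin mulr_ge0//; case/andP: (hU z.1.1 z.2).
have := @measurable_fun_fubini_tonelli_F _ _ (R * R)%type T R P f mf f0.
move=> m; apply/measurable_EFinP.
move: m; congr (measurable_fun setT _); apply/funext => z; rewrite /fubini_F/=.
rewrite (@bounded_RintegralE _ _ _ _ _ U)//.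
  apply/measurable_EFinP; exact: (measurableT_comp mf (measurable_pair1 z)).
move=> w; have /andP[h0 h1] := hU z.1 w; rewrite ger0_norm ?mulr_ge0//.
by case: (_ == _); rewrite ?mulr1// mulr0 (le_trans h0).
Qed.

Lemma measurable_state_mass g : measurable_fun setT (fun z : R * R => state_mass g z.1 z.2).
Proof.
have Um : 0 < U^-1 by rewrite invr_gt0.
have -> : (fun z : R * R => state_mass g z.1 z.2) =
    (fun z => U^-1 * \int[P]_w (U * (X g z.1 w == z.2)%:R)).
  apply/funext => z; rewrite -/(mean P (X g z.1) (fun _ y => U * (y == z.2)%:R)).
  by rewrite (meanZ (mX g z.1) _ (bounded_test_state_indic z.2)) mulrA mulVf ?mul1r// gt_eqF.
apply: measurable_funM => //; apply: (@joint_indic g (fun _ _ => U)) => // s w.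
by rewrite lexx ltW.
Qed.

Lemma measurable_state_eta g : measurable_fun setT (fun z : R * R => state_eta g z.1 z.2).
Proof.
apply: (@joint_indic g eta).
  have mid := measurable_id_g_sigma_algebra (@pre_measurable _ _ _ _ _ D 0).
  apply: (measurableT_comp meta (f := fun z : R * preT 0 => eta z.1 z.2) (g := fun z : R * T => (z.1, z.2))).
  apply: measurable_fun_pair; first exact: measurable_fst.
  exact: (measurableT_comp mid (@measurable_snd _ _ R T)).
move=> s w; have /andP[l ->] := eta_bounds s w; rewrite andbT.
by rewrite (le_trans _ l)// ltW.
Qed.

(** The reciprocal of the conditional expectation of [eta s] given that the state is [x]. At states
    of zero mass, [L^-1] is a convention that respects the bounds of a weight. *)
Definition updated (g : weight) s x :=
  if 0 < state_mass g s x then state_mass g s x / state_eta g s x else L^-1.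

Lemma updated_bounds g s x : U^-1 <= updated g s x <= L^-1.
Proof.
rewrite /updated; case: ifPn => [n0|_]; last by rewrite lexx andbT lef_pV2.
have /andP[l u] := state_eta_bounds g s x.
have e0 : 0 < state_eta g s x by rewrite (lt_le_trans _ l)// mulr_gt0.
by rewrite ler_pdivlMr// ler_pdivrMr// ler_pdivrMl// ler_pdivlMl// u l.
Qed.

Lemma measurable_updated g : measurable_fun setT (fun z : R * R => updated g z.1 z.2).
Proof.
have -> : (fun z : R * R => updated g z.1 z.2) = (fun z => if 0 < state_mass g z.1 z.2
    then state_mass g z.1 z.2 * state_eta g z.1 z.2 `^ (-1) else L^-1).
  apply/funext => z; rewrite /updated; case: ifPn => // n0.
  have /andP[l _] := state_eta_bounds g z.1 z.2.
  by rewrite powR_inv1// (le_trans _ l)// mulr_ge0// ltW.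
apply: measurable_fun_ifT => //.
- apply: measurable_fun_ltr => //; exact: measurable_state_mass.
- apply: measurable_funM; first exact: measurable_state_mass.
  exact: (measurableT_comp (measurable_powR (-1)) (measurable_state_eta g)).
Qed.

Definition update g := Weight (measurable_updated g) (updated_bounds g).

(** At states of zero mass both sides vanish, since [state_eta] is at most [U] times
    [state_mass]. *)
Lemma update_mass g s x : update g s x * state_eta g s x = state_mass g s x.
Proof.
rewrite /update/= /updated; have /andP[l u] := state_eta_bounds g s x.
case: ifPn => [n0|].
  by rewrite divfK// gt_eqF// (lt_le_trans _ l)// mulr_gt0.
rewrite -leNgt => n0; have n0' := state_mass_ge0 g s x.
have e : state_mass g s x = 0 by apply/eqP; rewrite eq_le n0.
by move: l u; rewrite e !mulr0 => l u; rewrite (_ : state_eta g s x = 0) ?mulr0//; apply/eqP; rewrite eq_le u.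
Qed.

Let mean_at g s h (phi : R -> R) x : admissible h -> measurable_fun setT phi ->
  (forall x, `|phi x| <= 1) ->
  mean P (X g s) (fun w y => (eta s w * h y * phi y - phi y) * (y == x)%:R) =
  phi x * (h x * state_eta g s x - state_mass g s x).
Proof.
move=> ah mphi phi1.
have bi := bounded_test_state_indic x; have be := bounded_test_eta_indic s x.
transitivity (mean P (X g s) (fun w y => phi x * h x * (eta s w * (y == x)%:R) - phi x * (y == x)%:R)).
  congr (mean P _ _); apply/funext => w; apply/funext => y.
  by case: eqP => [->|_]; rewrite ?mulr0 ?subr0//; ring.
rewrite (meanB (mX g s) (bounded_testM (bounded_test_cst D _) be)
  (bounded_testM (bounded_test_cst D _) bi)).
by rewrite (meanZ (mX g s) _ be) (meanZ (mX g s) _ bi); rewrite /state_eta /state_mass; ring.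
Qed.

Let bounded_test_defect s h (phi : R -> R) : admissible h -> measurable_fun setT phi ->
  (forall x, `|phi x| <= 1) ->
  bounded_test D (fun w y => eta s w * h y * phi y - phi y) (U / L + 1).
Proof.
move=> ah mphi phi1; apply: bounded_testB; first exact: bounded_test_balance.
exact: bounded_test_phi.
Qed.

Hypothesis FS_countable : countable (FS (Atom nu)).

(** The defect vanishes at every single state by [update_mass]. [mean_concentrated] adds up the
    states; it is applied to a constant sequence of processes, with total variation bound [0]. *)
Lemma balanced_update g s : balanced (X g s) s (update g s) 0.
Proof.
move=> phi mphi phi1; have au := wt_admissible (update g) s.
rewrite -(meanB (mX g s) (bounded_test_balance s au mphi phi1) (bounded_test_phi mphi phi1)).
rewrite -(mulr0 (2 * (U / L + 1))).
apply: (@mean_concentrated (fun=> X g s) _ 0 _ _ _ (fun=> mX g s) FS_countable).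
- by move=> w; exact: FS_position.
- exact: bounded_test_defect.
- by move=> m _; exact: tv_le_refl.
- move=> x; rewrite mean_at// update_mass subrr mulr0; exact: cvg_cst.
Qed.

(** * Picard iteration *)

Let inv_L_bounds (u x : R) : U^-1 <= L^-1 <= L^-1.
Proof. by rewrite lexx andbT lef_pV2. Qed.

Definition first_weight : weight := Weight (@measurable_cst _ _ _ _ _ L^-1) inv_L_bounds.

Definition picard n := iter n update first_weight.

Local Notation g_ := picard.

(** Between laws at distance [b], a weight balanced for one has defect at most [2 * (U / L + 1) * b]
    for the other; division by [L] turns defects into mean distances of weights. *)
Let K1 := 2 * (U / L + 1) / L.

(** The first summand meets the requirement of [stability]; the second makes
    [2 * (U * U * K1) / theta] at most [1/2], the contraction factor of [picard_step]. *)
Let theta := 4 * K + 4 * (U * U * K1).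

Let U_ge0 : 0 <= U. Proof. exact: ltW. Qed.

Let K1_ge0 : 0 <= K1.
Proof. by rewrite divr_ge0 ?mulr_ge0 ?addr_ge0 ?divr_ge0// ltW. Qed.

Let UK_ge0 : 0 <= U * U * K1.
Proof. by apply: mulr_ge0 K1_ge0; exact: mulr_ge0. Qed.

Let theta_ge : 4 * K <= theta.
Proof. by rewrite lerDl; exact: mulr_ge0. Qed.

Let theta_gt0 : 0 < theta.
Proof. by apply: lt_le_trans theta_ge; exact: mulr_gt0. Qed.

Local Notation e_ t := (expR (theta * t)).

(** Under the law of the process of [g_ n.+1], the weight [g_ n.+2] is exactly balanced, and
    [g_ n.+1] is balanced up to a multiple of the distance between this law and that of [g_ n]. So
    the two weights are close in mean, and [stability] halves the bound. *)
Lemma picard_step n t : tv_le (X (g_ n.+1) t) (X (g_ n) t) (2^-1 ^+ n * e_ t).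
Proof.
have [t0|/ltW t0] := leP t 0.
  have z g : X g t = cst 0 by apply/funext => w; exact: left_state0.
  have ct0 : 0 <= 2^-1 ^+ n * e_ t by rewrite mulr_ge0 ?exprn_ge0// expR_ge0.
  by apply: (tv_le_weaken ct0); rewrite !z; exact: tv_le_refl.
elim: n t t0 => [|n IH] t t0.
  have le1 : 1 <= 2^-1 ^+ 0 * e_ t.
    by rewrite expr0 mul1r -expR0 ler_expR mulr_ge0// ltW.
  by apply: (tv_le_weaken le1); exact: tv_le1.
have d0 : 0 <= K1 * 2^-1 ^+ n by apply: mulr_ge0 => //; exact: exprn_ge0.
have close u : 0 <= u -> mean P (X (g_ n.+1) u) (fun _ x => `|g_ n.+2 u x - g_ n.+1 u x|) <=
    K1 * 2^-1 ^+ n * e_ u.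
  move=> u0; have a k := wt_admissible (g_ k) u.
  have b1 := balanced_update (g_ n.+1) u; have b0 := balanced_update (g_ n) u.
  have b0' := balanced_tv (mX _ u) (mX _ u) (a n.+1) (IH u u0) b0.
  have := balanced_close (mX _ u) (a n.+2) (a n.+1) b1 b0'.
  by rewrite !add0r => /le_trans; apply; rewrite /K1 le_eqVlt; apply/orP; left; apply/eqP; ring.
apply: tv_le_weaken (stability t theta_ge d0 close).
rewrite ler_wpM2r ?expR_ge0// ler_pdivrMr// exprS.
rewrite (_ : 2 * _ = 2^-1 * 2^-1 ^+ n * (4 * (U * U * K1))); last by field.
by rewrite ler_wpM2l ?mulr_ge0 ?exprn_ge0// lerDr; apply: mulr_ge0 => //; exact: ltW.
Qed.

Lemma picard_cauchy n k t : tv_le (X (g_ n) t) (X (g_ (n + k)) t) (2 * 2^-1 ^+ n * e_ t).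
Proof.
have e0 := expR_ge0 (theta * t).
(* The exact partial sum of the geometric series is kept for the induction. *)
suff h : tv_le (X (g_ n) t) (X (g_ (n + k)) t) ((2 * 2^-1 ^+ n - 2 * 2^-1 ^+ (n + k)) * e_ t).
  apply: tv_le_weaken h; rewrite ler_wpM2r// gerBl mulr_ge0// exprn_ge0//.
elim: k => [|k IH]; first by rewrite addn0 subrr mul0r; exact: tv_le_refl.
rewrite addnS; have := tv_le_trans IH (tv_le_sym (mX _ t) (mX _ t) (picard_step (n + k) t)).
apply: tv_le_weaken; rewrite exprS le_eqVlt; apply/orP; left; apply/eqP; by field.
Qed.

(** Convergence is obtained test by test, without constructing a limit law: the steps are geometric
    and the means are bounded. *)
Lemma picard_cvg f B t : bounded_test D f B ->
  cvgn (fun n => mean P (X (g_ n) t) f : R).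
Proof.
move=> fb; have B0 : 0 <= B by apply: le_trans (fb.2 point 0); exact: normr_ge0.
have c0 : 0 <= 2 * B * e_ t by rewrite !mulr_ge0// expR_ge0.
apply: (@cvgn_geometric_increments _ _ B c0) => n.
  have := tv_le_bounded (mX _ t) (mX _ t) fb (picard_step n t).
  rewrite ler_norml => /andP[_ h].
  by rewrite -lerBlDl (le_trans h)// le_eqVlt; apply/orP; left; apply/eqP; ring.
by have := mean_bound (mX (g_ n) t) fb; rewrite ler_norml => /andP[].
Qed.

(** The upper limit is defined and measurable also at states where the weights fail to converge;
    clamping makes the bounds of a weight immediate. *)
Definition limit_weight_fun s x :=
  Num.max U^-1 (Num.min L^-1 (limn_sup (fun n => g_ n s x))).

Lemma measurable_limit_weight : measurable_fun setT (fun z : R * R => limit_weight_fun z.1 z.2).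
Proof.
apply: measurable_maxr => //; apply: measurable_minr => //.
apply: (@measurable_fun_limn_sup _ _ _ _ (fun n (z : R * R) => g_ n z.1 z.2)).
- by move=> z _; exists L^-1 => _ [n _ <-]; case/andP: (wt_bounds (g_ n) z.1 z.2).
- by move=> z _; exists U^-1 => _ [n _ <-]; case/andP: (wt_bounds (g_ n) z.1 z.2).
- by move=> n; exact: wt_measurable.
Qed.

Lemma limit_weight_bounds s x : U^-1 <= limit_weight_fun s x <= L^-1.
Proof.
rewrite /limit_weight_fun le_max lexx/= ge_max ge_min lexx/= andbT.
by rewrite lef_pV2.
Qed.

Definition limit_weight := Weight measurable_limit_weight limit_weight_bounds.

Local Notation ginf := limit_weight.

Lemma limit_weightE s x l : g_ n s x @[n --> \oo] --> l -> ginf s x = l.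
Proof.
move=> cg; rewrite /ginf/= /limit_weight_fun; have [_ ->] := cvg_limn_inf_sup cg.
have lU : U^-1 <= l.
  by apply: (cvgr_to_ge cg); near=> n; case/andP: (wt_bounds (g_ n) s x).
have lL : l <= L^-1.
  by apply: (cvgr_to_le cg); near=> n; case/andP: (wt_bounds (g_ n) s x).
by rewrite min_r// max_r.
Unshelve. all: by end_near.
Qed.

(** By [update_mass] the defect is [(ginf s x - g_ n.+1 s x) * state_eta (g_ n) s x]. If [state_eta]
    tends to [0], boundedness of the weights suffices; otherwise the weights are eventually
    quotients of convergent sequences and tend to [ginf s x]. *)
Lemma limit_defect s x :
  ginf s x * state_eta (g_ n) s x - state_mass (g_ n) s x @[n --> \oo] --> 0.
Proof.
have -> : (fun n => ginf s x * state_eta (g_ n) s x - state_mass (g_ n) s x) =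
    (fun n => (ginf s x - g_ n.+1 s x) * state_eta (g_ n) s x).
  by apply/funext => n; rewrite -(update_mass (g_ n) s x) mulrBl.
have /cvg_ex[/= a ca] := @picard_cvg _ _ s (bounded_test_eta_indic s x).
have /cvg_ex[/= b cb] := @picard_cvg _ _ s (bounded_test_state_indic x).
rewrite -/(state_eta _ _ _) in ca.
have [a0|a0] := eqVneq a 0.
  rewrite a0 in ca; apply/cvgr0Pnorm_le => e e0.
  have Le : 0 < L * e by rewrite mulr_gt0.
  move/cvgr0Pnorm_le: ca => /(_ _ Le); apply: filterS => n h.
  have dg : `|ginf s x - g_ n.+1 s x| <= L^-1.
    have /andP[l1 u1] := wt_bounds ginf s x; have /andP[l2 u2] := wt_bounds (g_ n.+1) s x.
    have Ui : 0 < U^-1 by rewrite invr_gt0.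
    by rewrite ler_norml; apply/andP; split; lra.
  rewrite normrM; apply: (le_trans (ler_pM (normr_ge0 _) (normr_ge0 _) dg h)).
  by rewrite mulrA mulVf ?mul1r// gt_eqF.
have cg : g_ n s x @[n --> \oo] --> b / a.
  rewrite -cvg_shiftS; apply: cvg_trans (cvgM cb (cvgV a0 ca)).
  apply: near_eq_cvg; near=> n.
  have en0 : state_eta (g_ n) s x != 0 by near: n; exact: cvgr_neq0 ca a0.
  transitivity (state_mass (g_ n) s x / state_eta (g_ n) s x) => //.
  by rewrite -(update_mass (g_ n) s x) mulfK.
have gE : limit_weight_fun s x = b / a := limit_weightE cg.
rewrite gE.
have cgS : g_ n.+1 s x @[n --> \oo] --> b / a by rewrite -cvg_shiftS in cg.
have := cvgM (cvgB (cvg_cst (b / a)) cgS) ca.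
by rewrite subrr mul0r; apply.
Unshelve. all: by end_near.
Qed.

(** For the process of [g_ n.+1] the limit weight is nearly balanced, hence close in mean to
    [g_ n.+1]. By [stability] its own process is then close to that of [g_ n.+1], to which the near
    balance is known, and [balanced_tv] transfers it. All errors are multiples of [2^-n]. *)
Lemma exists_balanced_weight : exists g : weight, forall s, balanced (X g s) s (g s) 0.
Proof.
exists ginf => s.
pose B := U / L + 1.
have B0 : 0 <= B by rewrite addr_ge0// divr_ge0// ltW.
have ag g := wt_admissible g s.
have near_balanced n u : balanced (X (g_ n) u) u (ginf u) (2 * B * (2 * 2^-1 ^+ n * e_ u)).
  move=> phi mphi phi1; have au := wt_admissible ginf u.
  rewrite -(meanB (mX _ u) (bounded_test_balance u au mphi phi1) (bounded_test_phi mphi phi1)).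
  apply: (@mean_concentrated (fun n => X (g_ n) u) _ n _ B _ (fun n => mX _ u) FS_countable).
  - by move=> w; exact: FS_position.
  - exact: bounded_test_defect.
  - by move=> m /subnKC <-; exact: picard_cauchy.
  - move=> x; under eq_fun do rewrite mean_at//.
    by have := cvgM (cvg_cst (phi x)) (limit_defect u x); rewrite mulr0; apply.
(* Under the law of [g_ n.+1], the defects of [ginf] and of [g_ n.+1] are both at most
   [2 * B * 2^-n * e_ u]; [balanced_close] divides their sum by [L]. *)
pose C := 4 * B / L.
have C0 : 0 <= C by apply: divr_ge0; [exact: mulr_ge0|exact: ltW].
have close n u : 0 <= u -> mean P (X (g_ n.+1) u) (fun _ x => `|ginf u x - g_ n.+1 u x|) <=
    C * 2^-1 ^+ n * e_ u.
  move=> u0; have a g := wt_admissible g u.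
  have b0 := balanced_tv (mX _ u) (mX _ u) (a (g_ n.+1)) (picard_step n u) (balanced_update (g_ n) u).
  have := balanced_close (mX _ u) (a ginf) (a (g_ n.+1)) (near_balanced n.+1 u) b0.
  move/le_trans; apply; rewrite /C exprS -/B le_eqVlt; apply/orP; left; apply/eqP.
  by field; rewrite gt_eqF.
pose C2 := 2 * (U * U * C) / theta.
have tv n : tv_le (X ginf s) (X (g_ n.+1) s) (C2 * 2^-1 ^+ n * e_ s).
  have Cn : 0 <= C * 2^-1 ^+ n by apply: mulr_ge0 => //; exact: exprn_ge0.
  have := stability s theta_ge Cn (close n).
  apply: tv_le_weaken; rewrite le_eqVlt; apply/orP; left; apply/eqP; rewrite /C2; ring.
move=> phi mphi phi1.
apply: (@le_geometric_half _ _ ((2 * B + 2 * B * C2) * e_ s)) => n.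
apply: le_trans (balanced_tv (mX _ s) (mX _ s) (ag _) (tv n) (near_balanced n.+1 s) mphi phi1) _.
by rewrite exprS le_eqVlt; apply/orP; left; apply/eqP; rewrite -/B; field.
Qed.

End local_intensity.

(** * Driving sequences *)

Section independence_lemmas.
Context d (T : measurableType d) (R : realType) (P : probability T R).

Lemma mutually_independent_seq (I : choiceType) (S : I -> set (set T)) (r : seq I)
    (A : I -> set T) : mutually_independent P S -> uniq r ->
  (forall i, i \in r -> S i (A i)) ->
  P (\bigcap_(i in [set` r]) A i) = (\prod_(i <- r) P (A i))%E.
Proof.
move=> indep ur SA.
have := indep [fset i | i in r]%fset A.
have memr : [fset i | i in r]%fset =i r by move=> i; rewrite !inE.
rewrite (_ : [set` [fset i | i in r]%fset] = [set` r]); last first.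
  by apply/seteqP; split=> i /=; rewrite memr.
move=> ->; last by move=> i; rewrite memr; exact: SA.
apply: perm_big; apply: uniq_perm => //; exact: fset_uniq.
Qed.

Lemma sigma_of_preimage (X : T -> R) (B : set R) : measurable B -> sigma_of X (X @^-1` B).
Proof. by move=> mB; exists B; [exact: mB|rewrite setTI]. Qed.

Lemma measure_eq_off_null (N A B : set T) : measurable N -> P N = 0%E ->
  measurable A -> measurable B -> A `\` N = B `\` N -> P A = P B.
Proof.
move=> mN N0 mA mB AB.
have z C : measurable C -> P C = P (C `\` N).
  move=> mC; rewrite [LHS](measureDI P mC mN).
  rewrite -[RHS]adde0; congr (_ + _)%E.
  by apply: (subset_measure0 _ mN) => //; exact: measurableI.
by rewrite (z _ mA) (z _ mB) AB.
Qed.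

(** The finite measures [A |-> P (A]&[S)] and [p] times [P] agree on a pi-system that contains the
    whole space. *)
Lemma independent_g_sigma_algebra (C : set (set T)) (S : set T) (p : \bar R) :
  C `<=` measurable -> setI_closed C -> C setT -> measurable S -> (0 <= p <= 1)%E ->
  (forall A, C A -> P (A `&` S) = P A * p)%E ->
  forall A, <<s C >> A -> (P (A `&` S) = P A * p)%E.
Proof.
move=> Cm CI CT mS /andP[p0 p1] CS.
have pf : p \is a fin_num by rewrite ge0_fin_numE// (le_lt_trans p1)// ltry.
pose q : {nonneg R} := NngNum (fine_ge0 p0).
move=> A CA; rewrite muleC -[p]fineK//.
apply: (@g_sigma_algebra_measure_unique _ _ _ C Cm (fun=> setT) (fun=> CT) _
  (mrestr P mS) (mscale q P)) => //.
- by rewrite bigcup_const.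
- by move=> B CB; apply: (etrans (CS B CB)); rewrite muleC -[X in (X * _)%E](fineK pf).
- by move=> _; apply: le_lt_trans (probability_le1 P (measurableI _ _ measurableT mS)) (ltry _).
Qed.

End independence_lemmas.

Section driver_of_sequences.
Context d (T : measurableType d) (R : realType) (P : probability T R).
Variables (H : set (set T)) (nu : probability R R) (E J : nat -> {RV P >-> R}).
Hypotheses (H_sigma : sigma_algebra setT H) (Hm : H `<=` measurable)
  (H_null : forall N, measurable N -> P N = 0%E -> H N).
Hypotheses (E_iid : iid E (exponential_prob 1)) (J_iid : iid J nu).
Hypothesis HEJ : mutually_independent P (tnth [tuple H; sigma_of_seq E; sigma_of_seq J]).
Hypotheses (nu_discrete : discrete_probability nu) (nu0 : nu [set 0] = 0%E).

Definition cylinder (X : nat -> T -> R) m (B : nat -> set R) :=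
  \bigcap_(j < m) (X j @^-1` B j).

Lemma measurable_cylinder (X : nat -> {RV P >-> R}) m B :
  (forall j, measurable (B j)) -> measurable (cylinder X m B).
Proof.
move=> mB; apply: fin_bigcap_measurable; first exact: finite_II.
by move=> j _; exact: measurable_funPTI.
Qed.

Lemma sigma_of_seq_cylinder (X : nat -> T -> R) m B : (forall j, measurable (B j)) ->
  sigma_of_seq X (cylinder X m B).
Proof.
move=> mB.
have := @fin_bigcap_measurable _ (g_sigma_algebraType (\bigcup_k sigma_of (X k))) nat `I_m
  (fun j => X j @^-1` B j) (finite_II m).
apply => j _; apply: sub_sigma_algebra; exists j => //.
exact: sigma_of_preimage.
Qed.

Lemma cylinder_prob (X : nat -> {RV P >-> R}) (law : set R -> \bar R) m B : iid X law ->
  (forall j, measurable (B j)) -> P (cylinder X m B) = (\prod_(j < m) law (B j))%E.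
Proof.
move=> [indep lawE] mB.
have -> : cylinder X m B = \bigcap_(j in [set` iota 0 m]) (X j @^-1` B j).
  by rewrite /cylinder; congr bigcap; apply/seteqP; split=> j /=; rewrite mem_iota.
rewrite (mutually_independent_seq indep (iota_uniq 0 m)); last first.
  by move=> j _; exact: sigma_of_preimage.
rewrite -[m in LHS]subn0 -/(index_iota 0 m) big_mkord.
by apply: eq_bigr => j _; rewrite -(lawE j).
Qed.

(** A pi-system for the joint information of [H], the first [m] variables [E] and the first [n]
    variables [J]. *)
Definition cylinder_generator m n : set (set T) :=
  [set A | exists A0 B C, [/\ H A0, forall j, measurable (B j), forall j, measurable (C j) &
    A = A0 `&` (cylinder E m B `&` cylinder J n C)]].

Lemma cylinder_generator_prob m n A0 B C : H A0 -> (forall j, measurable (B j)) ->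
  (forall j, measurable (C j)) ->
  P (A0 `&` (cylinder E m B `&` cylinder J n C)) =
  (P A0 * (\prod_(j < m) exponential_prob 1 (B j) * \prod_(j < n) nu (C j)))%E.
Proof.
move=> HA mB mC.
pose A i := tnth [tuple A0; cylinder E m B; cylinder J n C] i.
have := mutually_independent_seq (A := A) HEJ (enum_uniq 'I_3).
have -> : \bigcap_(i in [set` enum 'I_3]) A i = A0 `&` (cylinder E m B `&` cylinder J n C).
  apply/seteqP; split=> [w h|w [h1 [h2 h3]] i _].
    have in3 (i : 'I_3) : i \in enum 'I_3 by rewrite mem_enum.
    have h0 := h (@Ordinal 3 0 isT) (in3 _); have h1 := h (@Ordinal 3 1 isT) (in3 _).
    by have h2 := h (@Ordinal 3 2 isT) (in3 _).
  by case: i => -[|[|[|]]].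
move=> ->; last first.
  move=> i _; case: i => -[|[|[|]]]// ?.
  - exact: sigma_of_seq_cylinder.
  - exact: sigma_of_seq_cylinder.
rewrite big_enum/= !big_ord_recl big_ord0 mule1 /A/=.
by rewrite (cylinder_prob _ E_iid)// (cylinder_prob _ J_iid).
Qed.

Lemma cylinderI (X : nat -> T -> R) m B B' :
  cylinder X m B `&` cylinder X m B' = cylinder X m (fun j => B j `&` B' j).
Proof.
apply/seteqP; split=> [w [h h'] j jm|w h]; first by split; [exact: h|exact: h'].
by split => j jm; [exact: (h j jm).1|exact: (h j jm).2].
Qed.

Lemma cylinder_generatorI m n : setI_closed (cylinder_generator m n).
Proof.
move=> _ _ [A [B [C [HA mB mC ->]]]] [A' [B' [C' [HA' mB' mC' ->]]]].
exists (A `&` A'), (fun j => B j `&` B' j), (fun j => C j `&` C' j); split.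
- by have := @measurableI _ (g_sigma_algebraType H) A A'; rewrite /measurable/= sigma_algebra_id//; apply.
- by move=> j; exact: measurableI.
- by move=> j; exact: measurableI.
- by rewrite -!cylinderI setIACA; congr (_ `&` _); rewrite setIACA.
Qed.

Let HT : H setT.
Proof. by have := @measurableT _ (g_sigma_algebraType H); rewrite /measurable/= sigma_algebra_id. Qed.

Lemma cylinderT (X : nat -> T -> R) m : cylinder X m (fun=> setT) = setT.
Proof. by apply/seteqP; split. Qed.

Lemma cylinder_generator_base m n : H `<=` cylinder_generator m n.
Proof.
move=> A HA; exists A, (fun=> setT), (fun=> setT); split => //.
by rewrite !cylinderT !setIT.
Qed.

Lemma cylinder_generator_measurable m n : cylinder_generator m n `<=` measurable.
Proof.
move=> _ [A [B [C [HA mB mC ->]]]].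
by apply: measurableI; [exact: Hm|apply: measurableI; exact: measurable_cylinder].
Qed.

Lemma cylinder_widen (X : nat -> T -> R) m m' B : (m <= m')%N ->
  cylinder X m B = cylinder X m' (fun j => if (j < m)%N then B j else setT).
Proof.
move=> mm'; apply/seteqP; split=> w h j /= jm.
  by case: ifPn => // jm'; exact: h.
by have := h j (leq_trans jm mm'); rewrite /= jm.
Qed.

Lemma sub_cylinder_generator m m' n n' : (m <= m')%N -> (n <= n')%N ->
  cylinder_generator m n `<=` cylinder_generator m' n'.
Proof.
move=> mm' nn' _ [A [B [C [HA mB mC ->]]]].
exists A, (fun j => if (j < m)%N then B j else setT), (fun j => if (j < n)%N then C j else setT).
split => //; [by move=> j; case: ifP|by move=> j; case: ifP|].
by rewrite -!cylinder_widen.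
Qed.

Lemma cylinderS (X : nat -> T -> R) m B S :
  cylinder X m B `&` X m @^-1` S = cylinder X m.+1 (fun j => if (j < m)%N then B j else S).
Proof.
apply/seteqP; split=> w.
  move=> [h hS] j /=; rewrite ltnS leq_eqVlt => /predU1P[->|jm]; first by rewrite ltnn.
  by rewrite jm; exact: h.
move=> h; split; last by have := h m (ltnSn m); rewrite /= ltnn.
by move=> j jm; have := h j (ltnW jm : (j < m.+1)%N); rewrite /= jm.
Qed.

Lemma prod_cylinderS (f : set R -> \bar R) m (B : nat -> set R) S :
  (\prod_(j < m.+1) f (if (j < m)%N then B j else S) = \prod_(j < m) f (B j) * f S)%E.
Proof.
rewrite big_ord_recr/= ltnn; congr (_ * _)%E; apply: eq_bigr => j _.
by rewrite ltn_ord.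
Qed.

Let prob_01 (mu : probability R R) S : measurable S -> (0 <= mu S <= 1)%E.
Proof. by move=> mS; apply/andP; split; [exact: measure_ge0|exact: probability_le1]. Qed.

Lemma gap_independent k A S : <<s cylinder_generator k k >> A -> measurable S ->
  (P (A `&` E k @^-1` S) = P A * exponential_prob 1 S)%E.
Proof.
move=> GA mS; apply: independent_g_sigma_algebra GA.
- exact: cylinder_generator_measurable.
- exact: cylinder_generatorI.
- exact: cylinder_generator_base.
- exact: measurable_funPTI.
- rewrite -(E_iid.2 k S mS); exact: (prob_01 (distribution P (E k)) mS).
move=> _ [A0 [B [C [HA mB mC ->]]]].
rewrite -setIA setIAC cylinderS !cylinder_generator_prob//; last by move=> j; case: ifP.
by rewrite prod_cylinderS -!muleA; congr (_ * (_ * _))%E; exact: muleC.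
Qed.

Lemma mark_independent k A S : <<s cylinder_generator k.+1 k >> A -> measurable S ->
  (P (A `&` J k @^-1` S) = P A * nu S)%E.
Proof.
move=> GA mS; apply: independent_g_sigma_algebra GA.
- exact: cylinder_generator_measurable.
- exact: cylinder_generatorI.
- exact: cylinder_generator_base.
- exact: measurable_funPTI.
- exact: prob_01.
move=> _ [A0 [B [C [HA mB mC ->]]]].
rewrite -!setIA cylinderS !cylinder_generator_prob//; last by move=> j; case: ifP.
by rewrite prod_cylinderS !muleA.
Qed.

Lemma countable_Atom : countable (Atom nu).
Proof.
have [S cS nuS] := nu_discrete; apply: (sub_countable _ cS); apply: subset_card_le => x.
rewrite /Atom/= => x0; apply: contrapT => Sx; move: x0.
have mS : measurable S by exact: (countable_measurable (@measurable_set1 R) cS).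
rewrite (@subset_measure0 _ _ _ nu [set x] (~` S)) ?ltxx//.
- exact: measurableC.
- by move=> _ ->.
Qed.

Let mAtom : measurable (Atom nu).
Proof. exact: (countable_measurable (@measurable_set1 R) countable_Atom). Qed.

Lemma Atom_full : nu (~` Atom nu) = 0%E.
Proof.
have [S cS nuS] := nu_discrete.
have mS : measurable S by exact: (countable_measurable (@measurable_set1 R) cS).
have cD : countable (S `\` Atom nu) by apply: (sub_countable _ cS); apply: subset_card_le => x [].
have mD : measurable (S `\` Atom nu) by exact: measurableD.
have D0 : nu (S `\` Atom nu) = 0%E.
  have /pcard_geP/unsquash e : (S `\` Atom nu #<= [set: nat])%card by [].
  pose B n := [set e n] `&` (S `\` Atom nu).
  have mB n : measurable (B n) by apply: measurableI => //; exact: measurable_set1.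
  have -> : S `\` Atom nu = \bigcup_n B n.
    apply/seteqP; split=> [x Dx|x [n _ []]//].
    by have [n _ en] := @surj _ _ _ _ e x Dx; exists n.
  apply/negligibleP; first exact: bigcupT_measurable.
  apply: negligible_bigcup => n; apply/negligibleP; first exact: mB.
  have [De|De] := pselect ((S `\` Atom nu) (e n)).
    have -> : B n = [set e n] by apply/seteqP; split=> [x []//|x ->].
    by apply/eqP; rewrite -measure_le0 leNgt; apply/negP; case: De => _; apply.
  have -> : B n = set0 by rewrite -subset0 => x [->].
  exact: measure0.
apply/negligibleP; first exact: measurableC.
apply: (@negligibleS _ _ _ _ (~` S `|` (S `\` Atom nu))).
  by move=> x Ax; have [Sx|Sx] := pselect (S x); [right|left].
by apply: negligibleU; apply/negligibleP => //; exact: measurableC.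
Qed.

(** The third part says that from some rank on all [E j] are less than [1]; off it, infinitely many
    are at least [1], which makes the sums of positive gaps unbounded. *)
Definition null_part : set T :=
  \bigcup_k (E k @^-1` `]-oo, 0]) `|` \bigcup_k (J k @^-1` (~` Atom nu)) `|`
  \bigcup_k \bigcap_n cylinder E n (fun j => if (j < k)%N then setT else `]-oo, 1[%classic).

Local Notation N := null_part.

Lemma measurable_null_part : measurable N.
Proof.
apply: measurableU; first apply: measurableU.
- by apply: bigcupT_measurable => k; exact: measurable_funPTI.
- by apply: bigcupT_measurable => k; apply: measurable_funPTI; exact: measurableC.
- apply: bigcupT_measurable => k; apply: bigcapT_measurable => n.
  by apply: measurable_cylinder => j; case: ifP.
Qed.

Lemma null_part0 : P N = 0%E.
Proof.
apply/negligibleP; first exact: measurable_null_part.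
apply: negligibleU; first apply: negligibleU; apply: negligible_bigcup => k.
- apply/negligibleP; first exact: measurable_funPTI.
  rewrite -[LHS]/(distribution P (E k) _) E_iid.2//.
  have := @integral0_eq _ _ _ (@lebesgue_measure R) `]-oo, 0[ (fun x => (exponential_pdf 1 x)%:E).
  move=> h; rewrite /exponential_prob -integral_itv_bndo_bndc ?h// => [x|].
    by rewrite /= in_itv/= => x0; rewrite lt0_exponential_pdf.
  by apply/measurable_EFinP/measurable_funTS; exact: measurable_exponential_pdf.
- apply/negligibleP; first by apply: measurable_funPTI; exact: measurableC.
  rewrite -[LHS]/(distribution P (J k) _) J_iid.2//; last exact: measurableC.
  exact: Atom_full.
pose B j := if (j < k)%N then setT else `]-oo, (1 : R)[%classic.
have mB j : measurable (B j) by rewrite /B; case: ifP.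
have mc n : measurable (cylinder E n B) by exact: measurable_cylinder.
apply/negligibleP; first exact: bigcapT_measurable.
(* With [r] the probability of [E j < 1], the cylinder of length [k + n] has probability [r ^+ n],
   which tends to [0]. *)
have [r r01 rE] : exists2 r : R, 0 <= r < 1 & exponential_prob 1 `]-oo, (1 : R)[ = r%:E.
  have e1 := @exponential_prob_itvcy R 1 ler01.
  exists (1 - exponential_pdf 1 1).
    rewrite exponential_pdfE// mul1r mulN1r gtrBl expR_gt0 andbT subr_ge0.
    by rewrite -[leRHS]expR0 ler_expR oppr_le0.
  by rewrite EFinB -e1 -setCitvr; apply: probability_setC.
have Pc n : (P (cylinder E (k + n) B) = (r ^+ n)%:E)%E.
  rewrite (cylinder_prob _ E_iid)//; elim: n => [|n IH].
    rewrite addn0 big1// => j _; rewrite /B ltn_ord.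
    exact: probability_setT.
  by rewrite addnS big_ord_recr/= IH /B ltnNge leq_addr/= rE -EFinM exprSr.
apply/eqP; rewrite -measure_le0; apply/lee_addgt0Pr => e e0; rewrite add0e.
have : r ^+ n @[n --> \oo] --> (0 : R).
  by apply: cvg_expr; rewrite ger0_norm; case/andP: r01.
move/cvgr0Pnorm_le => /(_ _ e0)[n _ /(_ n (leqnn n))].
rewrite ger0_norm; last by rewrite exprn_ge0//; case/andP: r01.
rewrite -lee_fin -(Pc n); apply: le_trans; apply: le_measure; rewrite ?inE//.
  exact: bigcapT_measurable.
by move=> w; apply.
Qed.

Lemma not_null_part w : ~ N w -> [/\ forall k, 0 < E k w, forall k, Atom nu (J k w) &
  forall k, exists n, (k <= n)%N /\ 1 <= E n w].
Proof.
move=> Nw; split=> k.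
- rewrite ltNge; apply/negP => Ek; apply: Nw; left; left; exists k => //; rewrite /= in_itv/=.
- by apply: contrapT => Jk; apply: Nw; left; right; exists k.
- apply: contrapT => /forallNP h; apply: Nw; right; exists k => // n _ j jn /=.
  by case: ifPn => //; rewrite -leqNgt => kj; rewrite /= in_itv/= ltNge; apply/negP => ?; apply: (h j).
Qed.

Lemma sum_unbounded (e : nat -> R) (M : R) : (forall k, 0 < e k) ->
  (forall k, exists n, (k <= n)%N /\ 1 <= e n) -> exists n, M < \sum_(k < n) e k.
Proof.
move=> e0 e1; have [m Mm] : exists m : nat, M < m%:R.
  by exists (Num.truncn `|M|).+1; rewrite (le_lt_trans (ler_norm M))// truncnS_gt.
suff [n nm] : exists n, m%:R <= \sum_(k < n) e k by exists n; exact: lt_le_trans nm.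
elim: m {Mm} => [|m [n nm]]; first by exists 0%N; rewrite big_ord0.
have [n' [nn' e'1]] := e1 n; exists n'.+1.
rewrite big_ord_recr/= -addn1 natrD lerD// (le_trans nm)//.
rewrite -(subnKC nn') big_split_ord/= lerDl; apply: sumr_ge0 => j _; exact: ltW.
Qed.

Lemma exists_Atom : exists x, Atom nu x.
Proof.
apply: contrapT => /forallNP h; have := probability_setT nu.
rewrite (_ : [set: R] = ~` Atom nu); last by apply/seteqP; split=> // x _; exact: h.
rewrite Atom_full.
by move=> /eqP; rewrite eq_sym onee_eq0.
Qed.

(** On the exceptional null event, gaps and marks become constants with the properties required of a
    driver, so that these hold for every outcome. The event lies in [H], so measurability for the
    generated sigma-algebras is kept. *)
Definition proper_gap k w := if w \in N then 1 else E k w.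

Definition proper_mark k w := if w \in N then xget 0 (Atom nu) else J k w.

Let HN : H N. Proof. by apply: H_null; [exact: measurable_null_part|exact: null_part0]. Qed.

Let off (X Y : T -> R) S : measurable S -> measurable_fun setT X -> measurable_fun setT Y ->
  (forall w, ~ N w -> X w = Y w) -> forall A, measurable A -> P (A `&` X @^-1` S) = P (A `&` Y @^-1` S).
Proof.
move=> mS mX mY XY A mA; apply: (measure_eq_off_null measurable_null_part null_part0).
- by apply: measurableI => //; rewrite -[_ @^-1` _]setTI; exact: mX.
- by apply: measurableI => //; rewrite -[_ @^-1` _]setTI; exact: mY.
- by apply/seteqP; split=> w [[Aw Sw] Nw]; split => //; split => //=; [rewrite -XY|rewrite XY].
Qed.

Let measurable_patch (S : set (set T)) (Z : T -> R) (r : R) : H `<=` S ->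
  @measurable_fun _ _ (g_sigma_algebraType S) R setT Z ->
  @measurable_fun _ _ (g_sigma_algebraType S) R setT (fun w => if w \in N then r else Z w).
Proof.
move=> HS mZ; apply: measurable_fun_ifT => //.
apply: (@measurable_fun_bool _ (g_sigma_algebraType S) _ _ true).
rewrite setTI (_ : _ @^-1` _ = N); first by apply: sub_sigma_algebra; exact: HS.
by apply/seteqP; split=> w h; [exact: set_mem|exact: mem_set].
Qed.

Lemma measurable_proper_gap k :
  @measurable_fun _ _ (g_sigma_algebraType (cylinder_generator k.+1 k)) R setT (proper_gap k).
Proof.
apply: measurable_patch; first exact: cylinder_generator_base.
move=> _ B mB; rewrite setTI; apply: sub_sigma_algebra.
exists setT, (fun j => if (j < k)%N then setT else B), (fun=> setT); split => //.
  by move=> j; case: ifP.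
by rewrite -cylinderS !cylinderT !setTI setIT.
Qed.

Lemma measurable_proper_mark k :
  @measurable_fun _ _ (g_sigma_algebraType (cylinder_generator k.+1 k.+1)) R setT (proper_mark k).
Proof.
apply: measurable_patch; first exact: cylinder_generator_base.
move=> _ B mB; rewrite setTI; apply: sub_sigma_algebra.
exists setT, (fun=> setT), (fun j => if (j < k)%N then setT else B); split => //.
  by move=> j; case: ifP.
by rewrite -cylinderS !cylinderT !setTI.
Qed.

Lemma exists_driver : exists D : driver P nu, H `<=` pre D 0 /\
  forall w, ~ N w -> forall k, mark D k w = J k w.
Proof.
have gm k l : <<s cylinder_generator k l >> `<=` measurable.
  by apply: smallest_sub; [exact: sigma_algebra_measurable|exact: cylinder_generator_measurable].
have mg k : measurable_fun setT (proper_gap k).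
  exact: (measurableT_comp (@measurable_proper_gap k) (measurable_id_g_sigma_algebra (@cylinder_generator_measurable _ _))).
have mm k : measurable_fun setT (proper_mark k).
  exact: (measurableT_comp (@measurable_proper_mark k) (measurable_id_g_sigma_algebra (@cylinder_generator_measurable _ _))).
have A0 : Atom nu (xget 0 (Atom nu)) by exact: xgetPex exists_Atom.
have An0 x : Atom nu x -> x != 0 by rewrite /Atom/=; case: eqP => // ->; rewrite nu0 ltxx.
have mA k w : Atom nu (proper_mark k w).
  by rewrite /proper_mark; case: ifPn => // /negP Nw; have [] := @not_null_part w (contra_not (@mem_set _ _ _) Nw).
have lift (S : set (set T)) (f : T -> R) : @measurable_fun _ _ (g_sigma_algebraType S) R setT f ->
    @measurable_fun _ _ (g_sigma_algebraType <<s S >>) R setT f.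
  by move=> mf _ B mB; apply: sub_sigma_algebra; exact: mf.
have sub m m' n n' : (m <= m')%N -> (n <= n')%N ->
    <<s cylinder_generator m n >> `<=` <<s cylinder_generator m' n' >>.
  by move=> mm' nn'; apply: sub_sigma_algebra2; exact: sub_cylinder_generator.
(* Before gap [k] the first [k] gaps and marks are known; between gap [k] and mark [k], one more
   gap. *)
unshelve eexists (@Driver _ _ _ P nu (fun k => <<s cylinder_generator k k >>)
  (fun k => <<s cylinder_generator k.+1 k >>) proper_gap proper_mark
  (distribution P (E 0)) _ _ _ _ _ _ _ _ _ _ _ _ _ _ _).
- by move=> k; exact: smallest_sigma_algebra.
- by move=> k; exact: smallest_sigma_algebra.
- by move=> k; exact: gm.
- move=> A mA' A0'; apply: sub_sigma_algebra; apply: cylinder_generator_base; exact: H_null.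
- by move=> k; exact: sub.
- by move=> k; exact: sub.
- by move=> k; apply: lift; exact: measurable_proper_gap.
- by move=> k; apply: lift; exact: measurable_proper_mark.
- move=> k w; rewrite /proper_gap; case: ifPn => // /negP Nw.
  by have [] := @not_null_part w (contra_not (@mem_set _ _ _) Nw).
- move=> w M; apply: (@sum_unbounded (proper_gap ^~ w)) => [k|k]; rewrite /proper_gap; have [Nw|/negP Nw] := boolP (w \in N).
  + by [].
  + by have [] := @not_null_part w (contra_not (@mem_set _ _ _) Nw).
  + by exists k.
  + by have [_ _] := @not_null_part w (contra_not (@mem_set _ _ _) Nw); apply.
- by move=> k w; exact/An0/mA.
- exact: mA.
- by move=> B mB; exact: E_iid.2.
- move=> k A B GA mB; transitivity (P (A `&` E k @^-1` B)).
    apply: off => //; last exact: gm GA.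
    by move=> w Nw; rewrite /proper_gap memNset.
  rewrite gap_independent//; congr (_ * _)%E; exact/esym/E_iid.2.
- move=> k A B GA mB; rewrite -(mark_independent GA)//.
  apply: off => //; last exact: gm GA.
  by move=> w Nw; rewrite /proper_mark memNset.
split=> /=; first by move=> A HA; apply: sub_sigma_algebra; exact: cylinder_generator_base.
by move=> w Nw k; rewrite /proper_mark memNset.
Qed.

End driver_of_sequences.

(** A finite sum of elements of [A] is coded by the finite sequence of their indices in an
    enumeration. *)
Lemma countable_FS (R : realType) (A : set R) : countable A -> countable (FS A).
Proof.
move=> cA; have /pcard_geP/unsquash e : (A #<= [set: nat])%card by [].
apply: (@sub_countable _ _ (FS A) [set \sum_(n <- s) e n | s in [set: seq nat]]).
  apply: subset_card_le => x [k [a [Aa ->]]].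
  have ex i : exists n, e n = a i by have [n _ en] := @surj _ _ _ _ e _ (Aa i); exists n.
  exists [seq projT1 (cid (ex i)) | i <- index_enum 'I_k] => //.
  rewrite big_map; apply: eq_bigr => i _; exact: projT2 (cid (ex i)).
by apply: (sub_countable (card_image_le _ _)); exact: countableP.
Qed.

(** * Compensator of the jump measure *)

Section jump_measure_of_state.
Context d (T : measurableType d) (R : realType) (P : probability T R).
Variables (nu : probability R R) (D : driver P nu) (q : intensity D).
Local Notation tau k := (jump_time q k).
Local Notation G := (jump_filtration q).
Local Notation predT := (predictable_space G).
Local Notation leb := (@lebesgue_measure R).
Local Notation triple := (P \x time_mark nu)%E.

(** Marks are nonzero, so every jump time is seen by the jump measure; jump times increase strictly,
    so each is counted once. *)
Lemma jump_measure_stateE w (B : set (R * R)) :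
  jump_measure (state q ^~ w) B = (\sum_(k <oo) \d_(tau k.+1 w, mark D k w) B)%E.
Proof.
rewrite nneseries_esumT// /jump_measure.
rewrite (reindex_esum [set: nat] _ (fun k => tau k.+1 w)).
- by apply: eq_esum => k _; rewrite jump_state_jump_time.
- split=> [k _|j k _ _ jk|s [s0 js]].
  + by split; [exact: jump_time_gt0|rewrite jump_state_jump_time mark_neq0].
  + have [jk'|kj|//] := ltngtP j k.
    * by move: (lt_jump_time q w (jk' : (j.+1 < k.+1)%N)); rewrite jk ltxx.
    * by move: (lt_jump_time q w (kj : (k.+1 < j.+1)%N)); rewrite jk ltxx.
  + by have [k ->] := jump_state_neq0 s0 js; exists k.
Qed.

Lemma ge0_integral_jump_measure_state w (f : R * R -> \bar R) :
  measurable_fun setT f -> (forall z, 0 <= f z)%E ->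
  (\int[jump_measure (state q ^~ w)]_z f z = \sum_(k <oo) f (tau k.+1 w, mark D k w))%E.
Proof.
move=> mf f0.
pose m k : {measure set (R * R) -> \bar R} := \d_(tau k.+1 w, mark D k w).
transitivity (\int[mseries m 0]_z f z)%E.
  by apply: eq_measure_integral => B mB _; exact: jump_measure_stateE.
rewrite ge0_integral_measure_series//; apply: eq_eseriesr => k _.
by rewrite integral_dirac//= diracT mul1e.
Qed.

Definition state_compensator : random_measure T R := fun w =>
  density_measure (time_mark nu)
    (measurableT_comp (measurable_compensator_density q) (measurable_pair1 w))
    (fun z => compensator_density_ge0 q (w, z)).

Lemma ge0_integral_state_compensator w (f : R * R -> \bar R) :
  measurable_fun setT f -> (forall z, 0 <= f z)%E ->
  (\int[state_compensator w]_z f z =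
   \int[time_mark nu]_z (f z * (compensator_density q (w, z))%:E))%E.
Proof. by move=> mf f0; rewrite ge0_integral_density. Qed.

Section predictable_integrand.
Variable W : R -> T -> R -> \bar R.
Hypotheses (mW : predictable_function G W) (W0 : forall t w xi, (0 <= W t w xi)%E).

(** Predictability constrains [W] at nonnegative times only; extension by [0] gives a function
    measurable on the whole space. *)
Definition predictable_extension : predT * R -> \bar R :=
  (fun z => W z.1.1 z.1.2 z.2) \_ ((Rplus `*` setT) `*` setT).

Local Notation W' := predictable_extension.

Lemma predictable_extension_ge0 z : (0 <= W' z)%E.
Proof. by rewrite /W' patchE; case: ifP. Qed.

Let mRplusT : @measurable _ (predT * R)%type ((Rplus `*` setT) `*` setT).
Proof. by apply: measurableX => //; exact: measurable_Rplus_predictable. Qed.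

Lemma measurable_predictable_extension : @measurable_fun _ _ (predT * R)%type _ setT W'.
Proof. by apply/(measurable_restrictT _ mRplusT). Qed.

Lemma predictable_extensionE u w x : 0 <= u -> W' (u, w, x) = W u w x.
Proof.
move=> u0; rewrite /W' patchE mem_set//=; split => //; split => //.
by rewrite /Rplus/= in_itv/= u0.
Qed.

Lemma measurable_predictable_section w : measurable_fun setT (fun z : R * R => W' (z.1, w, z.2)).
Proof.
have m : @measurable_fun _ _ (R * R)%type (predT * R)%type setT (fun z => (z.1, w, z.2)).
  apply: (@measurable_fun_pair _ _ _ (R * R)%type predT R); last exact: measurable_snd.
  apply: (measurableT_comp (@measurable_id_predictable _ _ _ _ _ _ q)).
  by apply: measurable_fun_pair => //; exact: measurable_fst.
exact: (measurableT_comp measurable_predictable_extension m).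
Qed.

Lemma integral_predictable_extension (m : {measure set (R * R) -> \bar R}) (I : set R) w :
  I `<=` Rplus ->
  (\int[m]_(z in I `*` setT) W z.1 w z.2 = \int[m]_(z in I `*` setT) W' (z.1, w, z.2))%E.
Proof.
move=> IR; apply: eq_integral => -[u x] /set_mem[/= /IR + _].
by rewrite /Rplus/= in_itv/= andbT => u0; rewrite predictable_extensionE.
Qed.

Lemma integral_jump_measure_predictable w :
  (\int[jump_measure (state q ^~ w)]_(z in `]0%R, +oo[ `*` setT) W z.1 w z.2 =
   \sum_(k <oo) W' (jump_point q k w))%E.
Proof.
rewrite integral_predictable_extension; last first.
  by move=> u; rewrite /Rplus/= !in_itv/= !andbT => /ltW.
have mD : measurable (`]0%R, +oo[ `*` setT : set (R * R)) by exact: measurableX.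
rewrite integral_mkcond ge0_integral_jump_measure_state//.
- apply: eq_eseriesr => k _; rewrite patchE mem_set//; split=> //=.
  by rewrite in_itv/= jump_time_gt0.
- by apply/(measurable_restrictT _ mD); apply: measurable_funTS; exact: measurable_predictable_section.
- by move=> z; rewrite patchE; case: ifP => // _; exact: predictable_extension_ge0.
Qed.

Lemma integral_state_compensator_predictable w :
  (\int[state_compensator w]_(z in `]0%R, +oo[ `*` setT) W z.1 w z.2 =
   \int[time_mark nu]_z (W' (reassociate (w, z)) * (compensator_density q (w, z))%:E))%E.
Proof.
rewrite integral_predictable_extension; last first.
  by move=> u; rewrite /Rplus/= !in_itv/= !andbT => /ltW.
have mD : measurable (`]0%R, +oo[ `*` setT : set (R * R)) by exact: measurableX.
rewrite integral_mkcond ge0_integral_state_compensator//.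
- apply: eq_integral => -[u x] _; rewrite patchE.
  rewrite /compensator_density/=; have [u0|u0] := ltP 0 u.
    by rewrite mem_set//; split => //=; rewrite in_itv/= u0.
  by rewrite mulr0 !mule0.
- by apply/(measurable_restrictT _ mD); apply: measurable_funTS; exact: measurable_predictable_section.
- by move=> z; rewrite patchE; case: ifP => // _; exact: predictable_extension_ge0.
Qed.

Lemma state_compensation :
  (\int[P]_w \int[jump_random_measure (state q) w]_(z in `]0%R, +oo[ `*` setT) W z.1 w z.2 =
   \int[P]_w \int[state_compensator w]_(z in `]0%R, +oo[ `*` setT) W z.1 w z.2)%E.
Proof.
under eq_integral do rewrite integral_jump_measure_predictable.
under [RHS]eq_integral do rewrite integral_state_compensator_predictable.
rewrite integral_nneseries//; last 2 first.
- move=> k; exact: (measurableT_comp measurable_predictable_extension (@measurable_jump_point _ _ _ _ _ _ q k)).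
- by move=> k w _; exact: predictable_extension_ge0.
rewrite compensation//; last 2 first.
- exact: measurable_predictable_extension.
- exact: predictable_extension_ge0.
rewrite fubini_tonelli1//.
- apply: emeasurable_funM.
    exact: (measurableT_comp measurable_predictable_extension (@measurable_reassociate _ _ _ _ _ _ q)).
  by apply/measurable_EFinP; exact: measurable_compensator_density.
- move=> z; rewrite mule_ge0//; first exact: predictable_extension_ge0.
  by rewrite lee_fin compensator_density_ge0.
Qed.

Let past : set (predT * (R * R)) := [set z | 0 <= z.1.1 /\ 0 < z.2.1 <= z.1.1].

Let swap_time (z : predT * (R * R)) : predT * R := ((z.2.1, z.1.2), z.2.2).

Let m1 := @measurable_fst _ _ predT (R * R)%type.
Let m21 := measurableT_comp (@measurable_fst _ _ R R) (@measurable_snd _ _ predT (R * R)%type).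

Let measurable_past : @measurable _ (predT * (R * R))%type past.
Proof.
pose A : set (predT * (R * R)) := (Rplus `*` setT) `*` setT.
have mA : measurable A by apply: measurableX => //; exact: measurable_Rplus_predictable.
have mt : measurable_fun A (fun z : predT * (R * R) => z.1.1).
  apply: (@measurable_comp _ _ _ _ _ _ (Rplus `*` setT : set predT)).
  - exact: measurable_Rplus_predictable.
  - by move=> _ [z [Rz _] <-].
  - exact: measurable_predictable_time.
  - exact: measurable_funTS.
have mu : measurable_fun A (fun z : predT * (R * R) => z.2.1) by exact: measurable_funTS.
have m0 := measurable_fun_ltr (@measurable_cst _ _ _ _ A (0 : R)) mu.
have m : measurable_fun A (fun z : predT * (R * R) => (0 < z.2.1) && (z.2.1 <= z.1.1)).
  by apply: measurable_and => //; exact: measurable_fun_ler.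
have := m mA [set true] I; congr measurable; apply/seteqP; split=> -[[t w] [u x]].
  by move=> [[[+ _] _] /= ?]; rewrite /Rplus/= in_itv/= andbT.
by move=> [/= t0 ut]; split => //; split => //; split => //; rewrite /Rplus/= in_itv/= t0.
Qed.

(* On [0 < u <= t], an event of the filtration at a time [s < u] can be tested at [t]. *)
Let measurable_swap_time :
  @measurable_fun _ _ (predT * (R * R))%type (predT * R)%type past swap_time.
Proof.
apply: (@measurable_fun_pair_dom _ _ _ (predT * (R * R))%type predT R) => //; last first.
  by apply: measurable_funTS; apply: measurableT_comp => //; exact: measurable_snd.
apply: (@measurability _ _ (predT * (R * R))%type predT _ _ (predictable_rectangle G)) => // _ [_ [[A GA ->]|[s [r [A [s0 sr GA ->]]]]] <-].
  rewrite (_ : _ `&` _ = set0)//; apply/seteqP; split=> // -[[t w] [u x]] [[/= _ u0] [/= u00 _]].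
  by rewrite u00 ltxx in u0.
rewrite (_ : _ `&` _ = past `&` ((fun z : predT * (R * R) => z.2.1) @^-1` `]s, r]%classic `&`
  fst @^-1` [set z | s < z.1 /\ A z.2])).
  apply: measurableI => //; apply: measurableI.
    by rewrite -[_ @^-1` _]setTI; apply: m21 => //.
  by rewrite -[_ @^-1` _]setTI; apply: m1 => //; exact: measurable_predictable_after.
apply/seteqP; split=> -[[t w] [u x]] [pz /=].
  move=> [ur Aw]; split => //; split => //; split => //.
  move: ur pz => /=; rewrite in_itv/= => /andP[su _] [_ /andP[_ ut]].
  exact: lt_le_trans su ut.
by move=> [ur [_ Aw]].
Qed.

(** The integral up to [t] is the partial integral, over the time [u] and the jump [x], of a
    function on [predT * (R * R)] supported by [past]. That this function is measurable rests on
    [measurable_swap_time]. *)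
Lemma predictable_compensator_integral : predictable_process G
  (fun t w => \int[state_compensator w]_(z in `]0%R, t] `*` setT) W z.1 w z.2)%E.
Proof.
pose rate1 (z : predT) := q z.1 z.2 (left_state q z.1 z.2).
pose f (z : predT * (R * R)) := (W' (swap_time z) * (rate1 (swap_time z).1)%:E)%E.
have swap_Rplus : swap_time @` past `<=` (Rplus `*` setT) `*` setT.
  move=> _ [[[t w] [u x]] [/= _ /andP[u0 _]] <-]; split => //; split => //=.
  by rewrite /Rplus/= in_itv/= (ltW u0).
have mf : measurable_fun setT (f \_ past).
  apply/(measurable_restrictT _ measurable_past); apply: emeasurable_funM.
    exact: (measurableT_comp measurable_predictable_extension measurable_swap_time).
  apply/measurable_EFinP.
  apply: (@measurable_comp _ _ _ _ _ _ ((Rplus `*` setT) `*` setT : set (predT * R))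
    (fun z => rate1 z.1)) => //.
  apply: (@measurable_comp _ _ _ _ _ _ (Rplus `*` setT : set predT)).
  - exact: measurable_Rplus_predictable.
  - by move=> _ [z [Rz _] <-].
  - exact: measurable_predictable_rate.
  - exact: measurable_funTS.
have rate1_ge0 z : 0 <= rate1 z.
  have /andP[l _] := rate_bounds q z.1 z.2 (left_state q z.1 z.2).
  by rewrite (le_trans _ l)// ltW// rate_lb_gt0.
have f0 z : (0 <= (f \_ past) z)%E.
  rewrite patchE; case: ifP => // _; rewrite mule_ge0//; first exact: predictable_extension_ge0.
  by rewrite lee_fin.
have mF := @measurable_fun_fubini_tonelli_F _ _ predT (R * R)%type R (time_mark nu) (f \_ past) mf f0.
apply: (@eq_measurable_fun _ _ predT _ _ (fubini_F (time_mark nu) (f \_ past))); last exact: measurable_funTS.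
move=> [t w] /set_mem[/=]; rewrite /Rplus/= in_itv/= andbT => t0 _.
rewrite /fubini_F integral_predictable_extension; last first.
  by move=> u; rewrite /Rplus/= !in_itv/= !andbT => /andP[/ltW].
have mD : measurable (`]0%R, t] `*` setT : set (R * R)) by exact: measurableX.
rewrite [RHS]integral_mkcond ge0_integral_density//.
- apply: eq_integral => -[u x] _; rewrite !patchE.
  have [/andP[u0 ut]|ut] := boolP (0 < u <= t).
    rewrite mem_set; last by split => //=; rewrite u0 ut.
    rewrite mem_set; last by split => //=; rewrite in_itv/= u0 ut.
    by rewrite /f/= /compensator_density/= u0 mulr1.
  rewrite memNset; last by move=> [/= _]; exact/negP.
  by rewrite memNset ?mul0e//; move=> [/=]; rewrite in_itv/= (negbTE ut).
- by apply/(measurable_restrictT _ mD); apply: measurable_funTS; exact: measurable_predictable_section.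
- by move=> z; rewrite patchE; case: ifP => // _; exact: predictable_extension_ge0.
Qed.

End predictable_integrand.

Lemma is_compensator_state : is_compensator P G (jump_random_measure (state q)) state_compensator.
Proof.
split; first by move=> W mW W0; exact: predictable_compensator_integral.
by move=> W mW W0; exact: state_compensation.
Qed.

End jump_measure_of_state.

(** * Assembling the process *)

(** Tonelli for the indicator of a null set, in both orders. *)
Lemma ae_product_sections d1 d2 (T1 : measurableType d1) (T2 : measurableType d2)
    (R : realType) (m1 : {sigma_finite_measure set T1 -> \bar R})
    (m2 : {sigma_finite_measure set T2 -> \bar R}) (Q : T1 * T2 -> Prop) :
  {ae (m1 \x m2)%E, forall z, Q z} ->
  {ae m1, forall x, {ae m2, forall y, Q (x, y)}} /\
  {ae m2, forall y, {ae m1, forall x, Q (x, y)}}.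
Proof.
move=> [N [mN N0 QN]].
pose f z : \bar R := (\1_N z)%:E.
have mf : measurable_fun setT f by apply/measurable_EFinP; exact: measurable_indic.
have f0 z : (0 <= f z)%E by rewrite lee_fin.
have If : (\int[m1 \x m2]_z f z = 0)%E by rewrite integral_indic// setIT.
have fQ z : f z = 0%E -> Q z.
  rewrite /f indicE; have [_ [] /eqP|Nz _] := boolP (z \in N); first by rewrite oner_eq0.
  by apply: contrapT => /QN/mem_set; rewrite (negbTE Nz).
split.
- have m1f : measurable_fun setT (fubini_F m2 f) by exact: measurable_fun_fubini_tonelli_F.
  have : (\int[m1]_x `|fubini_F m2 f x| = 0)%E.
    by rewrite -[RHS]If fubini_tonelli1//; apply: eq_integral => x _; rewrite gee0_abs// integral_ge0.
  move=> /(ae_eq_integral_abs m1 measurableT m1f).1; apply: filterS => x /(_ I) Fx.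
  have mfx : measurable_fun setT (fun y => f (x, y)) by exact: (measurableT_comp mf (measurable_pair1 x)).
  have : (\int[m2]_y `|f (x, y)| = 0)%E.
    by rewrite -[RHS]Fx; apply: eq_integral => y _; rewrite gee0_abs.
  by move=> /(ae_eq_integral_abs m2 measurableT mfx).1; apply: filterS => y /(_ I)/fQ.
- have m2f : measurable_fun setT (fubini_G m1 f) by exact: measurable_fun_fubini_tonelli_G.
  have : (\int[m2]_y `|fubini_G m1 f y| = 0)%E.
    by rewrite -[RHS]If fubini_tonelli2//; apply: eq_integral => x _; rewrite gee0_abs// integral_ge0.
  move=> /(ae_eq_integral_abs m2 measurableT m2f).1; apply: filterS => y /(_ I) Fy.
  have mfy : measurable_fun setT (fun x => f (x, y)) by exact: (measurableT_comp mf (measurable_pair2 y)).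
  have : (\int[m1]_x `|f (x, y)| = 0)%E.
    by rewrite -[RHS]Fy; apply: eq_integral => x _; rewrite gee0_abs.
  by move=> /(ae_eq_integral_abs m1 measurableT mfy).1; apply: filterS => x /(_ I)/fQ.
Qed.

Lemma measurable_inv_pos d (X : measurableType d) (R : realType) (h : X -> R) :
  measurable_fun setT h -> (forall x, 0 < h x) -> measurable_fun setT (fun x => (h x)^-1).
Proof.
move=> mh h0; have -> : (fun x => (h x)^-1) = (fun x => h x `^ (-1)).
  by apply/funext => x; rewrite powR_inv1// ltW.
exact: (measurableT_comp (measurable_powR (-1)) mh).
Qed.

(** * From balance to conditional expectation *)

Section conditional_expectation.
Context d (T : measurableType d) (R : realType) (P : probability T R).
Variables (L U : R) (eta : R -> T -> R) (eta0 : T -> R) (t : R) (Y : T -> R) (h : R -> R).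
Hypotheses (L_gt0 : 0 < L) (LU : L <= U).
Hypotheses (meta : measurable_fun setT (eta t)) (meta0 : measurable_fun setT eta0).
Hypothesis eta_bounds : forall w, L <= eta t w <= U.
Hypothesis eta_eta0 : {ae P, forall w, eta t w = eta0 w}.
Hypotheses (mY : measurable_fun setT Y) (mh : measurable_fun setT h).
Hypothesis h_bounds : forall x, U^-1 <= h x <= L^-1.
Hypothesis bal : balanced P eta Y t h 0.

Let U_gt0 : 0 < U. Proof. exact: lt_le_trans LU. Qed.

Let h_gt0 x : 0 < h x.
Proof. by case/andP: (h_bounds x) => + _; apply: lt_le_trans; rewrite invr_gt0. Qed.

Let gm x := (h x)^-1.

Let gm_bounds x : 0 <= gm x <= U.
Proof.
rewrite invr_ge0 (ltW (h_gt0 x))/= -[leRHS]invrK lef_pV2 ?posrE// ?invr_gt0//.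
by case/andP: (h_bounds x).
Qed.

Let mgm : measurable_fun setT gm. Proof. exact: measurable_inv_pos. Qed.

Lemma cond_expectation_of_balanced : is_cond_expectation P (sigma_of Y) eta0 (fun w => (h (Y w))^-1).
Proof.
have e0 w : 0 <= eta t w by case/andP: (eta_bounds w) => + _; apply: le_trans; exact: ltW.
have eU w : `|eta t w| <= U by rewrite ger0_norm//; case/andP: (eta_bounds w).
have iE : P.-integrable setT (EFin \o eta t) by exact: bounded_integrable eU.
have ae : ae_eq P setT (EFin \o eta t) (EFin \o eta0).
  by apply: filterS eta_eta0 => w /= ->.
split.
- have [mE fE] := integrableP _ _ _ iE; apply/integrableP; split; first exact/measurable_EFinP.
  rewrite (_ : integral _ _ _ = \int[P]_w `|(EFin \o eta t) w|)%E//.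
  apply: ae_eq_integral => //; [|exact: measurableT_comp|].
    by apply: measurableT_comp => //; exact/measurable_EFinP.
  by apply: filterS ae => w + Tw; move=> /(_ Tw) ->.
- apply: (@bounded_integrable _ _ _ _ _ U); first exact: (measurableT_comp mgm mY).
  by move=> w; have /andP[? ?] := gm_bounds (Y w); rewrite ger0_norm.
- have mYs : @measurable_fun _ _ (g_sigma_algebraType (sigma_of Y)) R setT Y.
    by move=> _ B mB; rewrite setTI; apply: sub_sigma_algebra; exact: sigma_of_preimage.
  exact: (measurableT_comp mgm mYs).
move=> _ [B mB <-]; rewrite setTI.
have mYB : measurable (Y @^-1` B) by rewrite -[_ @^-1` _]setTI; exact: mY.
have -> : (\int[P]_(w in Y @^-1` B) (eta0 w)%:E = \int[P]_(w in Y @^-1` B) (eta t w)%:E)%E.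
  apply: ae_eq_integral => //; [exact/measurable_EFinP/measurable_funTS|
    exact/measurable_EFinP/measurable_funTS|].
  by apply: filterS eta_eta0 => w /= -> .
(* The factor [gm], the reciprocal of [h], cancels [h] in the balance and leaves [eta] on one side
   and [gm] on the other, both restricted to [B]; [U^-1] brings [phi] into the unit interval. *)
pose phi x : R := gm x * \1_B x * U^-1.
have mphi : measurable_fun setT phi.
  by apply: measurable_funM => //; apply: measurable_funM => //; exact: measurable_indic.
have phi1 x : 0 <= phi x <= 1.
  have /andP[g0 gU] := gm_bounds x.
  have U0 := ltW U_gt0; apply/andP; split.
    by apply: mulr_ge0; [apply: mulr_ge0|rewrite invr_ge0].
  rewrite ler_pdivrMr// mul1r.
  by rewrite indicE; case: (x \in B); rewrite ?mulr1// mulr0.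
have key : \int[P]_w (eta t w * (\1_B (Y w) * U^-1)) = \int[P]_w (gm (Y w) * (\1_B (Y w) * U^-1)).
  have := bal mphi (fun x => _ : `|phi x| <= 1).
  rewrite normr_le0 subr_eq0 => /(_ _)/eqP; rewrite /mean => e.
  transitivity (\int[P]_w (eta t w * h (Y w) * phi (Y w))).
    apply: eq_Rintegral => w _; rewrite /phi /gm.
    by rewrite -!mulrA [h _ * _]mulrA mulfV ?mul1r// gt_eqF.
  rewrite e; last by move=> x; have /andP[? ?] := phi1 x; rewrite ger0_norm.
  by apply: eq_Rintegral => w _; rewrite /phi -mulrA.
have lift (f : T -> R) : measurable_fun setT f -> (forall w, 0 <= f w <= U) ->
    ((\int[P]_w (f w * (\1_B (Y w) * U^-1)))%:E =
     U^-1%:E * \int[P]_(w in Y @^-1` B) (f w)%:E)%E.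
  move=> mf fU; have f0 w : 0 <= f w by case/andP: (fU w).
  have mB1 : measurable_fun setT (fun w => \1_B (Y w) : R) by exact: measurable_indic_comp.
  rewrite (@bounded_RintegralE _ _ _ _ _ 1); last 2 first.
  - by apply: measurable_funM => //; exact: measurable_funM.
  - move=> w; have /andP[a b] := fU w; have U0 := ltW U_gt0.
    rewrite ger0_norm; last by apply: mulr_ge0 => //; apply: mulr_ge0; rewrite ?invr_ge0.
    rewrite mulrA ler_pdivrMr// mul1r.
    by rewrite indicE; case: (_ \in B); rewrite ?mulr1// mulr0 ltW.
  rewrite [in RHS]integral_mkcond -ge0_integralZl//.
  - apply: eq_integral => w _; rewrite patchE indicE.
    have -> : (w \in Y @^-1` B) = (Y w \in B) by apply/idP/idP => /set_mem ?; exact/mem_set.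
    by case: (_ \in B); rewrite -?EFinM ?mul1r ?mul0r ?mulr0 ?mule0// mulrC.
  - by apply/(measurable_restrictT _ mYB); apply: measurable_funTS; exact/measurable_EFinP.
  - by move=> w _; rewrite patchE; case: ifP; rewrite ?lee_fin.
  - by rewrite lee_fin invr_ge0 ltW.
have := congr1 (fun r => U%:E * r%:E)%E key.
rewrite !lift//; last 2 first.
- exact: (measurableT_comp mgm mY).
- by move=> w; rewrite e0; case/andP: (eta_bounds w).
by rewrite !muleA -EFinM mulfV ?gt_eqF// !mul1e => ->.
Qed.

End conditional_expectation.

Lemma measurable_fun_predictable d (T : measurableType d) (R : realType)
    (F : R -> set (set T)) (eta : R -> T -> R) : F 0 setT ->
  (forall t, 0 <= t -> F t `<=` measurable) -> predictable_process F eta ->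
  measurable_fun (Rplus `*` setT) (fun z : R * T => eta z.1 z.2).
Proof.
move=> FT Fm peta; apply: (@measurable_comp _ _ _ (R * T)%type (predictable_space F) R
  (Rplus `*` setT) (fun z => eta z.1 z.2) (Rplus `*` setT) id) => //.
- exact: measurable_predictable_Rplus.
- by move=> _ [z Dz <-].
- by apply: measurable_funTS; exact: measurable_id_predictable_space.
Qed.

(** * Enforcing the bounds at every time, outcome and state *)

Section clamping.
Context d (T : measurableType d) (R : realType).
Variables (L U : R) (F : R -> set (set T)) (eta : R -> T -> R) (lambda : R -> R -> R) (S : set R).
Hypothesis LU : L <= U.

Definition clamp (r : R) : R := Num.max L (Num.min U r).

Lemma clamp_bounds r : L <= clamp r <= U.
Proof. by rewrite /clamp le_max lexx/= ge_max LU ge_min lexx. Qed.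

Lemma clamp_id r : L <= r <= U -> clamp r = r.
Proof. by move=> /andP[Lr rU]; rewrite /clamp min_r// max_r. Qed.

Lemma measurable_clamp : measurable_fun setT clamp.
Proof. by apply: measurable_maxr => //; exact: measurable_minr. Qed.

(** The assumed bounds hold almost everywhere, whereas an [intensity] needs them everywhere; at
    negative times [L] is a filler within the bounds. *)
Definition clamped_process u w := if 0 <= u then clamp (eta u w) else L.

Definition clamped_rate u x := if (0 <= u) && (x \in S) then clamp (lambda u x) else L.

Lemma clamped_process_bounds u w : L <= clamped_process u w <= U.
Proof. by rewrite /clamped_process; case: ifP; rewrite ?clamp_bounds// lexx. Qed.

Lemma clamped_rate_bounds u x : L <= clamped_rate u x <= U.
Proof. by rewrite /clamped_rate; case: ifP; rewrite ?clamp_bounds// lexx. Qed.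

Lemma measurable_clamped_process : F 0 setT ->
  (forall t, 0 <= t -> F t `<=` measurable) -> predictable_process F eta ->
  measurable_fun setT (fun z : R * T => clamped_process z.1 z.2).
Proof.
move=> FT Fm peta.
have mRT : @measurable _ (R * T)%type (Rplus `*` setT).
  by apply: measurableX => //; exact: measurable_itv.
have me := measurable_fun_predictable FT Fm peta.
have -> : (fun z : R * T => clamped_process z.1 z.2) =
    (fun z => if 0 <= z.1 then clamp (eta z.1 z.2) else L) by [].
apply: measurable_fun_if => //.
- by apply: measurable_fun_ler => //; exact: measurable_fst.
- apply: (measurableT_comp measurable_clamp); apply: measurable_funS me => //.
  by move=> [u w] [_ /= u0]; split => //; rewrite /Rplus/= in_itv/= andbT.
Qed.

Lemma measurable_clamped_rate : measurable S ->
  measurable_fun (Rplus `*` S) (fun z : R * R => lambda z.1 z.2) ->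
  measurable_fun setT (fun z : R * R => clamped_rate z.1 z.2).
Proof.
move=> mS ml; apply: measurable_fun_if => //.
- apply: measurable_and.
    by apply: measurable_fun_ler => //; exact: measurable_fst.
  apply: (@measurable_fun_bool _ (R * R)%type _ _ true).
  rewrite setTI (_ : _ @^-1` _ = snd @^-1` S).
    by rewrite -[_ @^-1` _]setTI; exact: measurable_snd.
  by apply/seteqP; split=> z h; [exact: set_mem|exact: mem_set].
- apply: (measurableT_comp measurable_clamp); apply: measurable_funS ml => //.
    by apply: measurableX => //; exact: measurable_itv.
  by move=> [u x] [_ /= /andP[u0 /set_mem xS]]; split => //; rewrite /Rplus/= in_itv/= andbT.
Qed.

End clamping.

Section state_process.
Context d (T : measurableType d) (R : realType) (P : probability T R).
Variables (nu : probability R R) (D : driver P nu) (q : intensity D).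
Local Notation tau k := (jump_time q k).
Local Notation leb := (@lebesgue_measure R).

Lemma state_series w t : 0 <= t ->
  series (fun k => mark D k w * (tau k.+1 w <= t)%R%:R)%R @ \oo --> state q t w.
Proof.
move=> t0; have /andP[jt tj] := jumps_uptoP q w t0.
apply: cvg_near_cst; near=> n; rewrite /state /series/= /position.
have jn : (jumps_upto q t w <= n)%N by near: n; exact: nbhs_infty_ge.
rewrite big_mkord -(subnKC jn) big_split_ord/= [X in _ + X]big1 ?addr0 => [|i _].
  apply: eq_bigr => i _; rewrite (le_trans _ jt) ?mulr1//.
  exact: le_jump_time.
by rewrite leNgt (lt_le_trans tj) ?mulr0//; apply: le_jump_time; rewrite ltnS leq_addr.
Unshelve. all: by end_near.
Qed.

Lemma pure_jump_process_state (J : nat -> {RV P >-> R}) :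
  discrete_probability nu -> nu [set 0] = 0%E -> iid J nu ->
  {ae P, forall w k, mark D k w = J k w} -> pure_jump_process P (state q).
Proof.
move=> dnu nu0 iJ aeJ.
pose tau' k : {RV P >-> R} := mfun_Sub (mem_set (measurable_jump_timeT q k.+1)).
exists tau', J, nu; split => //.
- by apply: aeW => w; split; [exact: jump_time_gt0|move=> k; exact: jump_time_lt].
- move=> k; have := iJ.2 k (~` [set 0]) (measurableC (measurable_set1 0)).
  have -> : nu [set~ 0] = 1%E by rewrite probability_setC// nu0 sube0.
  move=> <-.
  by congr (P _); apply/seteqP; split=> w /= /eqP.
- apply: filterS aeJ => w Jw t t0.
  rewrite (_ : (fun k => J k w * _) = (fun k => mark D k w * (tau k.+1 w <= t)%R%:R)).
    exact: state_series.
  by apply/funext => k; rewrite Jw.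
Qed.

Lemma integral_mul_indic_section (r : R) (B : set (R * R)) u : measurable B ->
  (\int[nu]_x (r * \1_B (u, x))%:E = r%:E * nu (xsection B u))%E.
Proof.
move=> mB; have mBu := measurable_xsection u mB.
under eq_integral do rewrite EFinM.
rewrite integralZl//; last first.
  have := @bounded_integrable _ _ _ nu (\1_(xsection B u)) 1 (measurable_indic mBu).
  have e : (fun x => (\1_B (u, x))%:E) = EFin \o (\1_(xsection B u) : R -> R).
    by apply/funext => x; rewrite /= !indicE mem_xsection.
  rewrite e; apply => x; rewrite indicE; case: (_ \in _); rewrite ?normr1 ?normr0//.
congr (_ * _)%E.
by under eq_integral do rewrite indicE -mem_xsection -indicE; rewrite integral_indic// setIT.
Qed.

Lemma state_compensatorE w (B : set (R * R)) : measurable B ->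
  state_compensator q w B =
  (\int[leb]_u ((q u w (left_state q u w) * (0 < u)%R%:R)%:E * nu (xsection B u)))%E.
Proof.
move=> mB; have mc : measurable_fun setT (fun z : R * R => (compensator_density q (w, z))%:E).
  apply/measurable_EFinP; exact: (measurableT_comp (measurable_compensator_density q) (measurable_pair1 w)).
rewrite -[LHS]/(\int[time_mark nu]_(z in B) (compensator_density q (w, z))%:E)%E.
rewrite [LHS]integral_mkcond ge0_integral_time_mark; last 2 first.
- by apply/(measurable_restrictT _ mB); apply: measurable_funTS; exact: mc.
- by move=> z; rewrite patchE; case: ifP => // _; rewrite lee_fin compensator_density_ge0.
apply: eq_integral => u _; rewrite -integral_mul_indic_section//.
by apply: eq_integral => x _; rewrite patchE indicE; case: ifP; rewrite ?mulr1 ?mulr0.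
Qed.

Lemma state_compensator_ae w (a : R -> R) : measurable_fun Rplus a ->
  {ae leb, forall u, 0 < u -> q u w (left_state q u w) = a u} ->
  forall B : set (R * R), measurable B ->
  (state_compensator q w B = \int[leb]_(u in Rplus) \int[nu]_xi (a u * \1_B (u, xi))%:E)%E.
Proof.
move=> ma aea B mB.
have mR : measurable (Rplus : set R) by exact: measurable_itv.
have mx : measurable_fun setT (fun u => nu (xsection B u)) by exact: measurable_fun_xsection.
rewrite state_compensatorE// [RHS]integral_mkcond.
apply: ae_eq_integral => //.
- apply: emeasurable_funM => //; apply/measurable_EFinP.
  have m := measurableT_comp (measurable_compensator_density q) (measurable_pair1 w).
  exact: (measurableT_comp m (measurable_pair2 (0 : R))).
- apply/(measurable_restrictT _ mR).
  apply: (@eq_measurable_fun _ _ _ _ _ (fun u => (a u)%:E * nu (xsection B u))%E).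
    by move=> u _; rewrite integral_mul_indic_section.
  apply: emeasurable_funM; first exact/measurable_EFinP.
  exact: measurable_funTS.
(* The compensator lives on [0 < u] and the claimed density on [0 <= u]; they differ on a null set
   of times. *)
have n0 : {ae leb, forall u, u != 0}.
  exists [set 0]; split; [exact: measurable_set1|exact: lebesgue_measure_set1|].
  by move=> u /= /negP; rewrite negbK => /eqP.
apply: (@filterS2 _ _ (ae_filter_ringOfSetsType leb) _ _ _ _ n0 aea) => u u0 au _.
rewrite patchE.
have [u0'|u0'|/esym/eqP] := ltgtP 0 u; last by rewrite (negbTE u0).
  rewrite mem_set; last by rewrite /Rplus/= in_itv/= ltW.
  by rewrite integral_mul_indic_section// mulr1 au.
by rewrite memNset ?mulr0 ?mul0e// /Rplus/= in_itv/= andbT leNgt u0'.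
Qed.

End state_process.

(** A countable union of null sets is null. This turns a bound for each fixed state into a bound
    along the random path. *)
Lemma ae_forall_countable d (T : measurableType d) (R : realType)
    (mu : {measure set T -> \bar R}) (S : set R) (Q : R -> T -> Prop) : countable S ->
  (forall x, S x -> {ae mu, forall t, Q x t}) -> {ae mu, forall t, forall x, S x -> Q x t}.
Proof.
move=> cS SQ; have /pcard_geP/unsquash e : (S #<= [set: nat])%card by [].
have : {ae mu, forall t, forall n, S (e n) -> Q (e n) t}.
  apply/ae_foralln => n; have [Sn|Sn] := pselect (S (e n)); last by apply: aeW.
  by apply: filterS (SQ _ Sn).
apply: filterS => t h x Sx; have [n _ en] := @surj _ _ _ _ e x Sx.
by rewrite -en; apply: h; rewrite en.
Qed.

Theorem theorem4p3 (R : realType) (d : measure_display) (Omega : measurableType d)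
    (P : probability Omega R) (F : R -> set (set Omega)) (L U : R)
    (nu : probability R R) (eta : R -> Omega -> R) (lambda : R -> R -> R)
    (E J : nat -> {RV P >-> R})
    (F_filtration : filtration F)
    (F_usual : usual_conditions P F)
    (L_gt0 : 0 < L) (L_lt_U : L < U)
    (nu_discrete : discrete_probability nu)
    (nu_0 : nu [set 0] = 0%E)
    (nu_first_moment : (\int[nu]_xi `|xi|%:E < +oo)%E)
    (eta_predictable : predictable_process F eta)
    (eta_bounds : {ae (P \x lebesgue_measure)%E, forall z : Omega * R,
       0 <= z.2 -> L <= eta z.2 z.1 <= U})
    (eta_hoelder : exists alpha : R, 0 < alpha <= 1 /\
       forall S : R, 0 < S -> exists C : R, 0 < C /\
         forall s t, 0 <= s <= S -> 0 <= t <= S ->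
           ('E_P[(fun w => `|eta t w - eta s w|)%R]
              <= (C * `|t - s| `^ alpha)%R%:E)%E)
    (lambda_measurable : measurable_fun (Rplus `*` FS (Atom nu))
       (fun z : R * R => lambda z.1 z.2))
    (lambda_ge0 : forall t x, 0 <= t -> FS (Atom nu) x -> 0 <= lambda t x)
    (lambda_bounds : forall x, FS (Atom nu) x ->
       {ae lebesgue_measure, forall t : R, 0 <= t -> L <= lambda t x <= U})
    (E_iid : iid E (exponential_prob 1))
    (J_iid : iid J nu)
    (FEJ_independent : mutually_independent P
       (tnth [tuple F_infty F; sigma_of_seq E; sigma_of_seq J])) :
  exists (G : R -> set (set Omega)) (X : R -> Omega -> R) (gamma : R -> R -> R),
    let X_ t w := left_limit (X ^~ w) t in
    [/\ [/\ filtration G, usual_conditions P G &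
            forall t, 0 <= t -> F t `<=` G t],
        [/\ adapted G X, pure_jump_process P X & {ae P, forall w, X 0 w = 0}],
        [/\ measurable_fun (Rplus `*` setT) (fun z : R * R => gamma z.1 z.2),
            forall t x, 0 <= t -> 0 < gamma t x &
            {ae lebesgue_measure, forall t : R, 0 <= t ->
               is_cond_expectation P (sigma_of (X_ t)) (eta t)
                 (fun w => gamma t (X_ t w))}] &
        has_compensator_density P G (jump_random_measure X)
          (fun t w => eta t w / gamma t (X_ t w) * lambda t (X_ t w)) nu].
Proof.
have [F_sigma F_meas _] := F_filtration; have [_ F_null] := F_usual; have LU := ltW L_lt_U.
have FH t : 0 <= t -> F t `<=` F_infty F.
  move=> t0 A FA; apply: sub_sigma_algebra; exists t => //.
  by rewrite /Rplus/= in_itv/= t0.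
have FT : F 0 setT.
  by have := @measurableT _ (g_sigma_algebraType (F 0)); rewrite /measurable/= sigma_algebra_id//; exact: F_sigma.
have H_sigma : sigma_algebra setT (F_infty F) by exact: smallest_sigma_algebra.
have H_meas : F_infty F `<=` measurable.
  apply: smallest_sub; first exact: sigma_algebra_measurable.
  by move=> A [t]; rewrite /Rplus/= in_itv/= andbT => t0; exact: F_meas.
have H_null N : measurable N -> P N = 0%E -> F_infty F N.
  by move=> mN N0; apply: (FH 0 (lexx _)); exact: F_null.
(* The whole of [F_infty] is made initial information, so that [eta] at all times is known before
   the first jump. *)
have [D [HD markJ]] := exists_driver H_sigma H_meas H_null E_iid J_iid FEJ_independent nu_discrete nu_0.
have ae_mark : {ae P, forall w k, mark D k w = J k w}.
  exists (null_part nu E J); split.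
  - exact: measurable_null_part.
  - exact: null_part0.
  - by move=> w nJ; apply: contrapT => /markJ.
pose S := FS (Atom nu).
have cS : countable S by apply: countable_FS; exact: countable_Atom.
have mS : measurable S by exact: (countable_measurable (@measurable_set1 R) cS).
(* The clamped versions drive the process; along almost every path they agree with the given ones at
   almost every time. *)
pose eta' := clamped_process L U eta; pose lam' := clamped_rate L U lambda S.
have eb u w : L <= eta' u w <= U by exact: clamped_process_bounds.
have lb u x : L <= lam' u x <= U by exact: clamped_rate_bounds.
have meta' : @measurable_fun _ _ (R * g_sigma_algebraType (pre D 0))%type R setT
    (fun z => eta' z.1 z.2).
  apply: (@measurable_clamped_process _ (g_sigma_algebraType (pre D 0)) R L U F eta) => //.
  by move=> t t0 A FA; apply/pre_measurableE/HD; exact: FH FA.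
have mlam' : measurable_fun setT (fun z : R * R => lam' z.1 z.2).
  exact: measurable_clamped_rate.
have [g bal] := exists_balanced_weight L_gt0 LU meta' eb mlam' lb cS.
pose q := weighted_intensity L_gt0 LU meta' eb mlam' lb g.
have g0 u x : 0 < g u x by exact: (wt_gt0 L_gt0 LU).
have mg u : measurable_fun setT (g u) by exact: (wt_admissible L_gt0 LU g u).1.
have meta : measurable_fun (Rplus `*` setT) (fun z : R * Omega => eta z.1 z.2).
  exact: (measurable_fun_predictable FT F_meas eta_predictable).
have [ae_w ae_t] := ae_product_sections eta_bounds.
(* The balanced weight is the reciprocal of the conditional expectation, hence this choice of
   [gamma]. *)
exists (jump_filtration q), (state q), (fun t x => (g t x)^-1) => X_.
have -> : X_ = left_state q by apply/funext => t; apply/funext => w; exact: left_limit_state.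
split.
- split; [exact: filtration_jump_filtration|exact: usual_conditions_jump_filtration|].
  by move=> t t0 A FA; apply: pre0_jump_filtration; apply: HD; exact: FH FA.
- split; first exact: adapted_state.
    exact: pure_jump_process_state ae_mark.
  by apply: aeW => w; exact: state0.
- split.
  + apply: measurable_funTS; apply: (measurable_inv_pos (wt_measurable g)) => z; exact: g0.
  + by move=> t x _; rewrite invr_gt0.
  + apply: filterS ae_t => t aet t0.
    apply: (@cond_expectation_of_balanced _ _ _ P L U eta' (eta t) t (left_state q t) (g t)) => //.
    * have m := measurable_clamped_process L U FT F_meas eta_predictable.
      exact: (measurableT_comp m (measurable_pair1 t)).
    * apply: (@measurable_comp _ _ _ Omega (R * Omega)%type R (Rplus `*` setT)
        (fun z => eta z.1 z.2) setT (pair t)) => //.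
      - by apply: measurableX => //; exact: measurable_itv.
      - by move=> _ [w _ <-]; split => //; rewrite /Rplus/= in_itv/= t0.
    * apply: filterS aet => w /(_ t0) b; rewrite /eta' /clamped_process t0; exact: clamp_id.
    * exact: measurable_left_state_at.
    * by move=> x; exact: wt_bounds.
exists (state_compensator q); first exact: is_compensator_state.
have ae_lambda := ae_forall_countable cS lambda_bounds.
apply: filterS ae_w => w aew; apply: state_compensator_ae.
  have mX : measurable_fun Rplus (fun t => left_state q t w).
    apply: measurable_funTS.
    exact: (measurableT_comp (measurable_left_state_joint q) (measurable_pair2 w)).
  have mtX : measurable_fun Rplus (fun t : R => (t, left_state q t w)).
    by apply: measurable_fun_pair_dom => //; exact: measurable_itv.
  apply: measurable_funM; first apply: measurable_funM.
  - apply: (@measurable_comp _ _ _ R (R * Omega)%type R (Rplus `*` setT)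
      (fun z => eta z.1 z.2) Rplus (fun t => (t, w))) => //.
    + by apply: measurableX => //; exact: measurable_itv.
    + by move=> _ [t Rt <-].
    + by apply: measurable_funTS; exact: measurable_pair2.
  - under eq_fun do rewrite invrK.
    exact: (measurableT_comp (wt_measurable g) mtX).
  - apply: (@measurable_comp _ _ _ R (R * R)%type R (Rplus `*` S)
      (fun z => lambda z.1 z.2) Rplus (fun t => (t, left_state q t w))) => //.
    + by apply: measurableX => //; exact: measurable_itv.
    + by move=> _ [t Rt <-]; split => //; exact: FS_position.
(* At almost every time the bounds hold for [eta] on this path and for [lambda] at all countably
   many states, so both clamps act as the identity. *)
apply: (@filterS2 _ _ (ae_filter_ringOfSetsType (@lebesgue_measure R)) _ _ _ _ aew ae_lambda).
move=> u eu lu u0; have Su : S (left_state q u w) by exact: FS_position.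
rewrite /= /weighted_rate /eta' /lam' /clamped_process /clamped_rate (ltW u0) mem_set//=.
rewrite clamp_id; last by apply: eu; exact: ltW.
rewrite clamp_id; last by apply: lu => //; exact: ltW.
by rewrite invrK mulrAC.
Qed.
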